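(* Let $x\in\mathbb R^d$, let $t$ (a power of two) and $r$ (odd) be positive integers, $D=rt$, $\sigma\ge0$, and let $w=\Omega(\log d)$. Let the hash functions $g_1,\dots,g_r:\{0,\dots,d-1\}\to[t]$ and $s_1,\dots,s_r:\{0,\dots,d-1\}\to\{\pm1\}$ be obtained from the output of FastPRG with block size $w$ as described in the context, and let $\boldsymbol\nu\sim N(0,\sigma^2)^D$ be independent of them. Define $\mathrm{PCS}(x)=\mathrm{CS}(x)+\boldsymbol\nu$ and, for $\ell\in\{0,\dots,d-1\}$, $\hat x_\ell=\mathrm{median}\{s_i(\ell)\,\mathrm{PCS}(x)_{i,g_i(\ell)}:i\in[r]\}$. Then for every $\alpha\in[0,1]$ and every $\ell$, $$\Pr\big[|\hat x_\ell-x_\ell|\ge\alpha\max(\Delta,\sigma)\big]\le 2\exp(-\Omega(\alpha^2 r))+O(2^{-cw}),\qquad\Delta=\|\mathrm{tail}_t(x)\|_2/\sqrt t,$$ where $c>0$ is an absolute constant.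
   Context: CountSketch: $\mathrm{CS}(x)_{i,j}=\sum_{\ell=0}^{d-1}s_i(\ell)x_\ell[g_i(\ell)=j]$ for $(i,j)\in[r]\times[t]$. $\mathrm{tail}_t(x)$ is $x$ with its $t$ largest-magnitude entries set to zero. FastPRG with block size $n=w$ and integer parameters $b\ge2,k$ with $rd\le b^k\le 2^{cw}$ ($c>0$ a sufficiently small absolute constant): draw $\mathbf x$ uniform in $\{0,1\}^w$ and $bk$ independent functions $\mathbf h_i^{(j)}:\{0,1\}^w\to\{0,1\}^w$ ($0\le i<k$, $0\le j<b$) from a $2$-wise independent family; output the string $\boldsymbol\gamma$ of $b^k$ blocks of $w$ bits whose block $j$ (base-$b$ digits $j_{k-1}\cdots j_0$) is $\mathbf h_0^{(j_0)}(\mathbf h_1^{(j_1)}(\cdots\mathbf h_{k-1}^{(j_{k-1})}(\mathbf x)))$. For $i\in[r]$ and $\rho\in\{0,\dots,d-1\}$, block number $(i-1)d+\rho$ determines $s_i(\rho)$ (as $2\beta-1$ for one bit $\beta$ of the block) and $g_i(\rho)$ (as $1$ plus the integer given by $\log_2 t$ other bits of the block).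
   Formalization: Assumes in addition t ≥ 2 and max(Δ,σ) > 0: for t = 1 the bound fails (x = (2,1), σ = 0, smaller coordinate, α = 1), and for Δ = σ = 0 the event |x̂_ℓ − x_ℓ| ≥ 0 has probability 1. *)

(* Defs.v *)
From mathcomp Require Export all_boot all_order all_algebra.
From mathcomp Require Export all_classical all_reals all_analysis.
Export Order.TTheory GRing.Theory Num.Def Num.Theory.
Export numFieldNormedType.Exports.

Set Implicit Arguments.
Unset Strict Implicit.
Unset Printing Implicit Defensive.

Local Open Scope classical_set_scope.
Local Open Scope ring_scope.

Section FastPRG.

Definition block (w : nat) : finType := w.-tuple bool.

(* The family is indexed by a finite set of keys and a member is drawn through
   a uniform key; two distinct inputs are hashed to a uniform pair of values. *)
Definition two_wise_independent (w : nat) (K : finType)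
    (H : K -> block w -> block w) : Prop :=
  forall x y a b : block w, x != y ->
    (#|[set key : K | (H key x == a) && (H key y == b)]%SET| * (2 ^ w) ^ 2)%N
    = #|K|.

Definition digit (b : nat) (b_gt0 : (0 < b)%N) (j i : nat) : 'I_b :=
  Ordinal (ltn_pmod (j %/ b ^ i) b_gt0).

(* Right fold over i = 0, ..., k - 1: h 0 is applied last and h (k - 1) first. *)
Definition fastprg_block (w b k : nat) (b_gt0 : (0 < b)%N)
    (h : 'I_k -> 'I_b -> block w -> block w) (x : block w) (j : nat) : block w :=
  foldr (fun i y => h i (digit b_gt0 j i) y) x (enum 'I_k).

Lemma bits_value_subproof (m w : nat) (q : 'I_m -> 'I_w) (B : block w) :
  (\sum_(e < m) tnth B (q e) * 2 ^ e < 2 ^ m)%N.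
Proof.
elim: m q => [|m IHm] q; first by rewrite big_ord0.
rewrite big_ord_recr /= expnS mul2n -addnn -addSn.
apply: leq_add; first exact: (IHm (fun e => q (widen_ord (leqnSn m) e))).
by case: (tnth _ _); rewrite ?mul1n ?mul0n.
Qed.

(* Buckets are numbered from 0, so the "1 plus" of the numbering from 1
   disappears. *)
Definition block_bucket (m w : nat) (q : 'I_m -> 'I_w) (B : block w) :
    'I_(2 ^ m) :=
  Ordinal (bits_value_subproof q B).

Definition block_sign (R : pzRingType) (w : nat) (p : 'I_w) (B : block w) : R :=
  (tnth B p)%:R *+ 2 - 1.

(* Rows are numbered from 0. *)
Definition hash_block (w d r : nat) (gamma : nat -> block w)
    (i : 'I_r) (rho : 'I_d) : block w :=
  gamma (i * d + rho)%N.

End FastPRG.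

Section CountSketch.
Variable R : realType.

Definition CS (d r t : nat) (g : 'I_r -> 'I_d -> 'I_t) (s : 'I_r -> 'I_d -> R)
    (x : 'rV[R]_d) : 'M[R]_(r, t) :=
  \matrix_(i, j) \sum_(l < d) s i l * x 0 l * (g i l == j)%:R.

(* The middle element of the sorted values, for r odd. *)
Definition median (r : nat) (f : 'I_r -> R) : R :=
  nth 0 (sort <=%R [seq f i | i <- enum 'I_r]) r./2.

Definition estimate (d r t : nat) (g : 'I_r -> 'I_d -> 'I_t)
    (s : 'I_r -> 'I_d -> R) (Y : 'M[R]_(r, t)) (l : 'I_d) : R :=
  median (fun i => s i l * Y i (g i l)).

(* Ties in magnitude are broken in favour of the smaller index, so that exactly
   min(t, d) entries are zeroed; the norm does not depend on the choice. *)
Definition entries_before (d : nat) (x : 'rV[R]_d) (l : 'I_d) : {set 'I_d} :=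
  [set j | (`|x 0 l| < `|x 0 j|) || ((`|x 0 j| == `|x 0 l|) && (j < l)%N)]%SET.

Definition tail (d t : nat) (x : 'rV[R]_d) : 'rV[R]_d :=
  \row_l (if (#|entries_before x l| < t)%N then 0 else x 0 l).

Definition l2norm (d : nat) (x : 'rV[R]_d) : R :=
  Num.sqrt (\sum_(l < d) x 0 l ^+ 2).

End CountSketch.

Section Randomness.
Context (R : realType) (disp : measure_display) (Omega : measurableType disp).
Variable P : probability Omega R.

Definition uniform_rv (S : finType) (Y : Omega -> S) : Prop :=
  forall v : S, measurable (Y @^-1` [set v]) /\
    P (Y @^-1` [set v]) = ((#|S|%:R)^-1)%:E.

(* [normal_prob] is only meaningful for a nonzero standard deviation. *)
Definition gaussian_law (sigma : R) : set (measurableTypeR R) -> \bar R :=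
  if sigma == 0 then dirac (0 : measurableTypeR R) else normal_prob 0 sigma.

Definition mutually_independent (I : finType) (F : I -> set_system Omega) :
    Prop :=
  forall (J : {set I}) (E : I -> set Omega),
    (forall i, i \in J -> F i (E i)) ->
    P (\bigcap_(i in [set` J]) E i) = (\prod_(i in J) P (E i))%E.

Definition pcs_events (w b k r t : nat) (K : finType) (X : Omega -> block w)
    (key : 'I_k -> 'I_b -> Omega -> K) (nu : 'I_r -> 'I_t -> {RV P >-> R})
    (a : unit + 'I_k * 'I_b + 'I_r * 'I_t) : set_system Omega :=
  match a with
  | inl (inl _) => preimage_set_system setT X setT
  | inl (inr (i, j)) => preimage_set_system setT (key i j) setT
  | inr (i, j) => preimage_set_system setT (nu i j) measurable
  end.

Definition pcs_randomness (w b k r t : nat) (K : finType)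
    (X : Omega -> block w) (key : 'I_k -> 'I_b -> Omega -> K)
    (sigma : R) (nu : 'I_r -> 'I_t -> {RV P >-> R}) : Prop :=
  [/\ uniform_rv X,
      forall i j, uniform_rv (key i j),
      forall i j (A : set (measurableTypeR R)), measurable A ->
        distribution P (nu i j) A = gaussian_law sigma A
    & mutually_independent (pcs_events X key nu)].

End Randomness.

(* Main.v *)
(** The row statistics are not functions of bounded complexity of the blocks, so
    the usual finite-automaton form of Nisan's argument does not apply to real
    vectors. What it needs is weaker: replacing one group of [b] blocks (produced
    from one seed block by [b] hash functions) by independent blocks changes the
    expectation of a test by at most the uniform deviation, over all ways of
    fixing the other blocks, between the empirical and the true mean of the
    restricted test. Pairwise independence bounds each single deviation by
    [2^(-w/2)] on average. The test "at least [R0] rows have error at least [a]",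
    restricted to a window, is a combination of few indicators of the form
    [c = c0, V >= theta, V' >= theta'], where [c] counts the rows inside the
    window, [V, V'] are the partial sums of the two rows cut by its ends, and only
    the thresholds depend on the outside; quantile cuts make this class finite.
    The bucket of the queried coordinate is a label of the row, so the number of
    buckets enters polynomially; when it exceeds [2^(w/32)], truncating the
    buckets to [w/32] bits shows that no row has a collision, and the row errors
    are those of the zero vector.

    For independent blocks, a row sum of lazy signs is the difference of two
    independent copies of a sum of Bernoulli variables, hence close to zero by
    Chebyshev's inequality and the pigeonhole principle. With the Gaussian noise
    and the symmetry of the sign of the queried coordinate, a row errs by [a] in a
    given direction with probability at most [1/2] minus a multiple of [alpha],
    and Chernoff's bound applies to the rows. *)
Require Import Defs.
From mathcomp Require Import ring lra zify measurable_realfun.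

Set Implicit Arguments.
Unset Strict Implicit.
Unset Printing Implicit Defensive.

Local Open Scope ring_scope.

(** * Finite averages *)

Section Averages.
Variable R : realFieldType.

Definition avg (T : finType) (f : T -> R) : R := (\sum_t f t) / #|T|%:R.

(** Expectation over [n] independent uniform draws, nested so that the first draws split off by
    computation and by [iavg_cat]. *)
Fixpoint iavg (T : finType) (n : nat) (F : seq T -> R) : R :=
  if n is n'.+1 then avg (fun a => iavg n' (fun s => F (a :: s)))
  else F [::].

Lemma eq_avg (T : finType) (f g : T -> R) : f =1 g -> avg f = avg g.
Proof. by move=> fg; rewrite /avg (eq_bigr g). Qed.

Lemma avgD (T : finType) (f g : T -> R) :
  avg (fun t => f t + g t) = avg f + avg g.
Proof. by rewrite /avg big_split mulrDl. Qed.

Lemma avgN (T : finType) (f : T -> R) : avg (fun t => - f t) = - avg f.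
Proof. by rewrite /avg sumrN mulNr. Qed.

Lemma avgB (T : finType) (f g : T -> R) :
  avg (fun t => f t - g t) = avg f - avg g.
Proof. by rewrite avgD avgN. Qed.

Lemma avgZ (T : finType) (a : R) (f : T -> R) :
  avg (fun t => a * f t) = a * avg f.
Proof. by rewrite /avg -mulr_sumr mulrA. Qed.

Lemma avg_sum (T I : finType) (f : I -> T -> R) :
  avg (fun t => \sum_i f i t) = \sum_i avg (f i).
Proof. by rewrite /avg exchange_big /= mulr_suml. Qed.

Lemma avg_cst (T : finType) (a : R) : (0 < #|T|)%N -> avg (fun _ : T => a) = a.
Proof.
move=> T0; rewrite /avg sumr_const -[a *+ _]mulr_natr mulfK //.
by rewrite pnatr_eq0 -lt0n.
Qed.

Lemma ler_avg (T : finType) (f g : T -> R) :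
  (forall t, f t <= g t) -> avg f <= avg g.
Proof. by move=> fg; rewrite ler_wpM2r ?invr_ge0 ?ler0n// ler_sum. Qed.

Lemma avg_ge0 (T : finType) (f : T -> R) : (forall t, 0 <= f t) -> 0 <= avg f.
Proof. by move=> f0; rewrite divr_ge0 ?sumr_ge0 ?ler0n. Qed.

Lemma ler_norm_avg (T : finType) (f : T -> R) :
  `|avg f| <= avg (fun t => `|f t|).
Proof.
rewrite /avg normrM (ger0_norm (_ : 0 <= _^-1)) ?invr_ge0 ?ler0n//.
by rewrite ler_wpM2r ?invr_ge0 ?ler0n ?ler_norm_sum.
Qed.

Lemma exchange_avg (T U : finType) (f : T -> U -> R) :
  avg (fun t => avg (f t)) = avg (fun u => avg (f^~ u)).
Proof.
rewrite /avg -mulr_suml exchange_big /= -[in RHS]mulr_suml.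
by rewrite -!mulrA [X in _ * X]mulrC.
Qed.

Lemma avg_prod (T U : finType) (f : T * U -> R) :
  avg f = avg (fun t => avg (fun u => f (t, u))).
Proof.
rewrite /avg -mulr_suml pair_bigA /= card_prod natrM invfM mulrA -!mulrA.
by rewrite [X in _ * X]mulrC; congr (_ * _); apply: eq_bigr => -[].
Qed.

Lemma eq_iavg (T : finType) (n : nat) (F G : seq T -> R) :
  (forall s, size s = n -> F s = G s) -> iavg n F = iavg n G.
Proof.
elim: n F G => [|n IH] F G FG /=; first exact: FG.
by apply: eq_avg => a; apply: IH => s ss; apply: FG; rewrite /= ss.
Qed.

Lemma ler_iavg (T : finType) (n : nat) (F G : seq T -> R) :
  (forall s, size s = n -> F s <= G s) -> iavg n F <= iavg n G.
Proof.
elim: n F G => [|n IH] F G FG /=; first exact: FG.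
by apply: ler_avg => a; apply: IH => s ss; apply: FG; rewrite /= ss.
Qed.

Lemma iavgB (T : finType) (n : nat) (F G : seq T -> R) :
  iavg n (fun s => F s - G s) = iavg n F - iavg n G.
Proof.
elim: n F G => [|n IH] F G //=.
by rewrite -avgB; apply: eq_avg => a; rewrite IH.
Qed.

Lemma iavgZ (T : finType) (n : nat) (a : R) (F : seq T -> R) :
  iavg n (fun s => a * F s) = a * iavg n F.
Proof.
elim: n F => [|n IH] F //=.
by rewrite -avgZ; apply: eq_avg => b; rewrite IH.
Qed.

Lemma iavg_sum (T I : finType) (n : nat) (F : I -> seq T -> R) :
  iavg n (fun s => \sum_i F i s) = \sum_i iavg n (F i).
Proof.
elim: n F => [|n IH] F //=.
by rewrite -avg_sum; apply: eq_avg => b; rewrite IH.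
Qed.

Lemma iavg_cst (T : finType) (n : nat) (a : R) :
  (0 < #|T|)%N -> iavg n (fun _ : seq T => a) = a.
Proof.
move=> T0; elim: n => [|n IH] //=.
by rewrite -[RHS](avg_cst a T0); apply: eq_avg => ?; rewrite IH.
Qed.

Lemma ler_norm_iavg (T : finType) (n : nat) (F : seq T -> R) :
  `|iavg n F| <= iavg n (fun s => `|F s|).
Proof.
elim: n F => [|n IH] F //=.
by apply: (le_trans (ler_norm_avg _)); apply: ler_avg => a; exact: IH.
Qed.

Lemma iavg_avg (T U : finType) (n : nat) (F : seq T -> U -> R) :
  iavg n (fun s => avg (F s)) = avg (fun u => iavg n (F^~ u)).
Proof.
elim: n F => [|n IH] F //=; rewrite -exchange_avg.
by apply: eq_avg => a; rewrite IH.
Qed.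

Lemma iavg_iavg (T U : finType) (m n : nat) (F : seq T -> seq U -> R) :
  iavg m (fun s => iavg n (F s)) = iavg n (fun u => iavg m (F^~ u)).
Proof.
elim: m F => [|m IH] F //=; rewrite iavg_avg.
by apply: eq_avg => a; rewrite IH.
Qed.

Lemma iavg_cat (T : finType) (m n : nat) (F : seq T -> R) :
  iavg (m + n) F = iavg m (fun s => iavg n (fun u => F (s ++ u))).
Proof.
elim: m F => [|m IH] F //=.
by apply: eq_avg => a; rewrite IH.
Qed.

Lemma avg_bij (T U : finType) (h : T -> U) (f : U -> R) :
  bijective h -> avg (fun t => f (h t)) = avg f.
Proof.
move=> hb; rewrite /avg (bij_eq_card hb).
by congr (_ / _); symmetry; apply: reindex; exact: onW_bij.
Qed.

(** Splitting off the value at [ord0] identifies functions on [n.+1] points with pairs, so nested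
    averages become averages over uniform functions. *)
Lemma iavg_ffun (T : finType) (n : nat) (F : seq T -> R) :
  iavg n F = avg (fun f : {ffun 'I_n -> T} => F (codom f)).
Proof.
elim: n F => [|n IH] F /=.
  rewrite -[LHS](@avg_cst {ffun 'I_0 -> T}) ?card_ffun ?card_ord //.
  apply: eq_avg => f; congr F; apply/esym/size0nil.
  by rewrite size_codom card_ord.
pose h (p : T * {ffun 'I_n -> T}) : {ffun 'I_n.+1 -> T} :=
  [ffun i => if unlift ord0 i is Some j then p.2 j else p.1].
have hb : bijective h.
  exists (fun f : {ffun 'I_n.+1 -> T} =>
    (f ord0, [ffun j => f (lift ord0 j)])).
    case=> a g; rewrite /h ffunE unlift_none; congr pair.
    by apply/ffunP => j; rewrite !ffunE liftK.
  move=> f; apply/ffunP => i; rewrite ffunE /=.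
  by case: unliftP => [j|] -> //; rewrite ffunE.
rewrite -(avg_bij _ hb) avg_prod; apply: eq_avg => a; rewrite IH.
apply: eq_avg => f; congr F.
rewrite /codom /image_mem enum_ordSl /= /h ffunE unlift_none; congr cons.
by rewrite -map_comp; apply: eq_map => i /=; rewrite ffunE liftK.
Qed.

(** The image of a product measure under a coordinatewise map is the product of the image measures;
    the sum is cut into fibres, and distributivity handles each. *)
Lemma sum_push (I A C : finType) (mu : I -> A -> R) (pi : I -> A -> C)
    (phi : {ffun I -> C} -> R) :
  \sum_(y : {ffun I -> A}) (\prod_i mu i (y i)) * phi [ffun i => pi i (y i)] =
  \sum_(c : {ffun I -> C}) (\prod_i \sum_(a | pi i a == c i) mu i a) * phi c.
Proof.
rewrite (partition_big (fun y : {ffun I -> A} => [ffun i => pi i (y i)])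
  xpredT) //=.
apply: eq_bigr => c _; rewrite bigA_distr_big_dep mulr_suml.
apply: eq_big => [y|y /eqP -> //].
apply/eqP/familyP => [<- i|yc]; first by rewrite /in_mem /= ffunE.
by apply/ffunP => i; rewrite ffunE; apply/eqP; exact: (yc i).
Qed.

(** Restricting a uniform function to the points [iota i] gives a uniform function, because all
    fibres of the restriction have the same size. *)
Lemma avg_marginal (I J B : finType) (iota : I -> J)
    (phi : {ffun I -> B} -> R) : (0 < #|B|)%N -> injective iota ->
  avg (fun y : {ffun J -> B} => phi [ffun i => y (iota i)]) = avg phi.
Proof.
move=> B0 iota_inj.
(* Common size of the fibres: a factor [#|B|] for each point outside the image of [iota]. *)
pose c : R := \prod_(j : J) if j \in codom iota then 1 else #|B|%:R.
have key (psi : {ffun I -> B} -> R) :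
    \sum_(y : {ffun J -> B}) psi [ffun i => y (iota i)] = c * \sum_y psi y.
  rewrite (partition_big (fun y : {ffun J -> B} => [ffun i => y (iota i)])
    xpredT) //= mulr_sumr.
  apply: eq_bigr => y' _.
  rewrite (eq_bigr (fun=> 1 * psi y')) => [|y /eqP ->]; last by rewrite mul1r.
  rewrite -mulr_suml; congr (_ * _).
  rewrite /c [RHS](eq_bigr (fun j =>
      \sum_(b | [forall i, (iota i == j) ==> (b == y' i)]) 1)); last first.
    move=> j _; case: ifPn => [/codomP [i ->]|ji].
      rewrite (big_pred1 (y' i)) // => b; apply/forallP/eqP => [H|-> i'].
        by have := H i; rewrite eqxx => /eqP.
      by apply/implyP => /eqP /iota_inj ->.
    rewrite (eq_bigl predT) ?sumr_const // => b; apply/forallP => i.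
    by apply/implyP => /eqP ij; rewrite -ij codom_f in ji.
  rewrite bigA_distr_big_dep; apply: eq_big => [y|y _]; last by rewrite big1_eq.
  apply/eqP/familyP => [<- j|yc].
    by rewrite /in_mem /=; apply/forallP => i; apply/implyP => /eqP <-;
      rewrite ffunE.
  apply/ffunP => i; rewrite ffunE; have /forallP/(_ i) := yc (iota i).
  by rewrite eqxx => /eqP.
have k1 := key (fun=> 1).
rewrite /avg key.
have c0 : c != 0.
  by apply/prodf_neq0 => j _; case: ifP => _; rewrite ?oner_neq0 // pnatr_eq0 -lt0n.
rewrite !sumr_const in k1; rewrite k1 invfM; field.
by rewrite c0 pnatr_eq0 card_ffun -lt0n expn_gt0 B0.
Qed.

Lemma avg_rows (I J B : finType) (phi : I -> {ffun J -> B} -> R) :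
  avg (fun y : {ffun I * J -> B} => \prod_i phi i [ffun j => y (i, j)]) =
  \prod_i avg (phi i).
Proof.
pose h (z : {ffun I -> {ffun J -> B}}) : {ffun I * J -> B} :=
  [ffun p => z p.1 p.2].
have hb : bijective h.
  exists (fun y : {ffun I * J -> B} => [ffun i => [ffun j => y (i, j)]]).
    by move=> z; apply/ffunP => i; apply/ffunP => j; rewrite !ffunE.
  by move=> y; apply/ffunP => -[i j]; rewrite !ffunE.
rewrite -(avg_bij _ hb) /avg prodf_div bigA_distr_bigA /=; congr (_ / _).
  apply: eq_bigr => z _; apply: eq_bigr => i _; congr phi.
  by apply/ffunP => j; rewrite !ffunE.
by rewrite prodr_const -natrX; congr _%:R; rewrite -card_ffun.
Qed.

End Averages.

(** * Fooling functions with few threshold cells *)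

Section Quantiles.
Variables (R : realFieldType) (Z : finType) (V : Z -> R) (n : nat).

Definition card_ge (v : R) : nat := #|[pred z | v <= V z]|.
Definition card_gt (v : R) : nat := #|[pred z | v < V z]|.

(** Both cuts are upward closed sets of reals. In the sample [V], for [k <= n], the upper one has
    frequency below [(k + 1) / n] and the lower one at least [k / n], so the first exceeds the
    second by at most [1 / n]. *)
Definition upper_cut (k : nat) (v : R) : bool :=
  (card_ge v * n < k.+1 * #|Z|)%N.
Definition lower_cut (k : nat) (v : R) : bool :=
  (card_gt v * n < k * #|Z|)%N.

(** At or above the smallest sample value in the cut there are at least as many samples as the cut
    contains. *)
Lemma card_upper_cut k : (0 < #|Z|)%N ->
  (#|[pred z | upper_cut k (V z)]| * n < k.+1 * #|Z|)%N.
Proof.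
move=> Z0; case: (pickP [pred z | upper_cut k (V z)]) => [z0 Uz0|U0].
  have [z Uz zmin] := @arg_minP _ _ _ z0 [pred z | upper_cut k (V z)] V Uz0.
  apply: leq_ltn_trans Uz; rewrite leq_mul2r; apply/orP; right.
  by apply: subset_leq_card; apply/fintype.subsetP => z' /zmin.
by rewrite (eq_card0 U0) mul0n muln_gt0.
Qed.

Lemma card_lower_cut k : (k <= n)%N ->
  (k * #|Z| <= #|[pred z | lower_cut k (V z)]| * n)%N.
Proof.
move=> kn; case: (pickP [pred z | ~~ lower_cut k (V z)]) => [z0 Lz0|L0].
  have [z Lz zmax] := @arg_maxP _ _ _ z0 [pred z | ~~ lower_cut k (V z)] V Lz0.
  move: Lz; rewrite inE /lower_cut -leqNgt => /leq_trans -> //.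
  rewrite leq_mul2r; apply/orP; right.
  apply: subset_leq_card; apply/fintype.subsetP => z' /=; rewrite !inE.
  by apply: contraTT => /zmax; rewrite -leNgt.
have -> : #|[pred z | lower_cut k (V z)]| = #|Z|.
  by apply: eq_card => z; have := L0 z; rewrite !inE => /negbFE.
by rewrite mulnC leq_mul2l kn orbT.
Qed.

(** [k] is the rank of [theta] rounded down to a multiple of one n-th, so every half-line, whatever
    its end point, is squeezed between two of finitely many cuts. *)
Lemma quantile_cut (theta : R) : (0 < #|Z|)%N -> exists k : 'I_n.+1,
  (forall v, lower_cut k v -> theta <= v) /\
  (forall v, theta <= v -> upper_cut k v).
Proof.
move=> Z0; pose k := (card_ge theta * n %/ #|Z|)%N.
have kn : (k < n.+1)%N.
  rewrite ltnS /k -[X in (_ <= X)%N](mulnK n Z0) leq_div2r // mulnC.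
  by rewrite leq_mul2l max_card orbT.
exists (Ordinal kn); split=> v; rewrite /lower_cut /upper_cut /=.
  apply: contraTT; rewrite -ltNge -leqNgt => vt.
  apply: (leq_trans (leq_divM _ _)); rewrite leq_mul2r; apply/orP; right.
  apply: subset_leq_card; apply/fintype.subsetP => z; rewrite !inE.
  exact: lt_le_trans.
move=> tv; apply: leq_ltn_trans (ltn_ceil _ Z0).
rewrite leq_mul2r; apply/orP; right.
by apply: subset_leq_card; apply/fintype.subsetP => z; rewrite !inE; exact: le_trans.
Qed.

End Quantiles.

(** * Deviation of one hashing level from independent blocks *)

Section Nisan.
Variables (R : realFieldType) (B K : finType) (H : K -> B -> B) (b : nat).

Definition hash_all (kappa : {ffun 'I_b -> K}) (u : B) : seq B :=
  codom [ffun j => H (kappa j) u].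

Definition expand (kappa : {ffun 'I_b -> K}) (s : seq B) : seq B :=
  flatten [seq hash_all kappa u | u <- s].

(** The head of [hs] is the level applied last, so recursion on [hs] peels off the outermost level,
    which decides the lowest digit of a position. *)
Definition gen (hs : seq {ffun 'I_b -> K}) (x : B) : seq B :=
  foldr expand [:: x] hs.

Lemma size_hash_all kappa u : size (hash_all kappa u) = b.
Proof. by rewrite size_codom card_ord. Qed.

Lemma size_expand kappa s : size (expand kappa s) = (size s * b)%N.
Proof.
by elim: s => //= u s IH; rewrite size_cat size_hash_all IH mulSn.
Qed.

Lemma expand_cat kappa s t :
  expand kappa (s ++ t) = expand kappa s ++ expand kappa t.
Proof. by rewrite /expand map_cat flatten_cat. Qed.

Hypothesis H2 : forall x y a a' : B, x != y ->
  (#|[set key : K | (H key x == a) && (H key y == a')]%SET| * #|B| ^ 2)%N = #|K|.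
Hypotheses (K0 : (0 < #|K|)%N) (B0 : (0 < #|B|)%N).

(** Distinct inputs have independent uniform images, coordinate by coordinate in [kappa]: each pair
    of values gets weight [#|K| / #|B| ^ 2]. *)
Lemma avg_hash_pair (u u' : B) (g : {ffun 'I_b -> B} -> R) : u != u' ->
  avg (fun kappa : {ffun 'I_b -> K} =>
    g [ffun j => H (kappa j) u] * g [ffun j => H (kappa j) u']) = avg g ^+ 2.
Proof.
move=> uu'.
pose phi (c : {ffun 'I_b -> B * B}) : R :=
  g [ffun j => (c j).1] * g [ffun j => (c j).2].
pose h (p : {ffun 'I_b -> B} * {ffun 'I_b -> B}) : {ffun 'I_b -> B * B} :=
  [ffun j => (p.1 j, p.2 j)].
have hb : bijective h.
  exists (fun c : {ffun 'I_b -> B * B} => ([ffun j => (c j).1], [ffun j => (c j).2])).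
    by case=> p q; congr pair; apply/ffunP => j; rewrite !ffunE.
  by move=> c; apply/ffunP => j; rewrite !ffunE; case: (c j).
have -> : avg g ^+ 2 = avg phi.
  rewrite -(avg_bij _ hb) avg_prod expr2 -avgZ.
  apply: eq_avg => p; rewrite mulrC -avgZ; apply: eq_avg => q.
  by rewrite /phi; congr (g _ * g _); apply/ffunP => j; rewrite !ffunE.
rewrite /avg.
under eq_bigr => kappa _.
  rewrite (_ : g _ * g _ = (\prod_(j < b) 1) *
    phi [ffun j => (H (kappa j) u, H (kappa j) u')]); last first.
    rewrite big1_eq mul1r /phi.
    by congr (g _ * g _); apply/ffunP => j; rewrite !ffunE.
  over.
rewrite (sum_push (fun=> fun=> 1) (fun=> fun k => (H k u, H k u')) phi).
have KB (c : B * B) : \sum_(k | (H k u, H k u') == c) 1 =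
    #|K|%:R / #|B|%:R ^+ 2 :> R.
  rewrite sumr_const -(H2 c.1 c.2 uu') natrM natrX mulfK; last first.
    by rewrite expf_neq0 // pnatr_eq0 -lt0n.
  by congr _%:R; apply: eq_card => k; rewrite !inE; case: c.
under eq_bigr => c _.
  rewrite (eq_bigr (fun=> #|K|%:R / #|B|%:R ^+ 2)) => [|j _]; last exact: KB.
  rewrite prodr_const card_ord; over.
rewrite -mulr_sumr !card_ffun card_prod card_ord !natrX natrM.
rewrite expr_div_n expr2 !exprMn; field.
by rewrite !expf_neq0 // pnatr_eq0 -lt0n.
Qed.

Definition deviation (kappa : {ffun 'I_b -> K}) (G : seq B -> R) : R :=
  avg (fun u => G (hash_all kappa u)) - iavg b G.

(** The square is a double average over inputs of products of the centred test. Distinct inputs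
    contribute zero by pairwise independence, and equal ones at most 1 with frequency [1 / #|B|]. *)
Lemma deviation_second_moment (G : seq B -> R) :
  (forall s, 0 <= G s <= 1) ->
  avg (fun kappa => deviation kappa G ^+ 2) <= #|B|%:R^-1.
Proof.
move=> G01.
pose g (z : {ffun 'I_b -> B}) : R := G (codom z) - iavg b G.
have g0 : avg g = 0.
  rewrite avgB -iavg_ffun avg_cst ?subrr //.
  by rewrite card_ffun expn_gt0 B0.
have m01 : 0 <= iavg b G <= 1.
  apply/andP; split.
    rewrite -(@iavg_cst R B b 0 B0); apply: ler_iavg => s _.
    by have /andP[] := G01 s.
  rewrite -(@iavg_cst R B b 1 B0); apply: ler_iavg => s _.
  by have /andP[] := G01 s.
have g1 z : g z * g z <= 1.
  rewrite /g; have := G01 (codom z); move: (G _) (iavg _ _) m01 => x y; nra.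
have E kappa : deviation kappa G ^+ 2 = avg (fun u => avg (fun u' =>
    g [ffun j => H (kappa j) u] * g [ffun j => H (kappa j) u'])).
  have -> : deviation kappa G = avg (fun u => g [ffun j => H (kappa j) u]).
    by rewrite avgB avg_cst.
  rewrite expr2 -avgZ; apply: eq_avg => u; rewrite mulrC -avgZ.
  by apply: eq_avg => u'.
rewrite (eq_avg E) exchange_avg.
rewrite (eq_avg (fun u => exchange_avg _)).
apply: (@le_trans _ _ (avg (fun u : B => avg (fun u' : B => (u == u')%:R)))).
  apply: ler_avg => u; apply: ler_avg => u'; case: eqVneq => [<-|uu'].
    rewrite -[leRHS](@avg_cst R {ffun 'I_b -> K}) ?card_ffun ?expn_gt0 ?K0 //.
    by apply: ler_avg => kappa.
  by rewrite avg_hash_pair // g0 expr0n.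
rewrite (@eq_avg _ _ _ (fun=> #|B|%:R^-1)) ?avg_cst // => u.
rewrite /avg (bigD1 u) //= eqxx big1 ?addr0 ?mul1r // => u' /negPf.
by rewrite eq_sym => ->.
Qed.

(** [sN] is the square root of [#|B|], given as data because [R] is only an ordered field. The bound
    is the average of [2 |d| <= sN d^2 + 1 / sN]. *)
Lemma deviation_first_moment (sN : R) (G : seq B -> R) :
  0 < sN -> sN ^+ 2 = #|B|%:R -> (forall s, 0 <= G s <= 1) ->
  avg (fun kappa => `|deviation kappa G|) <= sN^-1.
Proof.
move=> s0 sN2 G01.
have cardF : (0 < #|{ffun 'I_b -> K}|)%N by rewrite card_ffun expn_gt0 K0.
apply: (@le_trans _ _ (avg (fun kappa => 
   (sN / 2) * deviation kappa G ^+ 2 + sN^-1 / 2))).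
  apply: ler_avg => kappa; rewrite -real_normK ?num_real //.
  move: `|_| => d; rewrite -subr_ge0.
  have -> : sN / 2 * d ^+ 2 + sN^-1 / 2 - d = (sN * d - 1) ^+ 2 / (2 * sN).
    by field; rewrite gt_eqF.
  by rewrite divr_ge0 ?sqr_ge0 ?mulr_ge0 // ltW.
rewrite avgD avgZ avg_cst //.
have := deviation_second_moment G01; rewrite -sN2 => le2.
apply: (@le_trans _ _ (sN / 2 * (sN ^+ 2)^-1 + sN^-1 / 2)).
  by rewrite lerD2r ler_wpM2l // divr_ge0 // ltW.
by rewrite le_eqVlt; apply/orP; left; apply/eqP; field; rewrite gt_eqF.
Qed.

End Nisan.

Lemma and3b_sub (R : realFieldType) (a u l u' l' : bool) :
  (l -> u) -> (l' -> u') ->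
  [&& a, u & u']%:R - [&& a, l & l']%:R <=
    (u%:R - l%:R) + (u'%:R - l'%:R) :> R.
Proof.
case: l => [->|_] //; case: l' => [->|_] //; rewrite ?andbT ?andbF.
- by rewrite !subrr addr0.
- by case: a; case: u'; rewrite ?subrr ?add0r ?subr0 ?ler01.
- by case: a; case: u; rewrite ?subrr ?addr0 ?subr0 ?ler01.
by case: a; case: u; case: u'; rewrite /= ?subr0 ?addr0 ?add0r ?ler01 //
  -natrD ler_nat.
Qed.

(** * Uniform deviation over all thresholds *)

Section Covering.
Variables (R : realFieldType) (B K : finType) (H : K -> B -> B) (b : nat).

Hypothesis H2 : forall x y a a' : B, x != y ->
  (#|[set key : K | (H key x == a) && (H key y == a')]%SET| * #|B| ^ 2)%N = #|K|.
Hypotheses (K0 : (0 < #|K|)%N) (B0 : (0 < #|B|)%N).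
Variables (n : nat) (sN : R).
Hypotheses (n0 : (0 < n)%N) (sN0 : 0 < sN) (sN2 : sN ^+ 2 = #|B|%:R).

Local Notation dev := (deviation (R := R) H (b := b)).

Definition cell (A : seq B -> bool) (V V' : seq B -> R) (th th' : R)
    (s : seq B) : R := [&& A s, th <= V s & th' <= V' s]%:R.

(** The empirical mean of [G] lies between those of [Gl] and [Gu], and exchanging the true means
    costs at most their gap. *)
Lemma deviation_sandwich kappa (Gl G Gu : seq B -> R) :
  (forall s, size s = b -> Gl s <= G s <= Gu s) ->
  `|dev kappa G| <= `|dev kappa Gu| + `|dev kappa Gl| +
    (iavg b Gu - iavg b Gl).
Proof.
move=> GG.
have e1 : avg (fun u => Gl (hash_all H kappa u)) <=
          avg (fun u => G (hash_all H kappa u)).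
  by apply: ler_avg => u; have /andP[] := GG _ (size_hash_all H kappa u).
have e2 : avg (fun u => G (hash_all H kappa u)) <=
          avg (fun u => Gu (hash_all H kappa u)).
  by apply: ler_avg => u; have /andP[] := GG _ (size_hash_all H kappa u).
have e3 : iavg b Gl <= iavg b G by apply: ler_iavg => s /GG /andP[].
have e4 : iavg b G <= iavg b Gu by apply: ler_iavg => s /GG /andP[].
have := ler_norm (dev kappa Gu).
have := ler_norm (- dev kappa Gl); rewrite normrN.
have := normr_ge0 (dev kappa Gu); have := normr_ge0 (dev kappa Gl).
rewrite /deviation in e1 e2 e3 e4 *.
move: (avg _) (avg _) (avg _) (iavg _ _) (iavg _ _) (iavg _ _) e1 e2 e3 e4 =>
  x y z x' y' z' e1 e2 e3 e4 a1 a2 a3 a4.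
rewrite ler_norml; apply/andP; split; lra.
Qed.

Local Notation ZT := {ffun 'I_b -> B}.

Lemma iavg_cuts (V : seq B -> R) (k : 'I_n.+1) :
  iavg b (fun s => (upper_cut (fun z : ZT => V (codom z)) n k (V s))%:R -
    (lower_cut (fun z : ZT => V (codom z)) n k (V s))%:R) <= n%:R^-1 :> R.
Proof.
have Z0 : (0 < #|ZT|)%N by rewrite card_ffun expn_gt0 B0.
have up := card_upper_cut (fun z : ZT => V (codom z)) n k Z0.
have lo := card_lower_cut (fun z : ZT => V (codom z)) (ltnSE (ltn_ord k)).
have E (p : pred ZT) : \sum_(z : ZT) (p z)%:R = #|[pred z | p z]|%:R :> R.
  by rewrite -sum1_card natr_sum [RHS]big_mkcond; apply: eq_bigr => z _; rewrite inE; case: (p z).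
rewrite iavgB !iavg_ffun /avg -mulrBl !E.
rewrite ler_pdivrMr ?ltr0n // mulrC ler_pdivlMr ?ltr0n //.
rewrite mulrBl -!natrM lerBlDr -natrD ler_nat.
by apply: leq_trans (leq_add (leqnn _) lo); rewrite -mulSn ltnW.
Qed.

(* One bound serves all thresholds, because every cell is squeezed between two of
   the finitely many cells cut at quantiles of [V] and [V']. *)
Lemma cell_cover (A : seq B -> bool) (V V' : seq B -> R) :
  exists eta : {ffun 'I_b -> K} -> R,
    avg eta <= 2 * n.+1%:R ^+ 2 / sN + 2 / n%:R /\
    forall kappa th th', `|dev kappa (cell A V V' th th')| <= eta kappa.
Proof.
have Z0 : (0 < #|ZT|)%N by rewrite card_ffun expn_gt0 B0.
pose up (W : seq B -> R) k s := upper_cut (fun z : ZT => W (codom z)) n k (W s).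
pose lo (W : seq B -> R) k s := lower_cut (fun z : ZT => W (codom z)) n k (W s).
pose Gu (k k' : 'I_n.+1) s : R := [&& A s, up V k s & up V' k' s]%:R.
pose Gl (k k' : 'I_n.+1) s : R := [&& A s, lo V k s & lo V' k' s]%:R.
(* Summing over all [(n + 1) ^ 2] pairs of cuts dominates whichever pair the thresholds select;
   [2 / n] pays for the gap between the two cells. *)
exists (fun kappa => \sum_(p : 'I_n.+1 * 'I_n.+1)
  (`|dev kappa (Gu p.1 p.2)| + `|dev kappa (Gl p.1 p.2)|) + 2 / n%:R).
split.
  rewrite avgD avg_cst ?card_ffun ?expn_gt0 ?K0 // lerD2r avg_sum.
  apply: (@le_trans _ _ (\sum_(p : 'I_n.+1 * 'I_n.+1) 2 / sN)).
    apply: ler_sum => p _; rewrite avgD mulr_natl mulr2n.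
    by apply: lerD; apply: deviation_first_moment => // s;
      rewrite ?ler0n ?lern1 ?leq_b1.
  by rewrite sumr_const card_prod card_ord -[leLHS]mulr_natl natrM -expr2 mulrCA mulrA.
move=> kappa th th'.
have [k [k1 k2]] := quantile_cut (fun z : ZT => V (codom z)) n th Z0.
have [k' [k1' k2']] := quantile_cut (fun z : ZT => V' (codom z)) n th' Z0.
apply: le_trans (deviation_sandwich kappa (Gl := Gl k k') (Gu := Gu k k') _) _.
  move=> s _; rewrite /Gl /Gu /cell !ler_nat; apply/andP; split.
    case: (A s) => //=; case e: (lo V k s) => //=; case e': (lo V' k' s) => //=.
    by rewrite (k1 _ e) (k1' _ e').
  case: (A s) => //=; case e: (th <= V s) => //=; case e': (th' <= V' s) => //=.
  by rewrite /up (k2 _ e) (k2' _ e').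
apply: lerD.
  rewrite (bigD1 (k, k')) //= lerDl; apply: sumr_ge0 => p _.
  by rewrite addr_ge0.
rewrite -iavgB; apply: (@le_trans _ _ (iavg b (fun s =>
  ((up V k s)%:R - (lo V k s)%:R) - -1 * ((up V' k' s)%:R - (lo V' k' s)%:R)))).
  apply: ler_iavg => s _; rewrite /Gu /Gl mulN1r opprK.
  by apply: and3b_sub => [/k1/k2|/k1'/k2'].
rewrite iavgB iavgZ mulN1r opprK mulr_natl mulr2n.
by apply: lerD; exact: iavg_cuts.
Qed.

End Covering.

(** * Nisan's hybrid argument for tame tests *)

Section Fooling.
Variables (R : realFieldType) (B K : finType) (H : K -> B -> B) (b : nat).

Hypothesis H2 : forall x y a a' : B, x != y ->
  (#|[set key : K | (H key x == a) && (H key y == a')]%SET| * #|B| ^ 2)%N = #|K|.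
Hypotheses (B0 : (0 < #|B|)%N).
Variables (n : nat) (sN : R).
Hypotheses (n0 : (0 < n)%N) (sN0 : 0 < sN) (sN2 : sN ^+ 2 = #|B|%:R).
Variable I : finType.

(* [z] stands for a window of consecutive blocks; the data depending on [z]
   alone must not depend on the blocks outside the window. *)
Definition tame (F : seq B -> R) : Prop :=
  forall a m : nat, exists (A : I -> seq B -> bool) (V V' : I -> seq B -> R),
  forall pre suf, size pre = a -> exists coef th th' : I -> R,
    (forall e, `|coef e| <= 2) /\
    forall z, size z = m -> F (pre ++ z ++ suf) =
      \sum_e coef e * cell (A e) (V e) (V' e) (th e) (th' e) z.

(** The cost of one window: for each of the [#|I|] cells, the coefficient bound 2 times the bound of
    [cell_cover]. *)
Definition fooling_error : R :=
  #|I|%:R * (2 * (2 * n.+1%:R ^+ 2 / sN + 2 / n%:R)).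

(** A window of [m] seed blocks expands to a window of [m * b] blocks, which is why [tame] speaks of
    windows of every position and length. *)
Lemma tame_expand kappa F : tame F -> tame (F \o expand H (b := b) kappa).
Proof.
move=> tF a m; have [A [V [V' P]]] := tF (a * b)%N (m * b)%N.
exists (fun e => A e \o expand H kappa), (fun e => V e \o expand H kappa),
  (fun e => V' e \o expand H kappa) => pre suf sa.
have := P (expand H kappa pre) (expand H kappa suf).
rewrite size_expand sa => /(_ erefl) [coef [th [th' [c2 E]]]].
exists coef, th, th'; split=> // z sz.
by rewrite /= !expand_cat E ?size_expand ?sz.
Qed.

Hypothesis K0 : (0 < #|K|)%N.

(** One [eta] serves all surroundings of a window at a given position: they enter through
    coefficients and thresholds only, and the cells are bounded uniformly over thresholds. *)
Lemma tame_deviation F a : tame F -> exists eta : {ffun 'I_b -> K} -> R,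
  avg eta <= fooling_error /\
  forall kappa pre suf, size pre = a ->
    `|deviation H kappa (fun z => F (pre ++ z ++ suf))| <= eta kappa.
Proof.
move=> tF; have [A [V [V' P]]] := tF a b.
have /choice [eta etaP] : forall e : I, exists eta : {ffun 'I_b -> K} -> R,
    avg eta <= 2 * n.+1%:R ^+ 2 / sN + 2 / n%:R /\
    forall kappa th th',
      `|deviation H kappa (cell (A e) (V e) (V' e) th th')| <= eta kappa.
  by move=> e; exact: (cell_cover b H2 K0 B0 n0 sN0 sN2).
exists (fun kappa => \sum_e 2 * eta e kappa); split.
  rewrite avg_sum /fooling_error; apply: (@le_trans _ _ (\sum_(e : I)
    2 * (2 * n.+1%:R ^+ 2 / sN + 2 / n%:R))).
    by apply: ler_sum => e _; rewrite avgZ ler_wpM2l //; case: (etaP e).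
  by rewrite sumr_const -[leLHS]mulr_natl.
move=> kappa pre suf sa; have [coef [th [th' [c2 E]]]] := P pre suf sa.
have -> : deviation H kappa (fun z => F (pre ++ z ++ suf)) =
    \sum_e coef e * deviation H kappa (cell (A e) (V e) (V' e) (th e) (th' e)).
  rewrite /deviation (eq_iavg E) iavg_sum.
  rewrite (eq_avg (fun u => E _ (size_hash_all H kappa u))) avg_sum -sumrB.
  by apply: eq_bigr => e _; rewrite avgZ iavgZ mulrBr.
apply: le_trans (ler_norm_sum _ _ _) _; apply: ler_sum => e _; rewrite normrM.
by apply: ler_pM => //; case: (etaP e) => _ /(_ kappa (th e) (th' e)).
Qed.

(** Hybrid argument within one level: for a common [kappa], groups of [b] blocks are exchanged one
    by one. *)
Lemma tame_level F (q : nat) : tame F ->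
  `|avg (fun kappa => iavg q (fun s => F (expand H (b := b) kappa s))) -
    iavg (q * b) F| <= q%:R * fooling_error.
Proof.
move=> tF.
have cF : (0 < #|{ffun 'I_b -> K}|)%N by rewrite card_ffun expn_gt0 K0.
have /choice [eta etaP] := fun a => tame_deviation a tF.
(* The prefix is arbitrary, so it may consist of blocks already hashed with the same [kappa]. *)
have key kappa pre : `|iavg q (fun s => F (pre ++ expand H kappa s)) -
    iavg (q * b) (fun s => F (pre ++ s))| <=
    \sum_(i < q) eta (size pre + i * b)%N kappa.
  elim: q pre => [|q IH] pre; first by rewrite big_ord0 /= subrr normr0.
  rewrite big_ord_recl mul0n addn0 mulSn iavg_cat /=.
  have -> : iavg b (fun z => iavg (q * b) (fun s => F (pre ++ z ++ s))) =
      avg (fun u => iavg (q * b) (fun s => F (pre ++ hash_all H kappa u ++ s))) -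
      iavg (q * b) (fun s => deviation H kappa (fun z => F (pre ++ z ++ s))).
    by rewrite iavgB iavg_avg iavg_iavg opprB addrC subrK.
  rewrite opprB addrA [_ + iavg _ _]addrC -addrA.
  apply: le_trans (ler_normD _ _) _; apply: lerD.
    apply: le_trans (ler_norm_iavg _ _) _.
    rewrite -[leRHS](@iavg_cst R B (q * b)) //; apply: ler_iavg => s _.
    by have [_] := etaP (size pre); apply.
  rewrite -avgB; apply: le_trans (ler_norm_avg _) _.
  rewrite -[leRHS](@avg_cst R B) //; apply: ler_avg => u.
  have := IH (pre ++ hash_all H kappa u).
  rewrite (eq_iavg (G := fun s => F (pre ++ hash_all H kappa u ++ expand H kappa s)));
    last by move=> s _; rewrite -catA.
  rewrite (eq_iavg (n := (q * b)%N) (G := fun s => F (pre ++ hash_all H kappa u ++ s)));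
    last by move=> s _; rewrite -catA.
  move=> /le_trans; apply; apply: ler_sum => i _.
  by rewrite size_cat size_hash_all /bump /= add1n mulSn addnA.
rewrite -[iavg (q * b) F](@avg_cst R {ffun 'I_b -> K}) // -avgB.
apply: le_trans (ler_norm_avg _) _.
apply: le_trans (ler_avg (fun kappa => key kappa [::])) _.
rewrite avg_sum mulr_natl -[X in _ *+ X](card_ord q) -sumr_const.
by apply: ler_sum => i _; case: (etaP (size ([::] : seq B) + i * b)%N).
Qed.

End Fooling.

(** [tame_level] replaces the outermost level by independent blocks; for the remaining levels the
    test composed with [expand] is tame again. *)
Lemma nisan (R : realFieldType) (B K : finType) (H : K -> B -> B) (b : nat)
    (n : nat) (sN : R) (I : finType) (k : nat) (F : seq B -> R) :
  (forall x y a a' : B, x != y ->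
    (#|[set key : K | (H key x == a) && (H key y == a')]%SET| * #|B| ^ 2)%N
     = #|K|) ->
  (0 < #|B|)%N -> (0 < n)%N -> 0 < sN -> sN ^+ 2 = #|B|%:R ->
  (2 <= b)%N -> (k == 0)%N || (0 < #|K|)%N -> tame I F ->
  `|iavg k (fun hs => avg (fun x => F (gen H (b := b) hs x))) - iavg (b ^ k) F|
    <= (b ^ k)%:R * fooling_error n sN I.
Proof.
move=> H2 B0 n0 s0 s2 b2 kK.
have e0 : 0 <= fooling_error n sN I.
  by rewrite !(mulr_ge0, addr_ge0, invr_ge0) ?exprn_ge0 // ltW.
(* Subtracting 1 closes the induction: [(b ^ k - 1) + b ^ k <= b ^ k.+1 - 1] since [b >= 2]. *)
suff main : tame I F ->
    `|iavg k (fun hs => avg (fun x => F (gen H (b := b) hs x))) - iavg (b ^ k) F|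
    <= ((b ^ k)%:R - 1) * fooling_error n sN I.
  by move=> /main /le_trans; apply; rewrite ler_wpM2r // gerBl.
elim: k kK F => [|k IH] kK F tF.
  by rewrite expn0 /= subrr normr0 subrr mul0r.
have {}K0 : (0 < #|K|)%N by move: kK.
rewrite /= expnSr.
have -> : avg (fun kappa : {ffun 'I_b -> K} => iavg k (fun hs =>
      avg (fun x => F (gen H (kappa :: hs) x)))) - iavg (b ^ k * b) F =
    avg (fun kappa : {ffun 'I_b -> K} => iavg k (fun hs =>
      avg (fun x => (F \o expand H kappa) (gen H (b := b) hs x))) -
      iavg (b ^ k) (F \o expand H kappa)) +
    (avg (fun kappa : {ffun 'I_b -> K} => iavg (b ^ k) (F \o expand H kappa)) -
     iavg (b ^ k * b) F).
  by rewrite avgB addrA subrK.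
apply: le_trans (ler_normD _ _) _.
have cF : (0 < #|{ffun 'I_b -> K}|)%N by rewrite card_ffun expn_gt0 K0.
have l1 := tame_level b H2 B0 n0 s0 s2 K0 (b ^ k) tF.
apply: le_trans (lerD _ l1) _.
  apply: le_trans (ler_norm_avg _) _.
  apply: le_trans (ler_avg (fun kappa => IH _ _ (tame_expand H kappa tF))) _.
    by rewrite K0 orbT.
  by rewrite avg_cst.
rewrite -mulrDl ler_wpM2r // addrAC lerD2r -natrD ler_nat addnn -muln2.
by rewrite leq_mul2l b2 orbT.
Qed.

(** * Counting rows *)

Lemma sum_option (V : nmodType) (J : finType) (G : option J -> V) :
  \sum_oj G oj = G None + \sum_j G (Some j).
Proof.
rewrite (bigD1 None) //=; congr (_ + _).
rewrite (reindex_omap Some id) /= => [|[j|]] //.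
by apply: eq_bigl => j; rewrite eqxx.
Qed.

Section Rows.
Variables (R : realFieldType) (B J : finType) (d r : nat) (x0 : B).
Variable f : nat -> J -> 'I_d -> B -> R.

Definition score (y : seq B) (i : nat) (j : J) : R :=
  \sum_(rho < d) f i j rho (nth x0 y (i * d + rho)).

Definition hit (y : seq B) (i : nat) : bool := [exists j, (0 <= score y i j)%R].

Definition hits (y : seq B) : nat := \sum_(i < r) hit y i.

Hypothesis d0 : (0 < d)%N.
Hypothesis uniq_label : forall y i j j',
  0 <= score y i j -> 0 <= score y i j' -> j = j'.

(** At most one label passes the test, so the disjunction is a sum of threshold indicators. *)
Lemma hitE y i : (hit y i)%:R = \sum_j (0 <= score y i j)%R%:R :> R.
Proof.
case: (boolP (hit y i)) => [/existsP[j j0]|/existsPn nj].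
  rewrite (bigD1 j) //= j0 big1 ?addr0 // => j' /eqP jj'.
  by case: (boolP (0 <= score y i j')) => // /(uniq_label j0) /esym.
by rewrite big1 // => j _; rewrite (negPf (nj j)).
Qed.

Lemma eq_hit y y' i : (forall rho : 'I_d,
    nth x0 y (i * d + rho) = nth x0 y' (i * d + rho)) -> hit y i = hit y' i.
Proof.
move=> yy'; rewrite /hit; apply: eq_existsb => j.
by congr (0 <= _); apply: eq_bigr => rho _; rewrite yy'.
Qed.

Variable R0 : nat.

(** A window determines the hits of the whole rows strictly between [i0] and [i1], and contains
    parts of the two rows at its ends. Given the count inside, the test is a function of the hits of
    those two rows, expanded in their indicators; [None] marks an absent indicator. *)
Lemma tame_hits :
  tame ('I_r.+1 * option J * option J)%type (fun y => (R0 <= hits y)%N%:R : R).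
Proof.
move=> a m; pose i0 := (a %/ d)%N; pose i1 := ((a + m) %/ d)%N.
have i0P : (i0 * d <= a < i0.+1 * d)%N by rewrite leq_divM ltn_ceil.
have i1P : (i1 * d <= a + m < i1.+1 * d)%N by rewrite leq_divM ltn_ceil.
have i01 : (i0 <= i1)%N by apply: leq_div2r; rewrite leq_addr.
pose inw n := (a <= n < a + m)%N.
pose V i (oj : option J) (z : seq B) : R := if oj is Some j then
  \sum_(rho < d | inw (i * d + rho)%N) f i j rho (nth x0 z (i * d + rho - a))
  else 0.
(* Padding with [a] blocks puts the window in its place without reference to the outside. *)
pose cin z := (\sum_(i < r | i0 < i < i1) hit (nseq a x0 ++ z) i)%N.
exists (fun (e : 'I_r.+1 * option J * option J) z => cin z == e.1.1),
  (fun e => V i0 e.1.2), (fun e => V i1 e.2).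
move=> pre suf spre.
pose y0 := pre ++ nseq m x0 ++ suf.
pose out i (oj : option J) : R := if oj is Some j then
  \sum_(rho < d | ~~ inw (i * d + rho)%N) f i j rho (nth x0 y0 (i * d + rho))
  else 0.
pose cout := (\sum_(i < r | (i < i0) || (i1 < i)) hit y0 i)%N.
(* An end row counts only if it is below [r], and only once if both ends fall into the same row. *)
pose g0 := (i0 < r)%N; pose g1 := (i1 < r)%N && (i1 != i0).
pose Psi (c : nat) (h h' : bool) : R := (R0 <= c + cout + (g0 && h) + (g1 && h'))%N%:R.
(* Coefficients of [Psi] as a multilinear polynomial in the indicators [h] and [h']. *)
pose coef (e : 'I_r.+1 * option J * option J) : R :=
  let c := nat_of_ord e.1.1 in
  match e.1.2, e.2 with
  | None, None => Psi c false false
  | Some _, None => Psi c true false - Psi c false false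
  | None, Some _ => Psi c false true - Psi c false false
  | Some _, Some _ => Psi c true true - Psi c true false - Psi c false true
                      + Psi c false false
  end.
exists coef, (fun e => - out i0 e.1.2), (fun e => - out i1 e.2); split.
  have Psi01 c h h' : 0 <= Psi c h h' <= 1.
    by rewrite /Psi ler0n lern1 leq_b1.
  move=> [[c oj] oj']; rewrite /coef /= ler_norml.
  have := Psi01 c false false; have := Psi01 c true false.
  have := Psi01 c false true; have := Psi01 c true true.
  case: oj => [_|]; case: oj' => [_|];
  move: (Psi _ _ _) (Psi _ _ _) (Psi _ _ _) (Psi _ _ _) => p q p' q';
  by move=> /andP[? ?] /andP[? ?] /andP[? ?] /andP[? ?]; apply/andP; split; lra.
move=> z sz; set y := pre ++ z ++ suf.
have nth_out n : ~~ inw n -> nth x0 y n = nth x0 y0 n.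
  rewrite /inw /y /y0 !nth_cat spre size_nseq sz; case: (ltnP n a) => //= an.
  by rewrite ltn_subLR // => /negPf ->.
have nth_in n : inw n -> nth x0 y n = nth x0 z (n - a).
  move=> /andP[an nam]; rewrite /y !nth_cat spre sz ltnNge an /=.
  by rewrite ltn_subLR // nam.
have nth_pad n : inw n -> nth x0 (nseq a x0 ++ z) n = nth x0 z (n - a).
  by move=> /andP[an _]; rewrite nth_cat size_nseq ltnNge an.
have scoreE i j : score y i j = V i (Some j) z + out i (Some j).
  rewrite /score /V /out (bigID (fun rho : 'I_d => inw (i * d + rho)%N)) /=.
  by congr (_ + _); apply: eq_bigr => rho hr; [rewrite nth_in|rewrite nth_out].
have hit_in (i : nat) : (i0 < i < i1)%N -> hit y i = hit (nseq a x0 ++ z) i.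
  move=> /andP[hi hi']; apply: eq_hit => rho.
  have iw : inw (i * d + rho)%N.
    have l1 := leq_mul hi (leqnn d); have l2 := leq_mul hi' (leqnn d).
    have := ltn_ord rho; rewrite /inw; rewrite mulSn in l2.
    by move/andP: i0P => [_ i0P]; move/andP: i1P => [i1P _]; lia.
  by rewrite nth_in // nth_pad.
have hit_out (i : nat) : (i < i0)%N || (i1 < i)%N -> hit y i = hit y0 i.
  move=> hi; apply: eq_hit => rho; apply: nth_out; rewrite /inw negb_and -!ltnNge.
  have hr := ltn_ord rho; case/orP: hi => hi; apply/orP.
    left; have l1 := leq_mul hi (leqnn d); rewrite mulSn in l1.
    by move/andP: i0P => [i0P _]; lia.
  right; have l1 := leq_mul hi (leqnn d).
  by move/andP: i1P => [_ i1P]; lia.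
have hitsE : hits y = (cin z + cout + (g0 && hit y i0) + (g1 && hit y i1))%N.
  rewrite /hits (bigID (fun i : 'I_r => i0 < i < i1)%N) /= -!addnA; congr addn.
    by apply: eq_bigr => i /hit_in ->.
  rewrite (bigID (fun i : 'I_r => (i < i0) || (i1 < i))%N) /=; congr addn.
    apply: eq_big => [i|i /andP[_ /hit_out -> //]].
    by case: (ltngtP i i0) => //=; case: (ltngtP i i1) => //=; lia.
  have pick1 (k : nat) : (\sum_(i < r | i == k :> nat) hit y i)%N = ((k < r)%N && hit y k).
    case: (ltnP k r) => kr /=; last first.
      by rewrite big1 // => i /eqP ik; have := ltn_ord i; rewrite ik ltnNge kr.
    by rewrite (big_pred1 (Ordinal kr)).
  rewrite (bigID (fun i : 'I_r => i == i0 :> nat)) /=; congr addn.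
    by rewrite -pick1; apply: eq_bigl => i; lia.
  rewrite /g1; case: eqVneq => i10 /=.
    rewrite andbF big1 // => i; lia.
  by rewrite andbT -pick1; apply: eq_bigl => i; lia.
have cinr : (cin z < r.+1)%N.
  rewrite ltnS /cin; apply: (@leq_trans (\sum_(i < r) 1)%N).
    by rewrite [leqLHS]big_mkcond; apply: leq_sum => i _; case: ifP => // _;
      exact: leq_b1.
  by rewrite sum1_card card_ord.
pose G i (oj : option J) : R :=
  if oj is Some j then (0 <= score y i j)%R%:R else 1.
have outE i oj : (- out i oj <= V i oj z)%R%:R = G i oj.
  case: oj => [j|]; last by rewrite /= oppr0 lexx.
  by rewrite /G scoreE -[in LHS]subr_ge0 opprK.
have cellE c oj oj' : cell (fun z => cin z == c) (V i0 oj) (V i1 oj')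
    (- out i0 oj) (- out i1 oj') z = (cin z == c)%:R * (G i0 oj * G i1 oj').
  by rewrite -!outE -!natrM !mulnb.
rewrite -(pair_bigA _ (fun p oj' => coef (p, oj') * cell (fun z => cin z == p.1)
  (V i0 p.2) (V i1 oj') (- out i0 p.2) (- out i1 oj') z)) /=.
rewrite -(pair_bigA _ (fun c oj => \sum_oj' coef (c, oj, oj') *
  cell (fun z => cin z == c) (V i0 oj) (V i1 oj') (- out i0 oj) (- out i1 oj') z)) /=.
rewrite (bigD1 (Ordinal cinr)) //= [X in _ + X]big1 ?addr0 => [|c cc]; last first.
  rewrite big1 // => oj _; rewrite big1 // => oj' _.
  rewrite cellE; case: eqVneq => [cE|]; last by rewrite mul0r mulr0.
  by rewrite -(inj_eq val_inj) /= cE eqxx in cc.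
under eq_bigr => oj _.
  under eq_bigr => oj' _ do rewrite cellE eqxx mul1r.
  rewrite sum_option; over.
rewrite sum_option /= big_split /= !mulr1.
rewrite /coef /=.
under [X in _ + (_ + X)]eq_bigr => i _ do rewrite -mulr_sumr -mulr_sumr.
rewrite -!mulr_sumr -!mulr_suml -!hitE.
have -> : (R0 <= hits y)%N%:R = Psi (cin z) (hit y i0) (hit y i1) :> R.
  by rewrite /Psi hitsE.
case: (hit y i0); case: (hit y i1); rewrite /= ?mulr1 ?mulr0 ?addr0; ring.
Qed.

End Rows.

Section LabelledRows.
Variables (R : realFieldType) (B J : finType) (d r : nat) (x0 : B) (l : 'I_d).
Variables (label : B -> J) (theta : nat -> B -> R) (F : J -> 'I_d -> B -> R).

Definition labelled_hit (y : seq B) (i : nat) : bool :=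
  let yl := nth x0 y (i * d + l) in
  0 <= theta i yl +
    \sum_(rho | rho != l) F (label yl) rho (nth x0 y (i * d + rho)).

(** The label is read from the queried block, which may lie outside the window. Trying all labels,
    with a penalty for the wrong ones, gives a disjunction of scores that are sums over blocks. *)
Lemma tame_labelled_hits (R0 : nat) :
  tame ('I_r.+1 * option J * option J)%type
    (fun y => (R0 <= \sum_(i < r) labelled_hit y i)%N%:R : R).
Proof.
(* Strictly larger than any sum of the other terms, so that a wrong label has a negative score. *)
pose Big : R := 1 + \sum_j \sum_rho \sum_b `|F j rho b|.
pose f (i : nat) (j : J) (rho : 'I_d) (blk : B) : R :=
  if rho == l then (if label blk == j then theta i blk else - Big)
  else F j rho blk.
have d0 : (0 < d)%N by apply: leq_ltn_trans (ltn_ord l).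
have scoreE y i j : score x0 f y i j =
    (if label (nth x0 y (i * d + l)) == j then theta i (nth x0 y (i * d + l)) else - Big)
    + \sum_(rho | rho != l) F j rho (nth x0 y (i * d + rho)).
  rewrite /score (bigD1 l) //= {1}/f eqxx; congr (_ + _).
  by apply: eq_bigr => rho /negPf rl; rewrite /f rl.
have BigP y i j : \sum_(rho | rho != l) F j rho (nth x0 y (i * d + rho)) < Big.
  rewrite /Big ltr_pwDl // (bigD1 j) //= -[leLHS]addr0; apply: lerD.
    rewrite [leRHS](bigID (fun rho => rho != l)) /= -[leLHS]addr0; apply: lerD.
      apply: ler_sum => rho _; apply: (le_trans (ler_norm _)).
      by rewrite (bigD1 (nth x0 y (i * d + rho))) //= lerDl sumr_ge0.
    by apply: sumr_ge0 => rho _; apply: sumr_ge0.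
  by apply: sumr_ge0 => j' _; apply: sumr_ge0 => rho _; apply: sumr_ge0.
have labelP y i j : 0 <= score x0 f y i j -> label (nth x0 y (i * d + l)) = j.
  rewrite scoreE; case: eqP => // _; have := BigP y i j.
  by move: (\sum_(rho | _) _) => S SB S0; move: SB S0; rewrite addrC subr_ge0 ltNge => /negPf ->.
have uniq y i j j' : 0 <= score x0 f y i j -> 0 <= score x0 f y i j' -> j = j'.
  by move=> /labelP <- /labelP.
have hitP y i : hit x0 f y i = labelled_hit y i.
  apply/existsP/idP => [[j j0]|h].
    by have lj := labelP _ _ _ j0; move: j0; rewrite -lj scoreE eqxx.
  by exists (label (nth x0 y (i * d + l))); rewrite scoreE eqxx.
have tm := tame_hits r d0 uniq R0.
move=> a m; have [A [V [V' Q]]] := tm a m.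
exists A, V, V' => pre suf spre; have [coef [th [th' [c2 E]]]] := Q pre suf spre.
exists coef, th, th'; split=> // z sz; rewrite -E //.
by congr (_ <= _)%N%:R; apply: eq_bigr => i _; rewrite hitP.
Qed.

End LabelledRows.

(** * Anti-concentration of a row *)

Section ProductWeights.
Variable R : realType.

Lemma sum_prod_weight (I T : finType) (mu : I -> T -> R) :
  (forall i, \sum_a mu i a = 1) ->
  \sum_(A : {ffun I -> T}) \prod_i mu i (A i) = 1.
Proof.
by move=> mu1; rewrite -bigA_distr_bigA big1 // => i _; exact: mu1.
Qed.

(** Variance of a sum of independent centred variables: each cross term contains a factor of mean
    zero. *)
Lemma sum_prod_weight_sq (I T : finType) (mu f : I -> T -> R) :
  (forall i, \sum_a mu i a = 1) -> (forall i, \sum_a mu i a * f i a = 0) ->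
  \sum_(A : {ffun I -> T}) (\prod_i mu i (A i)) * (\sum_i f i (A i)) ^+ 2 =
  \sum_i \sum_a mu i a * f i a ^+ 2.
Proof.
move=> mu1 mu0.
under eq_bigr => A _.
  rewrite expr2 mulr_suml mulr_sumr.
  under [\sum_i _]eq_bigr => i _ do rewrite !mulr_sumr.
  over.
rewrite exchange_big /=; apply: eq_bigr => i _.
rewrite exchange_big /= (bigD1 i) //= [X in _ + X]big1 ?addr0.
  transitivity (\sum_(A : {ffun I -> T}) \prod_j
      (mu j (A j) * if j == i then f i (A j) ^+ 2 else 1)).
    apply: eq_bigr => A _; rewrite big_split /= -expr2; congr (_ * _).
    by rewrite (bigD1 i) //= eqxx big1 ?mulr1 // => j /negPf ->.
  rewrite -(bigA_distr_bigA (fun j a => mu j a * if j == i then f i a ^+ 2 else 1)).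
  rewrite (bigD1 i) //= eqxx [X in _ * X]big1 ?mulr1 // => j /negPf ->.
  by under eq_bigr do rewrite mulr1; exact: mu1.
move=> k ki.
transitivity (\sum_(A : {ffun I -> T}) \prod_j
    (mu j (A j) * if j == i then f i (A j) else if j == k then f k (A j) else 1)).
  apply: eq_bigr => A _; rewrite big_split /=; congr (_ * _).
  rewrite (bigD1 i) //= eqxx (bigD1 k) //= (negPf ki) eqxx big1 ?mulr1 // => j.
  by case/andP => /negPf -> /negPf ->.
rewrite -(bigA_distr_bigA (fun j a => mu j a *
  if j == i then f i a else if j == k then f k a else 1)).
by rewrite (bigD1 i) //= eqxx mu0 mul0r.
Qed.

(** Cauchy-Schwarz, from the non-negative sum of the [(p c - s / n) ^ 2]. *)
Lemma sum_sq_ge (T : finType) (n : nat) (p : T -> R) :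
  (#|T| <= n)%N -> (0 < n)%N -> (\sum_c p c) ^+ 2 / n%:R <= \sum_c p c ^+ 2.
Proof.
move=> Tn n0; set s := \sum_c p c.
have n0' : n%:R != 0 :> R by rewrite pnatr_eq0 -lt0n.
have : 0 <= \sum_c (p c - s / n%:R) ^+ 2 by apply: sumr_ge0 => c _; exact: sqr_ge0.
under eq_bigr do rewrite sqrrB.
rewrite big_split sumrB /= sumr_const.
have -> : \sum_i p i * (s / n%:R) *+ 2 = 2 * (s ^+ 2 / n%:R).
  by rewrite sumrMnl -mulr_suml -/s -mulr_natl; field.
have : (s / n%:R) ^+ 2 *+ #|T| <= s ^+ 2 / n%:R.
  apply: le_trans (ler_wpMn2l (sqr_ge0 _) Tn) _.
  by rewrite -mulr_natl le_eqVlt; apply/orP; left; apply/eqP; field.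
move: (_ *+ #|T|) (s ^+ 2 / n%:R) (\sum_c _) => z v w; lra.
Qed.

Definition bern (q : R) (b : bool) : R := if b then q else 1 - q.

Lemma sum_bern q : \sum_b bern q b = 1.
Proof. by rewrite big_bool /=; ring. Qed.

(* By Chebyshev, [Y = \sum_i A i * x i] lies within [u / kappa] of its mean with
   probability at least one half; Cauchy-Schwarz over the at most [3 / kappa]
   cells of length [u] bounds the probability that two copies share a cell. *)
Lemma difference_small (I : finType) (x q : I -> R) (kappa u : R) :
  (forall i, 0 <= q i <= 1) -> 0 < u -> 0 < kappa <= 1 ->
  \sum_i x i ^+ 2 * (q i * (1 - q i)) <= (u / kappa) ^+ 2 / 2 ->
  kappa / 12 <= \sum_(A : {ffun I -> bool}) \sum_(A' : {ffun I -> bool})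
    (\prod_i bern (q i) (A i)) * (\prod_i bern (q i) (A' i)) *
    (`|\sum_i ((A i)%:R - (A' i)%:R) * x i| <= u)%R%:R.
Proof.
move=> q01 u0 /andP[k0 k1] var.
pose D := u / kappa; have D0 : 0 < D by rewrite divr_gt0.
pose W (A : {ffun I -> bool}) := \prod_i bern (q i) (A i).
have W0 A : 0 <= W A.
  apply: prodr_ge0 => i _; have /andP[] := q01 i.
  by rewrite /bern; case: (A i) => //; rewrite subr_ge0.
pose Y (A : {ffun I -> bool}) := \sum_i (A i)%:R * x i.
pose mu := \sum_i q i * x i.
pose good A := `|Y A - mu| <= D.
have YE A : Y A - mu = \sum_i ((A i)%:R - q i) * x i.
  by rewrite -sumrB; apply: eq_bigr => i _; rewrite mulrBl.
have cheb : \sum_A W A * (good A)%:R >= 1 / 2.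
  have bad : \sum_A W A * (~~ good A)%:R <= 1 / 2.
    have : \sum_A W A * (Y A - mu) ^+ 2 <= D ^+ 2 / 2.
      rewrite (eq_bigr (fun A : {ffun I -> bool} => W A *
          (\sum_i ((A i)%:R - q i) * x i) ^+ 2)); last by move=> A _; rewrite YE.
      rewrite (sum_prod_weight_sq (mu := fun i => bern (q i))
        (f := fun i (b : bool) => (b%:R - q i) * x i)).
      - apply: le_trans var; apply: ler_sum => i _.
        by rewrite big_bool /= le_eqVlt; apply/orP; left; apply/eqP; ring.
      - by move=> i; exact: sum_bern.
      - by move=> i; rewrite big_bool /=; ring.
    have D2 : 0 < D ^+ 2 by rewrite exprn_gt0.
    move=> le1; rewrite -(ler_pM2r D2) div1r [leRHS]mulrC.
    apply: le_trans le1; rewrite mulr_suml; apply: ler_sum => A _.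
    rewrite -mulrA ler_wpM2l //; case: (boolP (good A)) => gA.
      by rewrite mul0r sqr_ge0.
    rewrite mul1r -[leRHS]real_normK ?num_real //.
    by rewrite ler_sqr ?nnegrE ?(ltW D0) // ltW // ltNge.
  have : \sum_A W A * (good A)%:R + \sum_A W A * (~~ good A)%:R = 1.
    rewrite -big_split -[RHS](sum_prod_weight (mu := fun i => bern (q i))
      (fun i => sum_bern (q i))).
    by apply: eq_bigr => A _ /=; rewrite -mulrDr; case: (good A); rewrite ?addr0 ?add0r mulr1.
  by move: (\sum_A _) (\sum_A _) bad => v w; lra.
(* Number of cells of length [u] that cover an interval of length [2 * u / kappa]. *)
pose n := (Num.truncn (2 / kappa)).+1.
have n3 : n%:R <= 3 / kappa.
  have : (Num.truncn (2 / kappa))%:R <= 2 / kappa.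
    by rewrite truncn_le divr_ge0 // ltW.
  have : 1 <= 1 / kappa by rewrite div1r invf_ge1.
  by rewrite /n -natr1 => h1 h2; move: h1 h2; rewrite !mulrDl ?mul1r; lra.
pose pos A := (Y A - mu + D) / u.
pose cl A : 'I_n := inord (Num.truncn (pos A)).
have posP A : good A -> 0 <= pos A <= 2 / kappa.
  rewrite /good ler_norml => /andP[g1 g2]; apply/andP; split.
    by rewrite divr_ge0 ?(ltW u0) //; lra.
  rewrite ler_pdivrMr //; have -> : 2 / kappa * u = 2 * D by rewrite /D; ring.
  by lra.
have clE A : good A -> cl A = Num.truncn (pos A) :> nat.
  move=> /posP/andP[p0 p1]; rewrite /cl inordK // ltnS.
  by apply: le_truncn.
have near A A' : good A -> good A' -> cl A = cl A' ->
    `|\sum_i ((A i)%:R - (A' i)%:R) * x i| <= u.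
  move=> gA gA' cc.
  have -> : \sum_i ((A i)%:R - (A' i)%:R) * x i = (pos A - pos A') * u.
    rewrite /pos -mulrBl mulfVK ?gt_eqF // (_ : _ - _ = Y A - Y A'); last by ring.
    by rewrite /Y -sumrB; apply: eq_bigr => i _; rewrite mulrBl.
  rewrite normrM (gtr0_norm u0) ler_piMl ?(ltW u0) //.
  have e : Num.truncn (pos A) = Num.truncn (pos A') by rewrite -!clE // cc.
  have /andP[p0 _] := posP _ gA; have /andP[p0' _] := posP _ gA'.
  have := truncn_itv p0; have := truncn_itv p0'; rewrite e.
  move: (Num.truncn _) => k; rewrite -natr1 => /andP[? ?] /andP[? ?].
  by rewrite ler_norml; apply/andP; split; lra.
pose p (c : 'I_n) := \sum_A W A * (good A && (cl A == c))%:R.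
have sump : \sum_c p c = \sum_A W A * (good A)%:R.
  rewrite exchange_big; apply: eq_bigr => A _ /=.
  rewrite (bigD1 (cl A)) //= eqxx andbT big1 ?addr0 // => c cc.
  by rewrite eq_sym (negPf cc) andbF mulr0.
(* The [n <= 3 / kappa] cells carry mass at least 1/2, so two copies share a cell with probability
   at least [(1 / 4) / (3 / kappa) = kappa / 12]. *)
apply: (@le_trans _ _ (\sum_c p c ^+ 2)).
  have := sum_sq_ge p (n := n); rewrite card_ord => /(_ (leqnn _) isT).
  apply: le_trans; rewrite sump.
  apply: (@le_trans _ _ ((1 / 4) / (3 / kappa))).
    by rewrite le_eqVlt; apply/orP; left; apply/eqP; field; rewrite gt_eqF.
  apply: ler_pM; rewrite ?invr_ge0 ?divr_ge0 ?(ltW k0) //.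
    have -> : (1 / 4 : R) = (1 / 2) ^+ 2 by rewrite expr2; field.
    by rewrite ler_sqr ?nnegrE // ?(le_trans _ cheb) // divr_ge0.
  by rewrite lef_pV2 // posrE ?ltr0n // divr_gt0.
rewrite (eq_bigr (fun c => \sum_A \sum_A' W A * W A' *
    ([&& good A, good A', cl A == c & cl A' == c])%:R)); last first.
  move=> c _; rewrite expr2 mulr_suml; apply: eq_bigr => A _.
  rewrite mulr_sumr; apply: eq_bigr => A' _.
  by case: (good A); case: (good A'); case: (cl A == c); case: (cl A' == c);
    rewrite /= ?mulr0 ?mul0r ?mulr1.
rewrite exchange_big; apply: ler_sum => A _; rewrite exchange_big.
apply: ler_sum => A' _; rewrite -mulr_sumr ler_wpM2l ?mulr_ge0 ?W0 //.
rewrite (bigD1 (cl A)) //= eqxx big1 ?addr0; last first.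
  by move=> c cc; rewrite [cl A == c]eq_sym (negPf cc) !andbF.
rewrite ler_nat; case: (boolP (good A)) => gA //=.
case: (boolP (good A')) => gA' //=; case: eqVneq => //= cc.
by rewrite near.
Qed.

End ProductWeights.

Lemma bernoulli_ineq (R : realFieldType) (y : R) (h : nat) :
  0 <= y <= 1 -> 1 - h%:R * y <= (1 - y) ^+ h.
Proof.
move=> /andP[y0 y1]; elim: h => [|h IH]; first by rewrite mul0r subr0 expr0.
rewrite exprS; apply: (@le_trans _ _ ((1 - y) * (1 - h%:R * y))).
  have : 0 <= h%:R * y ^+ 2 by rewrite mulr_ge0 ?ler0n ?sqr_ge0.
  by rewrite -natr1 expr2; lra.
by rewrite ler_wpM2l // subr_ge0.
Qed.

(** With [t = h.*2], this is the square of [(1 - 1 / t) ^ h >= 1 / 2], an instance of Bernoulli's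
    inequality. *)
Lemma miss_all_ge (R : realFieldType) (h : nat) :
  (0 < h)%N -> 1 / 4 <= (1 - (h.*2)%:R^-1) ^+ h.*2 :> R.
Proof.
move=> h0; have h2 : 2 <= (h.*2)%:R :> R.
  by rewrite (ler_nat _ 2) -(doubleS 0) leq_double.
have i01 : 0 <= ((h.*2)%:R^-1 : R) <= 1.
  by rewrite invr_ge0 ler0n /= invf_le1 //; lra.
have := bernoulli_ineq h i01.
have -> : h%:R * (h.*2)%:R^-1 = 1 / 2 :> R.
  by rewrite -muln2 natrM; field; rewrite pnatr_eq0 -lt0n.
rewrite -muln2 exprM => b1.
have -> : 1 / 4 = (1 / 2) ^+ 2 :> R by rewrite expr2; field.
rewrite ler_sqr ?nnegrE; first by move: b1; lra.
  by rewrite divr_ge0.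
by rewrite exprn_ge0 // subr_ge0 muln2; case/andP: i01.
Qed.

(** * Probability that one row sum is small *)

Section Row.
Variables (R : realType) (B T : finType) (d : nat) (l : 'I_d).
Variables (sg : B -> bool) (gb : B -> T) (x : 'I_d -> R).

Definition sgr (b : B) : R := if sg b then 1 else -1.

Definition rsum (y : {ffun 'I_d -> B}) : R :=
  \sum_(rho | rho != l) sgr (y rho) * x rho * (gb (y rho) == gb (y l))%:R.

Hypothesis unif : forall j e,
  (#|[pred b | (gb b == j) && (sg b == e)]| * (2 * #|T|) = #|B|)%N.
Hypothesis B0 : (0 < #|B|)%N.

(** [None] stands for a coordinate outside the queried bucket, [Some e] for one inside it with sign
    [e]. *)
Let val (c : option bool) : R :=
  match c with None => 0 | Some e => if e then 1 else -1 end.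
Let pi (j : T) (rho : 'I_d) (b : B) : option bool :=
  if rho == l then None else if gb b == j then Some (sg b) else None.
(** The uniform weights, restricted to queried blocks in bucket [j]; summing over [j] restores the
    uniform law. *)
Let mu (j : T) (rho : 'I_d) (b : B) : R :=
  if rho == l then (gb b == j)%:R / #|B|%:R else 1 / #|B|%:R.
Let diff (p : bool * bool) : option bool :=
  if p.1 == p.2 then None else Some p.1.
(** Law of the difference of two independent Bernoulli variables of parameter [q], with values
    encoded as for [val]. *)
Let tau (q : R) (c : option bool) : R :=
  \sum_(p | diff p == c) bern q p.1 * bern q p.2.

Let t0 : (0 < #|T|)%N.
Proof.
have /card_gt0P[b _] := B0; have := unif (gb b) (sg b).
by case: #|T| => // ; rewrite !muln0 => B00; have := B0; rewrite -B00.
Qed.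

Let nB : #|B|%:R != 0 :> R. Proof. by rewrite pnatr_eq0 -lt0n. Qed.
Let nT : #|T|%:R != 0 :> R. Proof. by rewrite pnatr_eq0 -lt0n. Qed.

Let mass_sign j e :
  \sum_(b | (gb b == j) && (sg b == e)) 1 / #|B|%:R = 1 / (2 * #|T|%:R) :> R.
Proof.
rewrite sumr_const -(unif j e) -[LHS]mulr_natl !natrM.
have : #|[pred b | (gb b == j) && (sg b == e)]|%:R != 0 :> R.
  rewrite pnatr_eq0; apply: contraTneq B0 => c0.
  by rewrite -(unif j e) c0 mul0n.
by move=> nc; field; rewrite nT nc.
Qed.

Let mass_bucket j : \sum_(b | gb b == j) 1 / #|B|%:R = 1 / #|T|%:R :> R.
Proof.
rewrite (bigID sg) /= (eq_bigl (fun b => (gb b == j) && (sg b == true)));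
  last by move=> b; rewrite eqb_id.
rewrite mass_sign (eq_bigl (fun b => (gb b == j) && (sg b == false)));
  last by move=> b; rewrite eqbF_neg.
by rewrite mass_sign; field.
Qed.

Let mass_other j : \sum_(b | gb b != j) 1 / #|B|%:R = 1 - 1 / #|T|%:R :> R.
Proof.
rewrite -(mass_bucket j); apply/eqP; rewrite eq_sym subr_eq addrC eq_sym.
rewrite -[_ == 1]/(_ == 1); apply/eqP.
transitivity (\sum_(b : B) 1 / #|B|%:R : R); first by rewrite [RHS](bigID (fun b => gb b == j)).
by rewrite sumr_const -[LHS]mulr_natl; field.
Qed.

(** Once the bucket [j] of the queried block is fixed, the outcomes of the coordinates are
    independent, and [sum_push] passes from blocks to outcomes. *)
Let avg_rsum (u : R) : avg (fun y => (`|rsum y| <= u)%R%:R) =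
  \sum_j \sum_(c : {ffun 'I_d -> option bool})
    (\prod_rho \sum_(b | pi j rho b == c rho) mu j rho b) *
    (`|\sum_rho val (c rho) * x rho| <= u)%R%:R.
Proof.
under eq_bigr => j _ do rewrite -(sum_push (mu j) (pi j)
  (fun c => (`|\sum_rho val (c rho) * x rho| <= u)%R%:R)).
rewrite exchange_big /avg mulr_suml; apply: eq_bigr => y _ /=.
rewrite (bigD1 (gb (y l))) //= [X in _ + X]big1 ?addr0 => [|j jl]; last first.
  by rewrite (bigD1 l) //= /mu eqxx eq_sym (negPf jl) !mul0r.
rewrite mulrC; congr (_ * _%:R).
  rewrite (eq_bigr (fun=> #|B|%:R^-1)).
    by rewrite prodr_const card_ffun natrX exprVn.
  by move=> rho _; rewrite /mu; case: eqP => [->|_]; rewrite ?eqxx mul1r.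
congr (`|_| <= u); rewrite /rsum [RHS](bigD1 l) //= ffunE /pi eqxx mul0r add0r.
apply: eq_bigr => rho rl; rewrite ffunE (negPf rl) /sgr.
by case: (gb (y rho) == _); rewrite /= ?mulr1 ?mulr0 ?mul0r.
Qed.

Let tauE q : tau q None = 1 - 2 * (q * (1 - q)) /\
  forall e, tau q (Some e) = q * (1 - q).
Proof.
rewrite /tau; split=> [|e].
  rewrite big_mkcond -(pair_bigA _ (fun a b =>
    if diff (a, b) == None then bern q a * bern q b else 0)) /=.
  by rewrite !big_bool /=; ring.
rewrite big_mkcond -(pair_bigA _ (fun a b =>
    if diff (a, b) == Some e then bern q a * bern q b else 0)) /=.
by rewrite !big_bool /=; case: e => /=; ring.
Qed.

Variables (heavy : {set 'I_d}) (Delta : R) (h : nat).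
Hypotheses (Th : #|T| = h.*2) (few : (#|heavy| <= #|T|)%N).
Hypothesis light : \sum_(rho | rho \notin heavy) x rho ^+ 2 <= #|T|%:R * Delta ^+ 2.

(** Only the event that all heavy coordinates miss the queried bucket is kept, of probability at
    least 1/4. There the light ones act as lazy signs of total variance at most [Delta ^ 2], and
    [difference_small] applies; [kappa / 48] is [(1 / 4) * (kappa / 12)]. *)
Lemma rsum_small (u kappa : R) : 0 <= Delta -> 0 < u -> 0 < kappa <= 1 ->
  kappa * Delta <= u ->
  kappa / 48 <= avg (fun y => (`|rsum y| <= u)%R%:R).
Proof.
move=> D0 u0 k01 kD; have /andP[k0 k1] := k01.
have h0 : (0 < h)%N by move: t0; rewrite Th double_gt0.
have T2 : 2 <= #|T|%:R :> R.
  by rewrite (ler_nat _ 2) Th -(doubleS 0) leq_double.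
have iT : 0 < (#|T|%:R^-1 : R) <= 1 / 2.
  rewrite invr_gt0 ltr0n t0 /= -[#|T|%:R^-1]div1r ler_pdivrMr ?ltr0n //.
  by move: T2; lra.
have /andP[iT0 iT2] := iT.
(* The characteristic function of a lazy sign is a squared modulus: the lazy
   sign is the difference of two independent Bernoulli variables. *)
have [q0 q01 qE] : exists2 q0 : R, 0 <= q0 <= 1 & 2 * (q0 * (1 - q0)) = 1 / #|T|%:R.
  pose s : R := Num.sqrt (1 - 2 / #|T|%:R).
  have s0 : 0 <= s by exact: sqrtr_ge0.
  have s2 : s ^+ 2 = 1 - 2 / #|T|%:R by rewrite sqr_sqrtr //; move: iT2; lra.
  have s1 : s <= 1.
    by rewrite -[leRHS]sqrtr1; apply: ler_wsqrtr; move: iT0; lra.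
  exists ((1 - s) / 2); first by apply/andP; split; lra.
  have -> : 2 * ((1 - s) / 2 * (1 - (1 - s) / 2)) = (1 - s ^+ 2) / 2 by field.
  by rewrite s2; field.
(* Parameter 0 forces the outcome [None] at the queried and the heavy coordinates; [kap] is the mass
   that this keeps. *)
pose q rho := if (rho == l) || (rho \in heavy) then 0 else q0.
pose kap rho : R := if rho == l then 1 / #|T|%:R
  else if rho \in heavy then 1 - 1 / #|T|%:R else 1.
have qr01 rho : 0 <= q rho <= 1 by rewrite /q; case: ifP; rewrite ?lexx ?ler01.
have kap0 rho : 0 <= kap rho.
  by rewrite /kap; case: ifP => _; [|case: ifP => _]; rewrite ?ler01 //;
    move: iT0 iT2; lra.
have tau_ge0 rho c : 0 <= tau (q rho) c.
  apply: sumr_ge0 => p _; have /andP[? ?] := qr01 rho.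
  by rewrite /bern mulr_ge0 //; case: ifP; rewrite ?subr_ge0.
have m_ge j rho c : kap rho * tau (q rho) c <=
    \sum_(b | pi j rho b == c) mu j rho b.
  have m0 : 0 <= \sum_(b | pi j rho b == c) mu j rho b.
    by apply: sumr_ge0 => b _; rewrite /mu; case: ifP => _; rewrite divr_ge0.
  have tau0 e : tau 0 (Some e) = 0 by rewrite (tauE 0).2 mul0r.
  rewrite /kap /q; case: (eqVneq rho l) => [rl|rl] /=.
    case: c m0 => [e|] m0; first by rewrite tau0 mulr0.
    rewrite (tauE 0).1 mul0r mulr0 subr0 mulr1 -(mass_bucket j).
    rewrite [leRHS](eq_bigr (fun b => if gb b == j then 1 / #|B|%:R else 0)).
      rewrite -big_mkcondr /= le_eqVlt; apply/orP; left; apply/eqP.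
      by apply: eq_bigl => b; rewrite /pi rl eqxx.
    by move=> b _; rewrite /mu rl eqxx; case: (gb b == j); rewrite ?mul0r.
  have mE : \sum_(b | pi j rho b == c) mu j rho b =
      \sum_(b | pi j rho b == c) 1 / #|B|%:R.
    by apply: eq_bigr => b _; rewrite /mu (negPf rl).
  rewrite mE; have mS e : \sum_(b | pi j rho b == Some e) 1 / #|B|%:R = 1 / (2 * #|T|%:R) :> R.
    rewrite -(mass_sign j e); apply: eq_bigl => b; rewrite /pi (negPf rl).
    by case: (gb b == j).
  have mN : \sum_(b | pi j rho b == None) 1 / #|B|%:R = 1 - 1 / #|T|%:R :> R.
    rewrite -(mass_other j); apply: eq_bigl => b; rewrite /pi (negPf rl).
    by case: (gb b == j).
  case: ifP => _; case: c m0 {mE} => [e|] m0; rewrite ?mS ?mN.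
  - by rewrite tau0 mulr0 divr_ge0 // mulr_ge0.
  - by rewrite (tauE 0).1 mul0r mulr0 subr0 mulr1.
  - rewrite (tauE q0).2 mul1r le_eqVlt; apply/orP; left; apply/eqP.
    have -> : q0 * (1 - q0) = (2 * (q0 * (1 - q0))) / 2 by field.
    by rewrite qE; field.
  - by rewrite (tauE q0).1 qE !mul1r.
rewrite avg_rsum.
pose phi (c : {ffun 'I_d -> option bool}) : R :=
  (`|\sum_rho val (c rho) * x rho| <= u)%R%:R.
pose M := \sum_(c : {ffun 'I_d -> option bool})
  (\prod_rho tau (q rho) (c rho)) * phi c.
apply: (@le_trans _ _ (\sum_(j : T) (\prod_rho kap rho) * M)); last first.
  apply: ler_sum => j _; rewrite /M mulr_sumr; apply: ler_sum => c _.
  rewrite mulrA -big_split /= ler_wpM2r ?ler0n //.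
  by apply: ler_prod => rho _; rewrite m_ge mulr_ge0.
(* The factor [1 / #|T|] of the queried coordinate cancels against the number of buckets; at most
   [#|T|] heavy factors remain. *)
have kap4 : 1 / 4 <= #|T|%:R * \prod_rho kap rho.
  rewrite (bigD1 l) //= {1}/kap eqxx [leRHS]mulrA [1 / #|T|%:R]mul1r mulfV // [leRHS]mul1r.
  have := miss_all_ge R h0; rewrite -Th => /le_trans; apply.
  have om : 0 <= (1 - #|T|%:R^-1 : R) <= 1 by move: iT0 iT2; lra.
  have /andP[om0 om1] := om.
  apply: (@le_trans _ _ ((1 - #|T|%:R^-1) ^+ #|heavy|)).
    by apply: ler_wiXn2l.
  rewrite -prodr_const.
  rewrite [leLHS]big_mkcond [leLHS](bigD1 l) //=.
  apply: (@le_trans _ _ (\prod_(i | i != l) (if i \in heavy then 1 - #|T|%:R^-1 else 1))).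
    rewrite ler_piMl //; last by case: ifP.
    by apply: prodr_ge0 => i _; case: ifP.
  apply: ler_prod => i il; rewrite /kap (negPf il) div1r.
  by case: ifP; rewrite ?om0 ?ler01 lexx.
have M12 : kappa / 12 <= M.
  rewrite /M -(sum_push (fun rho p => bern (q rho) p.1 * bern (q rho) p.2)
    (fun _ p => diff p) phi).
  have var : \sum_i x i ^+ 2 * (q i * (1 - q i)) <= (u / kappa) ^+ 2 / 2.
    apply: (@le_trans _ _ (Delta ^+ 2 / 2)).
      apply: (@le_trans _ _ (\sum_(rho | rho \notin heavy)
          x rho ^+ 2 * (1 / (2 * #|T|%:R)))).
        rewrite [leRHS]big_mkcond; apply: ler_sum => i _; rewrite /q.
        case: (i \in heavy); first by rewrite orbT /= mul0r mulr0.
        rewrite orbF /=; have -> : 1 / (2 * #|T|%:R) = q0 * (1 - q0).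
          have -> : q0 * (1 - q0) = (2 * (q0 * (1 - q0))) / 2 by field.
          by rewrite qE; field.
        have /andP[a1 a2] := q01.
        case: ifP => _; last by [].
        by rewrite mul0r mulr0 mulr_ge0 ?sqr_ge0 // mulr_ge0 // subr_ge0.
      rewrite -mulr_suml.
      have -> : Delta ^+ 2 / 2 = (#|T|%:R * Delta ^+ 2) * (1 / (2 * #|T|%:R)).
        by field.
      by rewrite ler_wpM2r // divr_ge0 // mulr_ge0.
    rewrite ler_pM2r ?invr_gt0 // ler_sqr ?nnegrE ?divr_ge0 ?(ltW u0) ?(ltW k0) //.
    by rewrite ler_pdivlMr // mulrC.
  apply: le_trans (difference_small qr01 u0 k01 var) _.
  rewrite le_eqVlt; apply/orP; left; apply/eqP.
  pose g (z : {ffun 'I_d -> bool} * {ffun 'I_d -> bool}) :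
    {ffun 'I_d -> bool * bool} := [ffun i => (z.1 i, z.2 i)].
  have gb' : bijective g.
    exists (fun c : {ffun 'I_d -> bool * bool} =>
      ([ffun j => (c j).1], [ffun j => (c j).2])).
      by case=> a b; congr pair; apply/ffunP => j; rewrite !ffunE.
    by move=> c; apply/ffunP => j; rewrite !ffunE; case: (c j).
  rewrite pair_bigA [RHS](reindex g) /=; last exact: onW_bij.
  apply: eq_bigr => -[a b] _ /=; rewrite -big_split /=; congr (_ * _).
    by apply: eq_bigr => i _; rewrite /g ffunE.
  rewrite /phi; congr (`|_| <= u)%R%:R; apply: eq_bigr => i _.
  rewrite ffunE /g ffunE /diff /=; congr (_ * _).
  by case: (a i); case: (b i); rewrite /= ?subrr ?subr0 ?sub0r.
rewrite sumr_const -[leRHS]mulr_natl mulrA.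
have -> : kappa / 48 = (1 / 4) * (kappa / 12) by field.
by apply: ler_pM; rewrite // divr_ge0 // ltW.
Qed.

End Row.

Local Open Scope classical_set_scope.
Local Open Scope ring_scope.

(** * Uniform buckets and Gaussian noise *)

(** The lowest bit is the parity, and the others follow by halving. *)
Lemma bits_value_inj (m : nat) (a b : 'I_m -> bool) :
  (\sum_(e < m) a e * 2 ^ e = \sum_(e < m) b e * 2 ^ e)%N -> a =1 b.
Proof.
elim: m a b => [|m IH] a b; first by move=> _ [].
rewrite !big_ord_recl /= expn0 !muln1.
have E (c : 'I_m.+1 -> bool) : (\sum_(i < m) c (lift ord0 i) * 2 ^ bump 0 i =
    (\sum_(i < m) c (lift ord0 i) * 2 ^ i).*2)%N.
  rewrite -muln2 big_distrl; apply: eq_bigr => i _ /=.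
  by rewrite /bump add1n expnSr mulnA.
rewrite !E => ab.
have a0 : a ord0 = b ord0.
  by have := congr1 odd ab; rewrite !oddD !odd_double !addbF !oddb.
move: ab; rewrite a0 => /addnI /double_inj /IH ab i.
by case: (unliftP ord0 i) => [j ->|-> //]; exact: ab.
Qed.

(** The sign bit and the bucket bits sit at distinct positions, hence are jointly uniform, and bit
    patterns are in bijection with bucket numbers. *)
Lemma block_bucket_sign_uniform (m w : nat) (p : 'I_w) (q : 'I_m -> 'I_w) :
  injective q -> (forall e, q e != p) -> forall (j : 'I_(2 ^ m)) (s : bool),
  (#|[pred B : block w | (block_bucket q B == j) && (tnth B p == s)]| *
     (2 * #|'I_(2 ^ m)|) = #|block w|)%N.
Proof.
move=> q_inj qp j s.
pose iota (o : option 'I_m) := if o is Some e then q e else p.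
have iota_inj : injective iota.
  move=> [e|] [e'|] //= => [/q_inj -> //|qe|qe].
  - by have := qp e; rewrite qe eqxx.
  - by have := qp e'; rewrite -qe eqxx.
pose val (z : {ffun 'I_m -> bool}) : 'I_(2 ^ m) :=
  Ordinal (bits_value_subproof id [tuple z i | i < m]).
have val_inj : injective val.
  move=> z z' /(congr1 (@nat_of_ord _)) /= zz; apply/ffunP => e.
  have := @bits_value_inj m z z'; apply.
  transitivity (\sum_(e < m) tnth [tuple z i | i < m] e * 2 ^ e)%N.
    by apply: eq_bigr => i _; rewrite tnth_mktuple.
  by rewrite zz; apply: eq_bigr => i _; rewrite tnth_mktuple.
have [val' valK valK'] : bijective val.
  by apply: inj_card_bij => //; rewrite card_ffun card_bool !card_ord.
pose phi (z : {ffun option 'I_m -> bool}) : rat :=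
  ((val [ffun e => z (Some e)] == j) && (z None == s))%:R.
have avg1 : avg phi = (2 ^ m.+1)%:R^-1.
  rewrite /avg card_ffun card_bool card_option card_ord.
  rewrite (bigD1 [ffun o : option 'I_m => if o is Some e then val' j e else s]) //=.
  rewrite big1 ?addr0.
    rewrite /phi ffunE eqxx andbT.
    rewrite (_ : finfun _ = val' j) ?valK' ?eqxx ?div1r //.
    by apply/ffunP => e; rewrite !ffunE.
  move=> z; apply: contraNeq; rewrite /phi pnatr_eq0 eqb0 negbK => /andP[zj zs].
  apply/eqP/ffunP => -[e|]; rewrite ffunE; last exact/eqP.
  by rewrite -(eqP zj) valK ffunE.
have := @avg_marginal rat _ 'I_w bool iota phi _ iota_inj.
rewrite card_bool => /(_ isT).
pose h (B : block w) : {ffun 'I_w -> bool} := [ffun i => tnth B i].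
have hb : bijective h.
  exists (fun f : {ffun 'I_w -> bool} => [tuple f i | i < w]) => [B|f].
    by apply: eq_from_tnth => i; rewrite tnth_mktuple ffunE.
  by apply/ffunP => i; rewrite ffunE tnth_mktuple.
rewrite -(avg_bij _ hb) avg1.
have E B : phi [ffun i => h B (iota i)] =
    ((block_bucket q B == j) && (tnth B p == s))%:R.
  rewrite /phi !ffunE /=; congr ((_ == j) && _)%:R.
  apply: ord_inj => /=; apply: eq_bigr => e _.
  by rewrite tnth_mktuple !ffunE.
rewrite (eq_avg E) /avg.
have -> : \sum_(B : block w) ((block_bucket q B == j) && (tnth B p == s))%:R =
    #|[pred B : block w | (block_bucket q B == j) && (tnth B p == s)]|%:R :> rat.
  rewrite -sum1_card natr_sum [RHS]big_mkcond; apply: eq_bigr => B _.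
  by rewrite inE; case: (_ && _).
have nB : #|block w|%:R != 0 :> rat.
  by rewrite pnatr_eq0 card_tuple card_bool -lt0n expn_gt0.
move=> H; apply/eqP; rewrite -(eqr_nat rat) natrM card_ord -expnS.
move/(canRL (divfK nB)): H => ->.
by rewrite mulrAC mulVf ?mul1r // pnatr_eq0 -lt0n expn_gt0.
Qed.

Section Noise.
Variable R : realType.

(** The standard normal density at 1, its least value on [-1, 1]. *)
Definition spread : R := normal_peak 1 * expR (- (1 / 2)).

Lemma spread_gt0 : 0 < spread.
Proof. by rewrite mulr_gt0 ?expR_gt0 ?normal_peak_gt0 ?oner_neq0. Qed.

Lemma normal_pdf_ge (sigma v : R) : 0 < sigma -> `|v| <= sigma ->
  spread / sigma <= normal_pdf 0 sigma v.
Proof.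
move=> s0 vs; rewrite normal_pdfE ?gt_eqF //.
have -> : normal_peak sigma = normal_peak 1 / sigma.
  rewrite /normal_peak expr1n mul1r -mulrnAr sqrtrM ?sqr_ge0 //.
  by rewrite sqrtr_sqr gtr0_norm // invfM mulrC.
rewrite /spread mulrAC; apply: ler_wpM2l.
  by rewrite divr_ge0 ?normal_peak_ge0 ?ltW.
rewrite /normal_fun ler_expR subr0 mulNr lerN2 -mulr_natr.
rewrite ler_pdivrMr ?mulr_gt0 ?exprn_gt0 //.
have : v ^+ 2 <= sigma ^+ 2.
  by rewrite -(real_normK (num_real v)) ler_sqr ?nnegrE // ltW.
lra.
Qed.

Lemma normal_prob_itv_ge (sigma lo hi : R) : 0 < sigma ->
  - sigma <= lo -> lo <= hi -> hi <= sigma ->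
  ((spread / sigma * (hi - lo))%:E <= normal_prob 0 sigma `]lo, hi[)%E.
Proof.
move=> s0 l1 l2 l3; rewrite /normal_prob.
apply: (@le_trans _ _ (\int[lebesgue_measure]_(x in `]lo, hi[) (spread / sigma)%:E)%E).
  rewrite integral_cst //= lebesgue_measure_itv /= lte_fin.
  case: ltP => lh; first by rewrite -EFinD -EFinM.
  by rewrite mule0 lee_fin (_ : hi - lo = 0) ?mulr0 //; lra.
apply: ge0_le_integral => //=.
- by move=> x _; rewrite lee_fin divr_ge0 ?ltW ?spread_gt0.
- apply/measurable_EFinP/measurable_funTS; exact: measurable_normal_pdf.
move=> x; rewrite in_itv /= => /andP[x1 x2]; rewrite lee_fin normal_pdf_ge //.
by rewrite ler_norml; apply/andP; split; lra.
Qed.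

Lemma gaussian_law_probability (sigma : R) :
  exists Q : probability (measurableTypeR R) R,
    forall A, gaussian_law sigma A = Q A.
Proof.
rewrite /gaussian_law; case: ifP => _.
  by exists (dirac (0 : measurableTypeR R)).
by exists (normal_prob 0 sigma).
Qed.

(** A rectangle of height [spread] over the interval from 0 to 1 fits under the density. *)
Lemma spread_le1 : spread <= 1.
Proof.
have := @normal_prob_itv_ge 1 0 1 ltr01; rewrite subr0 divr1 mulr1 lerN10 ler01 lexx.
move=> /(_ isT isT isT) le1; rewrite -lee_fin (le_trans le1) //.
exact: (probability_le1 (normal_prob 0 1)).
Qed.

(** An interval of length [min(a, sigma)] inside [[-sigma, sigma]] fits into the ball of radius [a]
    around [-S], and the density there is at least [spread / sigma]. For [sigma = 0] the point mass
    lies in the ball. *)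
Lemma gaussian_law_ball_ge (sigma S a kappa : R) :
  0 <= sigma -> 0 < a -> `|S| <= maxr sigma (a / 2) ->
  0 <= kappa <= 1 -> kappa * sigma <= a ->
  ((spread * kappa)%:E <= gaussian_law sigma [set v : R | (`|S + v| < a)%R])%E.
Proof.
move=> s0 a0 Su /andP[k0 k1] ka; rewrite /gaussian_law; case: eqVneq => [sE|sN].
  rewrite diracE mem_set /=.
    by rewrite lee_fin mulr_ile1 ?spread_le1 // ltW // spread_gt0.
  by rewrite addr0; apply: le_lt_trans Su _; rewrite sE gt_max a0; lra.
have {}s0 : 0 < sigma by rewrite lt_def sN.
pose a' := minr a sigma.
have a'0 : 0 < a' by rewrite lt_min a0.
have ka' : kappa <= a' / sigma.
  rewrite ler_pdivlMr // /a' le_min ka /=.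
  by rewrite ler_piMl // ltW.
have a'a : a' <= a by rewrite ge_min lexx.
have a's : a' <= sigma by rewrite ge_min lexx orbT.
(* If [|S| <= sigma], the interval has [-S] as an end point and extends towards 0; otherwise
   [sigma < |S| <= a / 2] and it starts at 0. *)
have [lo [l1 l2 l3]] : exists lo, [/\ - sigma <= lo, lo + a' <= sigma &
    forall v, lo < v < lo + a' -> `|S + v| < a].
  case: (lerP `|S| sigma) => Ss.
    case: (lerP 0 S) => S0.
      exists (- S); move: Ss; rewrite ler_norml => /andP[h1 h2].
      split; [lra|lra|move=> v /andP[v1 v2]].
      by rewrite ltr_norml; apply/andP; split; lra.
    exists (- S - a'); move: Ss; rewrite ler_norml => /andP[h1 h2].
    split; [lra|lra|move=> v /andP[v1 v2]].
    by rewrite ltr_norml; apply/andP; split; lra.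
  have Sa : `|S| <= a / 2 by move: Su; rewrite le_max leNgt Ss.
  exists 0; split; [lra|lra|move=> v /andP[v1 v2]].
  move: Sa; rewrite ler_norml => /andP[h1 h2]; move: Ss; rewrite ltr_normr => Ss.
  by rewrite ltr_norml; apply/andP; split; case/orP: Ss => Ss; lra.
apply: (@le_trans _ _ (normal_prob 0 sigma `]lo, lo + a'[)); last first.
  apply: (le_measure (normal_prob 0 sigma)).
  - by rewrite inE; exact: measurable_itv.
  - rewrite inE; have -> : [set v : R | `|S + v| < a] = `]- a - S, a - S[%classic.
      apply/seteqP; split => v /=; rewrite in_itv /= ltr_norml => /andP[? ?];
      by apply/andP; split; lra.
    exact: measurable_itv.
  - by move=> v /=; rewrite in_itv /=; exact: l3.
apply: le_trans (normal_prob_itv_ge s0 l1 _ l2); last by lra.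
rewrite lee_fin (addrC lo) addrK -mulrA ler_wpM2l ?(ltW spread_gt0) //.
by rewrite mulrC.
Qed.

End Noise.

Definition half_line (R : realType) (a s S : R) : set R :=
  [set v | a <= s * (S + v)].

Lemma measurable_half_line (R : realType) (a s S : R) : s = 1 \/ s = -1 ->
  measurable (half_line a s S : set (measurableTypeR R)).
Proof.
case=> ->.
  rewrite (_ : half_line _ _ _ = `[a - S, +oo[%classic); first exact: measurable_itv.
  apply/seteqP; split => v /=; rewrite /half_line /= in_itv /= mul1r andbT; lra.
rewrite (_ : half_line _ _ _ = `]-oo, - a - S]%classic); first exact: measurable_itv.
by apply/seteqP; split => v /=; rewrite /half_line /= in_itv /= mulN1r; lra.
Qed.

(** For [a > 0], erring upwards and erring downwards are disjoint and form the complement of the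
    ball. *)
Lemma half_line_opposite (R : realType) (Q : probability (measurableTypeR R) R)
    (a S : R) : 0 < a ->
  fine (Q (half_line a 1 S)) + fine (Q (half_line a (-1) S)) =
  1 - fine (Q [set v : R | (`|S + v| < a)%R]).
Proof.
move=> a0.
have m1 : measurable (half_line a 1 S : set (measurableTypeR R)).
  by apply: measurable_half_line; left.
have m2 : measurable (half_line a (-1) S : set (measurableTypeR R)).
  by apply: measurable_half_line; right.
have -> : [set v : R | (`|S + v| < a)%R] =
    ~` (half_line a 1 S `|` half_line a (-1) S).
  apply/seteqP; split => v /=.
    by rewrite ltr_norml => /andP[h1 h2] [|]; rewrite /half_line /= ?mul1r ?mulN1r; lra.
  move=> /not_orP[]; rewrite /half_line /= mul1r mulN1r => /negP + /negP.
  by rewrite -!ltNge ltr_norml => h1 h2; apply/andP; split; lra.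
have mU : measurable (half_line a 1 S `|` half_line a (-1) S : set (measurableTypeR R)).
  exact: measurableU.
rewrite probability_setC // measureU //; last first.
  by apply/seteqP; split => v //= []; rewrite /half_line /= mul1r mulN1r; lra.
have f1 := fin_num_measure Q _ m1; have f2 := fin_num_measure Q _ m2.
rewrite fineB ?fin_numD ?f1 ?f2 //= fineD //; ring.
Qed.

Section RowProbability.
Variables (R : realType) (B T : finType) (d : nat) (l : 'I_d).
Variables (sg : B -> bool) (gb : B -> T) (x : 'I_d -> R).
Variables (fl : B -> B) (Q : probability (measurableTypeR R) R).
Hypotheses (flK : involutive fl) (flg : forall b, gb (fl b) = gb b)
  (fls : forall b, sg (fl b) = ~~ sg b).

Definition row_prob (a eps : R) (y : {ffun 'I_d -> B}) : R :=
  fine (Q (half_line a (eps * sgr R sg (y l)) (rsum l sg gb x y))).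

Lemma sgr_pm b : sgr R sg b = 1 \/ sgr R sg b = -1.
Proof. by rewrite /sgr; case: (sg b); [left|right]. Qed.

Lemma row_prob01 a eps y : eps = 1 \/ eps = -1 -> 0 <= row_prob a eps y <= 1.
Proof.
move=> e1; have m : measurable (half_line a (eps * sgr R sg (y l))
    (rsum l sg gb x y) : set (measurableTypeR R)).
  apply: measurable_half_line; case: e1 => ->; case: (sgr_pm (y l)) => ->;
  rewrite ?mul1r ?mulN1r ?opprK; by [left|right].
rewrite fine_ge0 ?measure_ge0 //= -lee_fin fineK ?fin_num_measure //.
exact: probability_le1.
Qed.

(** Flipping the sign bit of the queried block preserves the law and the row sum but exchanges the
    two directions. Each direction therefore has half the probability of an error, and an error is
    avoided with probability at least [beta] whenever the row sum is at most [u] in absolute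
    value. *)
Lemma avg_row_prob (a eps u beta kappa : R) : eps = 1 \/ eps = -1 -> 0 < a ->
  (0 < #|B|)%N -> 0 <= beta ->
  (forall S, `|S| <= u -> beta <= fine (Q [set v : R | (`|S + v| < a)%R])) ->
  kappa <= avg (fun y => (`|rsum l sg gb x y| <= u)%R%:R) ->
  avg (row_prob a eps) <= 1 / 2 - beta * kappa / 2.
Proof.
move=> e1 a0 B0 b0 bQ kap.
pose fly (y : {ffun 'I_d -> B}) := [ffun rho => if rho == l then fl (y rho) else y rho].
have flyb : bijective fly.
  exists fly => y; apply/ffunP => rho; rewrite !ffunE;
  by case: (eqVneq rho l) => [->|rl]; rewrite ?flK.
have rs y : rsum l sg gb x (fly y) = rsum l sg gb x y.
  apply: eq_bigr => rho rl; rewrite !ffunE (negPf rl) eqxx flg //.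
have cF : (0 < #|{ffun 'I_d -> B}|)%N by rewrite card_ffun expn_gt0 B0.
have -> : avg (row_prob a eps) =
    avg (fun y => (1 - fine (Q [set v : R | (`|rsum l sg gb x y + v| < a)%R])) / 2).
  have E : avg (row_prob a eps) = avg (fun y => (row_prob a eps y + row_prob a eps (fly y)) / 2).
    rewrite (eq_avg (fun y => mulrC _ _)) avgZ avgD (avg_bij (row_prob a eps) flyb).
    by field.
  rewrite E; apply: eq_avg => y; congr (_ / 2).
  rewrite -half_line_opposite // /row_prob rs ffunE eqxx /sgr fls.
  by case: e1 => ->; case: (sg (y l)); rewrite /= ?mul1r ?mulN1r ?opprK ?mulr1 // addrC.
rewrite (eq_avg (fun y => mulrC _ _)) avgZ avgB avg_cst //.
have : beta * kappa <= avg (fun y : {ffun 'I_d -> B} =>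
    fine (Q [set v : R | (`|rsum l sg gb x y + v| < a)%R])).
  apply: (@le_trans _ _ (beta * avg (fun y => (`|rsum l sg gb x y| <= u)%R%:R))).
    by rewrite ler_wpM2l.
  rewrite -avgZ; apply: ler_avg => y; case: (boolP (_ <= u)) => [/bQ|_].
    by rewrite mulr1.
  by rewrite mulr0 fine_ge0.
lra.
Qed.

End RowProbability.

(** * Chernoff's bound for independent rows *)

Section Chernoff.
Variables (R : realType) (B : finType) (r d : nat).

Definition ones (beta : {ffun 'I_r -> bool}) : nat := \sum_i beta i.

(** Exponential moments with base [lam], the optimal one for success probability [1 / 2 - delta] and
    threshold [r / 2]; independence of the rows is [avg_rows]. *)
Lemma chernoff (R0 : nat) (p : {ffun 'I_d -> B} -> R) (delta : R) :
  (0 < #|B|)%N -> (r <= R0.*2)%N -> (forall y, 0 <= p y <= 1) ->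
  0 <= delta < 1 / 2 -> avg p <= 1 / 2 - delta ->
  avg (fun y : {ffun 'I_r * 'I_d -> B} =>
    \sum_(beta : {ffun 'I_r -> bool} | (R0 <= ones beta)%N)
      \prod_i bern (p [ffun rho => y (i, rho)]) (beta i))
    <= expR (- (2 * delta ^+ 2 * r%:R)).
Proof.
move=> B0 rR p01 /andP[d0 d1] avgp.
pose lam := (1 / 2 + delta) / (1 / 2 - delta).
have h0 : 0 < 1 / 2 - delta by lra.
have lam1 : 1 <= lam by rewrite /lam ler_pdivlMr //; lra.
have lam0 : 0 < lam by apply: lt_le_trans lam1.
(* Markov's inequality: on the event [lam ^ ones] is at least [lam ^ R0], and the sum over all
   [beta] factorises. *)
have step (y : {ffun 'I_r * 'I_d -> B}) :
    \sum_(beta : {ffun 'I_r -> bool} | (R0 <= ones beta)%N)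
      \prod_i bern (p [ffun rho => y (i, rho)]) (beta i) <=
    (lam ^+ R0)^-1 * \prod_(i < r) (1 + (lam - 1) * p [ffun rho => y (i, rho)]).
  have bern0 (i : 'I_r) b : 0 <= bern (p [ffun rho => y (i, rho)]) b.
    by have /andP[? ?] := p01 [ffun rho => y (i, rho)]; case: b; rewrite /= ?subr_ge0.
  rewrite (eq_bigr (fun i => \sum_(b : bool)
    lam ^+ b * bern (p [ffun rho => y (i, rho)]) b)); last first.
    by move=> i _; rewrite big_bool /= expr1 expr0; ring.
  rewrite bigA_distr_bigA mulr_sumr big_mkcond; apply: ler_sum => beta _.
  rewrite big_split /= prodrXr -/(ones beta) mulrA.
  have P0 : 0 <= \prod_(i < r) bern (p [ffun rho => y (i, rho)]) (beta i).
    by apply: prodr_ge0 => i _.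
  case: ifP => R0b; last by rewrite mulr_ge0 // mulr_ge0 ?invr_ge0 ?exprn_ge0 // ltW.
  rewrite ler_peMl // mulrC ler_pdivlMr ?exprn_gt0 // mul1r.
  by rewrite ler_weXn2l.
apply: le_trans (ler_avg step) _.
rewrite avgZ (avg_rows (fun i f => 1 + (lam - 1) * p f)).
rewrite prodr_const card_ord avgD avgZ avg_cst; last by rewrite card_ffun expn_gt0 B0.
have m0 : 0 <= avg p by apply: avg_ge0 => y; have /andP[] := p01 y.
have le1 : 1 + (lam - 1) * avg p <= 1 + 2 * delta.
  rewrite lerD2l; apply: (@le_trans _ _ ((lam - 1) * (1 / 2 - delta))).
    by rewrite ler_wpM2l // subr_ge0.
  by rewrite /lam mulrBl divfK ?gt_eqF //; lra.
have ge0 : 0 <= 1 + (lam - 1) * avg p by rewrite addr_ge0 // mulr_ge0 // subr_ge0.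
apply: (@le_trans _ _ ((lam ^+ R0)^-1 * (1 + 2 * delta) ^+ r)).
  rewrite ler_wpM2l ?invr_ge0 ?exprn_ge0 ?(ltW lam0) //.
  by apply: lerXn2r => //; rewrite nnegrE //; lra.
(* Squaring avoids [lam ^ (r / 2)]; then [lam^-1 * (1 + 2 delta) ^ 2 = 1 - 4 delta ^ 2]. *)
rewrite -ler_sqr ?nnegrE ?expR_ge0 ?mulr_ge0 ?invr_ge0 ?exprn_ge0 ?(ltW lam0) //;
  last by lra.
rewrite exprMn exprVn -!exprM muln2.
apply: (@le_trans _ _ ((lam ^+ r)^-1 * (1 + 2 * delta) ^+ (r * 2))).
  rewrite ler_wpM2r ?exprn_ge0 //; first by lra.
  by rewrite lef_pV2 ?posrE ?exprn_gt0 // ler_weXn2l.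
rewrite mulnC exprM -exprVn -exprMn -expRM_natr mulNr.
have -> : - (2 * delta ^+ 2 * r%:R * 2%:R) = (- (4 * delta ^+ 2)) * r%:R by ring.
rewrite expRM_natr.
have E : lam^-1 * (1 + 2 * delta) ^+ 2 = 1 - 4 * delta ^+ 2.
  by rewrite /lam invf_div; field; rewrite gt_eqF //; lra.
apply: lerXn2r; rewrite ?nnegrE ?expR_ge0 //.
  by rewrite mulr_ge0 ?invr_ge0 ?(ltW lam0) ?sqr_ge0.
by rewrite E; exact: expR_ge1Dx.
Qed.

End Chernoff.

(** * Probabilities of output events *)

Section FiniteProbability.
Context (R : realType) (disp : measure_display) (Omega : measurableType disp).
Variable P : probability Omega R.

Lemma integral_sum_indic (I : finType) (A : I -> set Omega) :
  (forall i, measurable (A i)) ->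
  (\int[P]_om (\sum_i \1_(A i) om)%:E = \sum_i P (A i))%E.
Proof.
move=> mA; under eq_integral => om _ do rewrite -sumEFin.
rewrite ge0_integral_sum //.
- by apply: eq_bigr => i _; rewrite integral_indic // setIT.
- by move=> i; apply/measurable_EFinP; exact: measurable_indic.
Qed.

(** Disjointness and covering are stated as one identity of indicators, which is integrated. *)
Lemma prob_disjoint (I : finType) (G : set Omega) (A : I -> set Omega) :
  measurable G -> (forall i, measurable (A i)) ->
  (forall om, \1_G om = \sum_i \1_(A i) om :> R) -> P G = (\sum_i P (A i))%E.
Proof.
move=> mG mA GA; rewrite -integral_sum_indic // -[in LHS](setIT G).
by rewrite -integral_indic //; apply: eq_integral => om _; rewrite GA.
Qed.

Lemma fine_prob_disjoint (I : finType) (G : set Omega) (A : I -> set Omega) :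
  measurable G -> (forall i, measurable (A i)) ->
  (forall om, \1_G om = \sum_i \1_(A i) om :> R) ->
  fine (P G) = \sum_i fine (P (A i)).
Proof.
move=> mG mA GA; rewrite (prob_disjoint mG mA GA).
rewrite (eq_bigr (fun i => (fine (P (A i)))%:E)) ?sumEFin // => i _.
by rewrite fineK // fin_num_measure.
Qed.

(** Lets the noise be frozen: an inequality between averages, valid at each outcome, is integrated
    over the outcomes. *)
Lemma avg_prob_le (I J : finType) (A : I -> set Omega) (B : J -> set Omega)
    (e : R) : (forall i, measurable (A i)) -> (forall j, measurable (B j)) ->
  0 <= e ->
  (forall om, avg (fun i => \1_(A i) om) <= avg (fun j => \1_(B j) om) + e) ->
  avg (fun i => fine (P (A i))) <= avg (fun j => fine (P (B j))) + e.
Proof.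
move=> mA mB e0 AB.
have E (L : finType) (C : L -> set Omega) : (forall i, measurable (C i)) ->
    (\int[P]_om (avg (fun i => \1_(C i) om))%:E = (avg (fun i => fine (P (C i))))%:E)%E.
  move=> mC; under eq_integral => om _ do rewrite /avg mulrC EFinM.
  rewrite ge0_integralZl_EFin ?invr_ge0 //.
  - rewrite integral_sum_indic // /avg mulrC EFinM; congr (_ * _)%E.
    rewrite -sumEFin; apply: eq_bigr => i _.
    by rewrite fineK // fin_num_measure.
  - by move=> om _; rewrite lee_fin sumr_ge0.
  - apply/measurable_EFinP; apply: measurable_sum => i.
    exact: measurable_indic.
rewrite -lee_fin EFinD -!E //.
have -> : (e%:E = \int[P]_om e%:E)%E.
  by rewrite integral_cst //= probability_setT mule1.
have mavg (L : finType) (C : L -> set Omega) : (forall i, measurable (C i)) ->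
    measurable_fun setT (fun om => (avg (fun i => \1_(C i) om : R))%:E).
  move=> mC; apply/measurable_EFinP; apply: measurable_funM => //.
  by apply: measurable_sum => i; exact: measurable_indic.
rewrite -ge0_integralD //; last 2 first.
- by move=> om _; rewrite lee_fin avg_ge0.
- exact: mavg.
apply: ge0_le_integral => //.
- by move=> om _; rewrite lee_fin avg_ge0.
- exact: mavg.
- by apply: emeasurable_funD => //; exact: mavg.
- by move=> om _; rewrite -EFinD lee_fin.
Qed.

End FiniteProbability.

Lemma size_gen (B K : finType) (H : K -> B -> B) (b : nat)
    (hs : seq {ffun 'I_b -> K}) (x : B) : size (gen H hs x) = (b ^ size hs)%N.
Proof. by elim: hs => //= h hs IH; rewrite size_expand IH expnSr. Qed.

(** Position [j] of an expanded list comes from position [j %/ b] under the hash function of the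
    lowest digit, so digits are consumed from the outermost level inwards. *)
Lemma fastprg_block_gen (w b k : nat) (b_gt0 : (0 < b)%N) (K : finType)
    (H : K -> block w -> block w) (kk : 'I_k -> {ffun 'I_b -> K})
    (x x0 : block w) (j : nat) : (j < b ^ k)%N ->
  fastprg_block b_gt0 (fun i e => H (kk i e)) x j =
  nth x0 (gen H (codom kk) x) j.
Proof.
rewrite /codom /image_mem /fastprg_block.
elim: k kk j => [|k IH] kk j.
  rewrite expn0 ltnS leqn0 => /eqP ->.
  by rewrite (_ : enum 'I_0 = [::]) //; apply/size0nil; rewrite size_enum_ord.
rewrite expnSr => jb; rewrite enum_ordSl /= foldr_map -map_comp.
have jb' : (j %/ b < b ^ k)%N by rewrite ltn_divLR.
have := IH (kk \o lift ord0) (j %/ b)%N jb'.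
set y := foldr _ _ _ => yE.
have -> : foldr (fun (i : 'I_k) (y : block w) =>
    H (kk (lift ord0 i) (digit b_gt0 j (lift ord0 i))) y) x (enum 'I_k) = y.
  rewrite /y; elim: (enum 'I_k) => //= i e ->; congr (H (kk _ _) _).
  apply: val_inj => /=.
  by rewrite /bump add1n expnS divnMA.
rewrite yE.
have sz : size (gen H [seq kk (lift ord0 i) | i <- enum 'I_k] x) = (b ^ k)%N.
  by rewrite size_gen size_map size_enum_ord.
set s := gen H _ x in sz *.
have key (s' : seq (block w)) n : (n < size s' * b)%N ->
    nth x0 (expand H (kk ord0) s') n = H (kk ord0 (digit b_gt0 n 0)) (nth x0 s' (n %/ b)).
  elim: s' n => [|u s' IHs] n /=; first by rewrite mul0n.
  rewrite mulSn nth_cat size_hash_all => nb; case: ltnP => nb'.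
    rewrite divn_small //= /hash_all /codom /image_mem.
    rewrite (nth_map (Ordinal nb')) ?size_enum_ord // ffunE; congr (H (kk _ _) _).
    by apply: val_inj; rewrite /= nth_enum_ord // expn0 divn1 modn_small.
  rewrite IHs; last by rewrite ltn_subLR.
  have nE : n = (b + (n - b))%N by rewrite subnKC.
  have dE : (n %/ b = ((n - b) %/ b).+1)%N.
    by rewrite [in LHS]nE divnDl // divnn b_gt0.
  rewrite dE /=; congr (H (kk _ _) _); apply: val_inj => /=.
  by rewrite !expn0 !divn1 [in RHS]nE modnDl.
by rewrite key ?sz.
Qed.

(** * Joint law of the seed and the noise *)

Section Independence.
Context (R : realType) (disp : measure_display) (Omega : measurableType disp).
Variable P : probability Omega R.
Variables (w b k r t : nat) (K : finType).
Variables (X : Omega -> block w) (key : 'I_k -> 'I_b -> Omega -> K).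
Variables (sigma : R) (nu : 'I_r -> 'I_t -> {RV P >-> R}).
Hypothesis rnd : pcs_randomness X key sigma nu.

Definition seed (om : Omega) : block w * {ffun 'I_k -> {ffun 'I_b -> K}} :=
  (X om, [ffun i => [ffun j => key i j om]]).

Definition law (A : set R) : R := fine (gaussian_law sigma A).

Let mX v : measurable (X @^-1` [set v]). Proof. by case: rnd => /(_ v)[]. Qed.
Let mkey i j v : measurable (key i j @^-1` [set v]).
Proof. by case: rnd => _ /(_ i j v)[]. Qed.

Lemma seed_preimage v : seed @^-1` [set v] =
  X @^-1` [set v.1] `&` \bigcap_(p in [set: 'I_k * 'I_b])
    key p.1 p.2 @^-1` [set v.2 p.1 p.2].
Proof.
case: v => x kk; apply/seteqP; split => om /=.
  by case=> <- <-; split=> // -[i j] _ /=; rewrite !ffunE.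
case=> Xx kkk; rewrite /seed Xx; congr pair.
apply/ffunP => i; rewrite !ffunE; apply/ffunP => j; rewrite ffunE.
exact: (kkk (i, j) I).
Qed.

Lemma measurable_seed v : measurable (seed @^-1` [set v]).
Proof.
rewrite seed_preimage; apply: measurableI => //.
by apply: fin_bigcap_measurable => // -[i j] _ /=.
Qed.

(** Mutual independence is applied to all seed variables together with one noise entry per row, the
    one that the queried bucket will select. *)
Lemma prob_seed_noise v (j : 'I_r -> 'I_t) (A : 'I_r -> set (measurableTypeR R)) :
  (forall i, measurable (A i)) ->
  P (seed @^-1` [set v] `&`
     \bigcap_(i in [set: 'I_r]) nu i (j i) @^-1` A i) =
  (#|{: block w * {ffun 'I_k -> {ffun 'I_b -> K}}}|%:R^-1 *
   \prod_i law (A i))%:E.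
Proof.
move=> mA; have [hX hkey hnu hind] := rnd.
pose J : {set unit + 'I_k * 'I_b + 'I_r * 'I_t} :=
  [set a | if a is inr p then p.2 == j p.1 else true]%SET.
pose E (a : unit + 'I_k * 'I_b + 'I_r * 'I_t) : set Omega :=
  match a with
  | inl (inl _) => X @^-1` [set v.1]
  | inl (inr p) => key p.1 p.2 @^-1` [set v.2 p.1 p.2]
  | inr p => nu p.1 p.2 @^-1` A p.1
  end.
have EJ a : a \in J -> pcs_events X key nu a (E a).
  move: a => [[u|[i e]]|[i e]] _ /=.
  - by exists [set v.1] => //; rewrite setTI.
  - by exists [set v.2 i e] => //; rewrite setTI.
  - by exists (A i); [exact: mA|rewrite setTI].
have -> : seed @^-1` [set v] `&` \bigcap_(i in [set: 'I_r]) nu i (j i) @^-1` A i =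
    \bigcap_(a in [set` J]) E a.
  rewrite seed_preimage; apply/seteqP; split => om /=.
    case=> -[oX ok] on [[u _|p _]|p].
    - exact: oX.
    - exact: ok.
    - by rewrite /= inE /= => /eqP pj; rewrite pj; exact: on.
  move=> H; split; first split.
  - by apply: (H (inl (inl tt))); rewrite /= inE.
  - by move=> p _; apply: (H (inl (inr p))); rewrite /= inE.
  - by move=> i _; apply: (H (inr (i, j i))); rewrite /= inE /=.
rewrite (hind J E EJ).
pose f (a : unit + 'I_k * 'I_b + 'I_r * 'I_t) : R :=
  match a with
  | inl (inl _) => #|block w|%:R^-1
  | inl (inr _) => #|K|%:R^-1
  | inr p => law (A p.1)
  end.
rewrite (eq_bigr (fun a => (f a)%:E)); last first.
  move=> [[u|[i e]]|[i e]] _ /=.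
  - by have [_ ->] := hX v.1.
  - by have [_ ->] := hkey i e (v.2 i e).
  - have [Q QE] := gaussian_law_probability sigma.
    rewrite -[LHS]/(distribution P (nu i e) (A i)) hnu // /law QE.
    by rewrite fineK // fin_num_measure.
rewrite prodEFin; congr (_%:E).
rewrite big_sumType big_sumType /=; congr (_ * _).
  rewrite card_prod !card_ffun !card_ord natrM invfM; congr (_ * _).
    rewrite (eq_bigl predT) => [|u]; last by rewrite inE.
    by rewrite big_const card_unit /= mulr1.
  rewrite (eq_bigl predT) => [|u]; last by rewrite inE.
  by rewrite prodr_const card_prod !card_ord -expnM natrX exprVn mulnC.
rewrite (eq_bigl (fun p : 'I_r * 'I_t => p.2 == j p.1)) => [|p]; last by rewrite inE.
rewrite -(pair_big_dep xpredT (fun i e => e == j i) (fun i e => law (A i))) /=.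
by apply: eq_bigr => i _; rewrite big_pred1_eq.
Qed.

End Independence.

Section CountEvents.
Context (R : realType) (disp : measure_display) (Omega : measurableType disp).
Variable P : probability Omega R.
Variables (w b k r t : nat) (K : finType).
Variables (X : Omega -> block w) (key : 'I_k -> 'I_b -> Omega -> K).
Variables (sigma : R) (nu : 'I_r -> 'I_t -> {RV P >-> R}).
Hypothesis rnd : pcs_randomness X key sigma nu.

Local Notation seedT := (block w * {ffun 'I_k -> {ffun 'I_b -> K}})%type.

Definition count_event (R0 : nat) (j : 'I_r -> 'I_t)
    (A : 'I_r -> set (measurableTypeR R)) : set Omega :=
  [set om | (R0 <= \sum_(i < r) `[< A i (nu i (j i) om) >])%N].

(** Tail of a Poisson binomial law with success probabilities [p i]. *)
Definition binomial_tail (R0 : nat) (p : 'I_r -> R) : R :=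
  \sum_(beta : {ffun 'I_r -> bool} | (R0 <= ones beta)%N)
    \prod_i bern (p i) (beta i).

Let pattern (j : 'I_r -> 'I_t) (A : 'I_r -> set (measurableTypeR R))
    (beta : {ffun 'I_r -> bool}) : set Omega :=
  \bigcap_(i in [set: 'I_r])
    nu i (j i) @^-1` (if beta i then A i else ~` A i).

Let mpattern j A beta : (forall i, measurable (A i)) ->
  measurable (pattern j A beta).
Proof.
move=> mA; apply: fin_bigcap_measurable => // i _.
rewrite -[_ @^-1` _]setTI; apply: measurable_funP => //.
by case: (beta i); [exact: mA|exact: (measurableC (mA i))].
Qed.

Let count_eventE (R0 : nat) j A om : \1_(count_event R0 j A) om =
  \sum_(beta : {ffun 'I_r -> bool})
    \1_(if (R0 <= ones beta)%N then pattern j A beta else set0) om :> R.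
Proof.
pose b0 : {ffun 'I_r -> bool} := [ffun i => `[< A i (nu i (j i) om) >]].
have inb0 beta : pattern j A beta om <-> beta = b0.
  split=> [H|-> i _] /=; last by rewrite ffunE; case: asboolP.
  apply/ffunP => i; rewrite ffunE; have := H i I => /=.
  by case: (beta i) => /= h; symmetry; [exact/asboolP|apply/asboolPn].
rewrite (bigD1 b0) //= big1 ?addr0 => [|beta bb]; last first.
  rewrite indicE; case: ifP => _; last by rewrite in_set0.
  by rewrite memNset // => /inb0 /eqP; rewrite (negPf bb).
rewrite !indicE; congr (nat_of_bool _)%:R.
have -> : ones b0 = (\sum_(i < r) `[< A i (nu i (j i) om) >])%N.
  by apply: eq_bigr => i _; rewrite ffunE.
case: (boolP (R0 <= _)%N) => h; last by rewrite memNset ?in_set0 //; exact/negP.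
by rewrite !mem_set //; exact/inb0.
Qed.

Lemma measurable_count_event R0 j A : (forall i, measurable (A i)) ->
  measurable (count_event R0 j A).
Proof.
move=> mA; rewrite (_ : count_event R0 j A =
    \bigcup_(beta in [set beta : {ffun 'I_r -> bool} | (R0 <= ones beta)%N])
      pattern j A beta).
  by apply: fin_bigcup_measurable => // beta _; exact: mpattern.
apply/seteqP; split => om.
  move=> ho; pose b0 : {ffun 'I_r -> bool} := [ffun i => `[< A i (nu i (j i) om) >]].
  exists b0 => /=.
    apply: (leq_trans ho); apply: leq_sum => i _; by rewrite ffunE.
  by move=> i _ /=; rewrite ffunE; case: asboolP.
case=> beta /= hb Hb; rewrite /count_event /=; apply: (leq_trans hb).
apply: leq_sum => i _; have := Hb i I => /=; case: (beta i) => //= h.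
by case: asboolP.
Qed.

Lemma law_setC A : measurable (A : set (measurableTypeR R)) ->
  law sigma (~` A) = 1 - law sigma A.
Proof.
move=> mA; have [Q QE] := gaussian_law_probability sigma.
by rewrite /law !QE probability_setC // fineB ?fin_num_measure.
Qed.

Lemma prob_seed_count (v : seedT) (R0 : nat) j A : (forall i, measurable (A i)) ->
  fine (P (seed X key @^-1` [set v] `&` count_event R0 j A)) =
  #|{: seedT}|%:R^-1 * binomial_tail R0 (fun i => law sigma (A i)).
Proof.
move=> mA.
have mS := measurable_seed rnd v.
rewrite (@fine_prob_disjoint _ _ _ P {ffun 'I_r -> bool} _ (fun beta =>
  seed X key @^-1` [set v] `&`
  (if (R0 <= ones beta)%N then pattern j A beta else set0))).
- rewrite /binomial_tail mulr_sumr [RHS]big_mkcond; apply: eq_bigr => beta _.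
  case: ifP => _; last by rewrite setI0 measure0.
  rewrite (prob_seed_noise rnd) /=; last first.
    by move=> i; case: ifP => // _; exact: (measurableC (mA i)).
  congr (_ * _); apply: eq_bigr => i _.
  by case: (beta i) => //=; rewrite law_setC.
- by apply: measurableI => //; exact: measurable_count_event.
- by move=> beta; apply: measurableI => //; case: ifP => // _; exact: mpattern.
- move=> om; rewrite indicI /= count_eventE mulr_sumr.
  by apply: eq_bigr => beta _; rewrite indicI.
Qed.

Lemma seed_partition (G : seedT -> set Omega) :
  (forall v, measurable (G v)) ->
  measurable [set om | G (seed X key om) om] /\
  fine (P [set om | G (seed X key om) om]) =
    \sum_v fine (P (seed X key @^-1` [set v] `&` G v)).
Proof.
move=> mG; have mS v := measurable_seed rnd v.
have m : measurable [set om | G (seed X key om) om].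
  rewrite (_ : [set om | _] = \bigcup_(v in [set: seedT])
    (seed X key @^-1` [set v] `&` G v)).
    by apply: fin_bigcup_measurable => // v _; exact: measurableI.
  apply/seteqP; split => om /=; first by exists (seed X key om).
  by case=> v _ [/= ->].
split=> //; apply: fine_prob_disjoint => // [v|om]; first exact: measurableI.
rewrite (bigD1 (seed X key om)) //= big1 ?addr0 => [|v vs].
  by rewrite !indicE; congr (nat_of_bool _)%:R; apply/idP/idP; rewrite !inE /=; [split|case].
by rewrite indicE memNset // => -[/= /esym/eqP]; rewrite (negPf vs).
Qed.

Lemma seedT_gt0 : (0 < #|{: seedT}|)%N.
Proof.
rewrite lt0n; apply/negP => /eqP/card0_eq s0.
have := probability_setT P; rewrite (_ : setT = set0) ?measure0.
  by move/eqP; rewrite eq_sym onee_eq0.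
by apply/seteqP; split=> // om _; have := s0 (seed X key om); rewrite !inE.
Qed.

Lemma prob_count_event (R0 : nat) j A : (forall i, measurable (A i)) ->
  fine (P (count_event R0 j A)) = binomial_tail R0 (fun i => law sigma (A i)).
Proof.
move=> mA; have mC := measurable_count_event R0 j mA.
have [_ ->] := seed_partition (fun=> mC).
rewrite (eq_bigr (fun=> #|{: seedT}|%:R^-1 *
  binomial_tail R0 (fun i => law sigma (A i)))); last first.
  by move=> v _; exact: prob_seed_count.
rewrite sumr_const -[LHS]mulr_natl mulrA mulfV ?mul1r //.
by rewrite pnatr_eq0 -lt0n seedT_gt0.
Qed.

(** The seed is uniform and independent of the noise, so it may be frozen and then averaged over,
    although the event depends on it. *)
Lemma prob_seed_event (G : seedT -> set Omega) (R0 : nat) :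
  (forall v, exists j A, (forall i, measurable (A i)) /\ G v = count_event R0 j A) ->
  fine (P [set om | G (seed X key om) om]) = avg (fun v => fine (P (G v))).
Proof.
move=> hG.
have mG v : measurable (G v).
  by have [j [A [mA ->]]] := hG v; exact: measurable_count_event.
have [_ ->] := seed_partition mG; rewrite /avg mulrC mulr_sumr.
apply: eq_bigr => v _; have [j [A [mA ->]]] := hG v.
by rewrite prob_seed_count // prob_count_event.
Qed.

Variable H : K -> block w -> block w.
Hypothesis H2 : two_wise_independent H.
Hypothesis b2 : (2 <= b)%N.

Definition output (om : Omega) : seq (block w) :=
  gen H (codom (seed X key om).2) (seed X key om).1.

Lemma avg_seed (phi : seq (block w) -> R) :
  avg (fun v : seedT => phi (gen H (codom v.2) v.1)) =
  iavg k (fun hs => avg (fun x => phi (gen H (b := b) hs x))).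
Proof. by rewrite avg_prod iavg_ffun [RHS]exchange_avg. Qed.

Variables (n : nat) (sN : R).
Hypotheses (n0 : (0 < n)%N) (sN0 : 0 < sN) (sN2 : sN ^+ 2 = (2 ^ w)%:R).

(** At a fixed outcome of the noise, [nisan] compares the averages of the indicator over seeds and
    over independent blocks; [avg_prob_le] integrates this comparison. *)
Lemma prob_output_le (I : finType) (G : seq (block w) -> set Omega) (R0 : nat) :
  (forall y, exists j A, (forall i, measurable (A i)) /\ G y = count_event R0 j A) ->
  (forall om, tame I (fun y => \1_(G y) om : R)) ->
  fine (P [set om | G (output om) om]) <=
    iavg (b ^ k) (fun y => fine (P (G y))) + (b ^ k)%:R * fooling_error n sN I.
Proof.
move=> hG tG.
have mG y : measurable (G y).
  by have [j [A [mA ->]]] := hG y; exact: measurable_count_event.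
rewrite (prob_seed_event (G := fun v => G (gen H (codom v.2) v.1)) (R0 := R0));
  last by move=> v; exact: hG.
have B0 : (0 < #|block w|)%N by rewrite card_tuple card_bool expn_gt0.
have e0 : 0 <= fooling_error n sN I.
  by rewrite !(mulr_ge0, addr_ge0, invr_ge0) ?exprn_ge0 // ltW.
rewrite iavg_ffun; apply: avg_prob_le => //; first by rewrite mulr_ge0.
move=> om; rewrite (avg_seed (fun y => \1_(G y) om)) -(iavg_ffun _ (fun y => \1_(G y) om)).
have kK : (k == 0)%N || (0 < #|K|)%N.
  case: (posnP k) => [//|k0] /=; have := seedT_gt0.
  rewrite card_prod muln_gt0 => /andP[_]; rewrite !card_ffun !card_ord.
  by case: #|K| => //; rewrite exp0n ?(ltnW b2) // exp0n.
have := @nisan R (block w) K H b n sN I k (fun y => \1_(G y) om) _ B0 n0 sN0 _ b2 kK (tG om).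
rewrite card_tuple card_bool => /(_ H2 sN2).
rewrite ler_norml lerBlDl => /andP[_]; exact.
Qed.

End CountEvents.

Section Heavy.
Variables (R : realType) (d : nat) (x : 'rV[R]_d).

Lemma entries_before_trichotomy (j l : 'I_d) : j != l ->
  (j \in entries_before x l) || (l \in entries_before x j).
Proof.
move=> jl; rewrite !inE; case: (ltrgtP `|x 0 j| `|x 0 l|) => //= _.
by rewrite -neq_ltn.
Qed.

Lemma entries_before_proper (j l : 'I_d) : j \in entries_before x l ->
  (#|entries_before x j| < #|entries_before x l|)%N.
Proof.
move=> jl; apply: proper_card; apply/properP; split.
  apply/fintype.subsetP => k; move: jl; rewrite !inE.
  move=> /orP[h1|/andP[/eqP h1 h1']] /orP[h2|/andP[/eqP h2 h2']].
  - by rewrite (lt_trans h1 h2).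
  - by rewrite h2 h1.
  - by rewrite -h1 h2.
  - by rewrite h2 h1 eqxx (ltn_trans h2' h1') orbT.
by exists j => //; rewrite !inE ltxx ltnn andbF.
Qed.

(** Ranks are injective because ties are broken, so at most [t] coordinates have rank below [t]. *)
Lemma card_heavy (t : nat) :
  (#|[set l : 'I_d | (#|entries_before x l| < t)%N]%SET| <= t)%N.
Proof.
pose rk (l : 'I_d) := #|entries_before x l|.
have rk_inj : injective rk.
  move=> j l e; apply: contraTeq isT => /entries_before_trichotomy /orP[]
    /entries_before_proper; by rewrite -/(rk j) -/(rk l) e ltnn.
case: t => [|t]; first by rewrite (eq_card0 (A := [set _ | _]%SET)) // => l; rewrite inE.
have inj : {in [set l : 'I_d | (rk l < t.+1)%N]%SET &,
    injective (fun l => inord (rk l) : 'I_t.+1)}.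
  move=> j l; rewrite !inE => jt lt' /(congr1 val) /=.
  by rewrite !inordK //; exact: rk_inj.
by rewrite -(card_in_imset inj) -[X in (_ <= X)%N](card_ord t.+1) max_card.
Qed.

Lemma sum_light (t : nat) : (0 < t)%N ->
  \sum_(l | l \notin [set l : 'I_d | (#|entries_before x l| < t)%N]%SET) x 0 l ^+ 2
  = t%:R * (l2norm (tail t x) / Num.sqrt t%:R) ^+ 2.
Proof.
move=> t0; have t0' : t%:R != 0 :> R by rewrite pnatr_eq0 -lt0n.
rewrite expr_div_n [Num.sqrt t%:R ^+ 2]sqr_sqrtr ?ler0n // [RHS]mulrC divfK // /l2norm sqr_sqrtr; last first.
  by apply: sumr_ge0 => l _; exact: sqr_ge0.
rewrite big_mkcond; apply: eq_bigr => l _; rewrite inE mxE.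
by case: (_ < _)%N; rewrite /= ?expr0n.
Qed.

End Heavy.

(* With probability of order [k2] the row sum is at most [max(sigma, a / 2)], and
   then with probability of order [k1] the noise brings it below [a]. *)
Lemma gap_factors (R : realFieldType) (alpha Delta sigma : R) :
  0 <= Delta -> 0 <= sigma -> 0 < alpha <= 1 -> 0 < maxr Delta sigma ->
  let a := alpha * maxr Delta sigma in
  exists k1 k2 : R, [/\ 0 <= k1 <= 1, k1 * sigma <= a, 0 < k2 <= 1,
    k2 * Delta <= maxr sigma (a / 2) & alpha / 2 <= k1 * k2].
Proof.
move=> D0 s0 /andP[al0 al1]; set M := maxr _ _ => M0 a.
have MD : Delta <= M by rewrite le_max lexx.
have Ms : sigma <= M by rewrite le_max lexx orbT.
(* In the first case [k1 * k2] is exactly [alpha], in the second it is [alpha / 2]. *)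
case: (leP a sigma) => as_.
  have s1 : 0 < sigma by apply: lt_le_trans as_; rewrite mulr_gt0.
  exists (a / sigma), (sigma / M); split.
  - have a0 : 0 < a by rewrite mulr_gt0.
    by rewrite ler_pdivrMr // mul1r as_ divr_ge0 // ltW.
  - by rewrite divfK // gt_eqF.
  - by rewrite divr_gt0 //= ler_pdivrMr // mul1r.
  - rewrite le_max mulrAC ler_pdivrMr // ler_wpM2l ?orbT //; exact: ltW.
  - by rewrite mulrA divfK ?gt_eqF // /a mulfK ?gt_eqF //; lra.
exists 1, (alpha / 2); split; rewrite ?ler01 ?lexx ?mul1r ?(ltW as_) //.
- by rewrite divr_gt0 //=; lra.
- rewrite le_max; apply/orP; right; rewrite /a mulrAC ler_pM2r //.
  by rewrite ler_pM2l.
Qed.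

(** * The sketch with independent blocks *)

Section Ideal.
Context (R : realType) (disp : measure_display) (Omega : measurableType disp).
Variable P : probability Omega R.
Variables (w b k r d m : nat) (K : finType).
Variables (X : Omega -> block w) (key : 'I_k -> 'I_b -> Omega -> K).
Variables (sigma : R) (nu : 'I_r -> 'I_(2 ^ m) -> {RV P >-> R}).
Hypothesis rnd : pcs_randomness X key sigma nu.
Variables (p : 'I_w) (q : 'I_m -> 'I_w) (l : 'I_d).
Hypotheses (q_inj : injective q) (qp : forall e, q e != p).
Hypothesis rd : (r * d <= b ^ k)%N.

Local Notation x0 := [tuple of nseq w false].
Local Notation sg := (fun B : block w => tnth B p).

Definition row_blocks (y : seq (block w)) (i : nat) : {ffun 'I_d -> block w} :=
  [ffun rho : 'I_d => nth x0 y (i * d + rho)].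

(** For a fixed block string [y] this is an event of the noise alone. *)
Definition row_event (R0 : nat) (a eps : R) (z : 'I_d -> R)
    (y : seq (block w)) : set Omega :=
  count_event nu R0 (fun i => block_bucket q (row_blocks y i l))
    (fun i => half_line a (eps * sgr R sg (row_blocks y i l))
                (rsum l sg (block_bucket q) z (row_blocks y i))).

Definition flip (B : block w) : block w :=
  [tuple if i == p then ~~ tnth B i else tnth B i | i < w].

(** The positions [i * d + rho] are distinct and below [b ^ k], so they carry independent uniform
    blocks. *)
Lemma avg_row_positions (phi : {ffun 'I_r * 'I_d -> block w} -> R) :
  iavg (b ^ k) (fun y => phi [ffun e : 'I_r * 'I_d => nth x0 y (e.1 * d + e.2)]) = avg phi.
Proof.
have pos (e : 'I_r * 'I_d) : (e.1 * d + e.2 < b ^ k)%N.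
  apply: leq_trans rd; apply: (@leq_trans (e.1.+1 * d)).
    by rewrite mulSn addnC ltn_add2r.
  by rewrite leq_mul2r ltn_ord orbT.
pose iota e := Ordinal (pos e).
have iota_inj : injective iota.
  move=> [i j] [i' j'] /(congr1 val) /= e; have d0 : (0 < d)%N := leq_ltn_trans (leq0n _) (ltn_ord j).
  have ei : i = i' :> nat.
    by have := congr1 (divn^~ d) e; rewrite !divnMDl // !divn_small // !addn0.
  by move: e; rewrite ei => /addnI /val_inj ->; congr pair; exact: val_inj.
rewrite iavg_ffun -(avg_marginal phi (iota := iota)) //; last first.
  by rewrite card_tuple card_bool expn_gt0.
apply: eq_avg => f; congr phi; apply/ffunP => e; rewrite !ffunE.
have h : (e.1 * d + e.2 < #|'I_(b ^ k)|)%N by rewrite card_ord pos.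
rewrite (_ : (e.1 * d + e.2)%N = enum_rank (iota e)); last by rewrite enum_rank_ord.
by rewrite nth_codom ?enum_rankK // ; exact: ltn_ord.
Qed.

Lemma row_event_count R0 a eps z y : eps = 1 \/ eps = -1 ->
  exists j A, (forall i, measurable (A i)) /\
    row_event R0 a eps z y = count_event nu R0 j A.
Proof.
move=> e1; eexists; eexists; split; last reflexivity.
move=> i; apply: measurable_half_line.
have := sgr_pm R sg (row_blocks y i l).
by case: e1 => -> [] ->; rewrite ?mul1r ?mulN1r ?opprK; [left|right|right|left].
Qed.

Variables (h : nat) (heavy : {set 'I_d}) (z : 'I_d -> R) (Delta : R).
Hypotheses (mh : (2 ^ m = h.*2)%N) (few : (#|heavy| <= 2 ^ m)%N).
Hypothesis light : \sum_(rho | rho \notin heavy) z rho ^+ 2 <= (2 ^ m)%:R * Delta ^+ 2.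

Lemma row_event_ideal (R0 : nat) (alpha eps : R) :
  eps = 1 \/ eps = -1 -> 0 <= Delta -> 0 <= sigma -> 0 < alpha <= 1 ->
  0 < maxr Delta sigma -> (r <= R0.*2)%N ->
  iavg (b ^ k) (fun y =>
    fine (P (row_event R0 (alpha * maxr Delta sigma) eps z y))) <=
  expR (- (2 * (spread R / 192) ^+ 2 * alpha ^+ 2 * r%:R)).
Proof.
move=> e1 D0 s0 al M0 rR; have /andP[al0 al1] := al.
have [k1 [k2 [k101 k1s k201 k2D k12]]] := gap_factors D0 s0 al M0.
set a := alpha * _ in k1s k2D *; have a0 : 0 < a by rewrite mulr_gt0.
have [Q QE] := gaussian_law_probability sigma.
pose pr := row_prob l sg (block_bucket q) z Q a eps.
have B0 : (0 < #|block w|)%N by rewrite card_tuple card_bool expn_gt0.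
have sp0 := spread_gt0 R; have sp1 := spread_le1 R.
have /andP[k10 k11] := k101; have /andP[k20 k21] := k201.
(* Half of [spread * k1] times [k2 / 48], with [k1 * k2 >= alpha / 2]. *)
pose delta := spread R * alpha / 192.
have T2 : #|'I_(2 ^ m)| = h.*2 by rewrite card_ord.
have fewT : (#|heavy| <= #|'I_(2 ^ m)|)%N by rewrite card_ord.
have lightT : \sum_(rho | rho \notin heavy) z rho ^+ 2 <=
    #|'I_(2 ^ m)|%:R * Delta ^+ 2 by rewrite card_ord.
have sm := rsum_small l (block_bucket_sign_uniform q_inj qp) B0 T2 fewT lightT
  (u := maxr sigma (a / 2)) (kappa := k2) D0 _ k201 k2D.
have avgpr : avg pr <= 1 / 2 - delta.
  have flK : involutive flip.
    move=> B; apply: eq_from_tnth => i; rewrite !tnth_mktuple.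
    by case: eqP => // _; rewrite negbK.
  have flg B : block_bucket q (flip B) = block_bucket q B.
    apply: val_inj; apply: eq_bigr => e _ /=.
    by rewrite tnth_mktuple (negPf (qp e)).
  have fls B : tnth (flip B) p = ~~ tnth B p by rewrite tnth_mktuple eqxx.
  have u0 : 0 < maxr sigma (a / 2) by rewrite lt_max divr_gt0 ?orbT.
  apply: le_trans (avg_row_prob (x := z) (Q := Q) flK flg fls e1 a0 B0
    (beta := spread R * k1) (u := maxr sigma (a / 2)) (kappa := k2 / 48) _ _ _) _.
  - by rewrite mulr_ge0 // ltW.
  - move=> S Su; rewrite -lee_fin fineK; last first.
      rewrite fin_num_measure //.
      rewrite (_ : [set v : R | _] = `]- a - S, a - S[%classic).
        exact: measurable_itv.
      apply/seteqP; split => v /=; rewrite in_itv /= ltr_norml => /andP[? ?];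
      by apply/andP; split; lra.
    by rewrite -QE; exact: gaussian_law_ball_ge.
  - exact: sm.
  - have : spread R * (alpha / 2) <= spread R * (k1 * k2) by rewrite ler_wpM2l // ltW.
    by rewrite /delta; lra.
have d01 : 0 <= delta < 1 / 2.
  rewrite /delta; apply/andP; split.
    by apply: divr_ge0 => //; apply: mulr_ge0; exact: ltW.
  have : spread R * alpha <= 1 by apply: mulr_ile1 => //; exact: ltW.
  lra.
have pr01 y : 0 <= pr y <= 1.
  exact: row_prob01.
have -> : iavg (b ^ k) (fun y => fine (P (row_event R0 a eps z y))) =
    avg (fun y : {ffun 'I_r * 'I_d -> block w} =>
      binomial_tail R0 (fun i => pr [ffun rho => y (i, rho)])).
  rewrite -avg_row_positions; apply: eq_iavg => y _.
  rewrite (prob_count_event rnd); last first.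
    move=> i; apply: measurable_half_line.
    have := sgr_pm R sg (row_blocks y i l).
    by case: e1 => -> [] ->; rewrite ?mul1r ?mulN1r ?opprK; [left|right|right|left].
  congr (binomial_tail _ _); apply/funext => i; rewrite /law QE /pr /row_prob.
  have -> : [ffun rho => [ffun e : 'I_r * 'I_d => nth x0 y (e.1 * d + e.2)] (i, rho)] = row_blocks y i.
    by apply/ffunP => rho; rewrite !ffunE.
  by [].
apply: le_trans (chernoff B0 rR pr01 d01 avgpr) _.
rewrite ler_expR lerN2 /delta le_eqVlt; apply/orP; left; apply/eqP; ring.
Qed.

End Ideal.

(** Blocks at distinct positions are independent, and the squares of the [2 ^ m] equal bucket masses
    add up to [(2 ^ m)^-1]. *)
Lemma pair_collision (R : realType) (w m n n1 n2 : nat) (p : 'I_w)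
    (q : 'I_m -> 'I_w) (x0 : block w) :
  injective q -> (forall e, q e != p) -> (n1 < n)%N -> (n2 < n)%N -> n1 != n2 ->
  iavg n (fun y => (block_bucket q (nth x0 y n1) == block_bucket q (nth x0 y n2))%:R)
    = (2 ^ m)%:R^-1 :> R.
Proof.
move=> q_inj qp n1n n2n n12.
pose iota (c : bool) : 'I_n := if c then Ordinal n1n else Ordinal n2n.
have iota_inj : injective iota.
  by move=> [] [] // /(congr1 val) /= e; move: n12; rewrite e eqxx.
have B0 : (0 < #|block w|)%N by rewrite card_tuple card_bool expn_gt0.
pose phi (z : {ffun bool -> block w}) : R :=
  (block_bucket q (z true) == block_bucket q (z false))%:R.
transitivity (avg phi).
  rewrite iavg_ffun -(avg_marginal phi B0 iota_inj); apply: eq_avg => f.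
  have nthE (o : 'I_n) : nth x0 (codom f) o = f o.
    rewrite (_ : nat_of_ord o = enum_rank o); last by rewrite enum_rank_ord.
    by rewrite nth_codom ?enum_rankK //; exact: ltn_ord.
  by rewrite /phi !ffunE -(nthE (Ordinal n1n)) -(nthE (Ordinal n2n)).
have nB : #|block w|%:R != 0 :> R by rewrite pnatr_eq0 -lt0n.
have n2m : (2 ^ m)%:R != 0 :> R by rewrite pnatr_eq0 -lt0n expn_gt0.
have cnt (j : 'I_(2 ^ m)) : \sum_(B : block w) (block_bucket q B == j)%:R =
    #|block w|%:R / (2 ^ m)%:R :> R.
  have U s := block_bucket_sign_uniform q_inj qp j s.
  apply: (mulIf n2m); rewrite divfK //.
  have -> : \sum_(B : block w) (block_bucket q B == j)%:R =
      \sum_(s : bool) #|[pred B : block w | (block_bucket q B == j) && (tnth B p == s)]|%:R :> R.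
    under [RHS]eq_bigr => s _ do rewrite -sum1_card natr_sum big_mkcond.
    rewrite exchange_big; apply: eq_bigr => B _; rewrite big_bool /= !inE.
    by case: (_ == j); case: (tnth B p); rewrite /= ?addr0 ?add0r.
  rewrite big_bool /=; have := U true; have := U false; rewrite card_ord => u1 u2.
  apply: (@mulIf R 2); first by rewrite pnatr_eq0.
  rewrite -!natrD -!natrM; congr _%:R.
  by rewrite !mulnDl -!mulnA [(2 ^ m * 2)%N]mulnC u1 u2 addnn muln2.
rewrite /avg.
have -> : \sum_z phi z = \sum_(j : 'I_(2 ^ m)) \sum_(z : {ffun bool -> block w})
    \prod_(c : bool) (block_bucket q (z c) == j)%:R.
  rewrite exchange_big; apply: eq_bigr => z _ /=.
  rewrite (bigD1 (block_bucket q (z false))) //= [X in _ + X]big1 ?addr0.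
    by rewrite big_bool /= eqxx mulr1.
  by move=> j jz; rewrite big_bool /= [_ (z false) == _]eq_sym (negPf jz) mulr0.
under eq_bigr => j _.
  rewrite -(bigA_distr_bigA (fun (c : bool) (B : block w) => (block_bucket q B == j)%:R)).
  rewrite big_bool /= cnt; over.
rewrite sumr_const card_ord card_ffun card_bool [(#|_| ^ _)%:R]natrX -[_ *+ _]mulr_natl.
move: nB n2m; move: (#|block w|%:R) ((2 ^ m)%:R) => N M nN nM.
by field; rewrite nN nM.
Qed.

(** * The sketch *)

Section Median.
Variables (R : realType) (r : nat) (f : 'I_r -> R).
Hypothesis odd_r : odd r.

Local Notation srt := (sort <=%R [seq f i | i <- enum 'I_r]).

Let size_srt : size srt = r.
Proof. by rewrite size_sort size_map size_enum_ord. Qed.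

Let rE : r = (r./2.*2).+1.
Proof. by rewrite -[in LHS](odd_double_half r) odd_r. Qed.

Let hr : (r./2 < r)%N.
Proof. by rewrite [X in (_ < X)%N]rE ltnS -addnn leq_addr. Qed.

Let nth_srt i j : (i <= j < r)%N -> nth 0 srt i <= nth 0 srt j.
Proof.
move=> /andP[ij jr].
have := sorted_leq_nth le_trans lexx 0 (sort_sorted (@le_total _ R) [seq f i | i <- enum 'I_r]).
by apply; rewrite ?inE ?size_srt // (leq_ltn_trans ij).
Qed.

Let count_srt (a : pred R) : (\sum_(i < r) a (f i))%N = count a srt.
Proof.
rewrite count_sort count_map -sum1_count [RHS]big_mkcond big_enum /=.
by apply: eq_bigr => i _; case: (a (f i)).
Qed.

(** The first [r./2 + 1] sorted entries are at most the median. *)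
Let all_lower (a : pred R) : {homo a : u v / v <= u >-> u -> v} ->
  a (median f) -> ((r./2).+1 <= count a srt)%N.
Proof.
move=> ha am; rewrite -(cat_take_drop (r./2).+1 srt) count_cat.
apply: (leq_trans _ (leq_addr _ _)).
have /eqP -> : count a (take (r./2).+1 srt) == size (take (r./2).+1 srt).
  rewrite -all_count; apply/(all_nthP 0) => i.
  rewrite size_take_min size_srt leq_min => /andP[ir _].
  by rewrite nth_take //; apply: ha am; apply: nth_srt; rewrite -ltnS ir.
by rewrite size_take_min size_srt leq_min leqnn.
Qed.

Let all_upper (a : pred R) : {homo a : u v / u <= v >-> u -> v} ->
  a (median f) -> ((r./2).+1 <= count a srt)%N.
Proof.
move=> ha am; rewrite -(cat_take_drop r./2 srt) count_cat.
apply: (leq_trans _ (leq_addl _ _)).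
have /eqP -> : count a (drop r./2 srt) == size (drop r./2 srt).
  rewrite -all_count; apply/(all_nthP 0) => i; rewrite size_drop size_srt => ir.
  rewrite nth_drop; apply: ha am; apply: nth_srt.
  by rewrite leq_addr -ltn_subRL.
by rewrite size_drop size_srt; move: rE; lia.
Qed.

Let count_compl (a : pred R) :
  ((r./2).+1 <= count (predC a) srt)%N -> (count a srt < (r./2).+1)%N.
Proof. by have := count_predC a srt; rewrite size_srt; move: rE; lia. Qed.

(** For odd [r], a predicate and its complement cannot both hold for [r./2 + 1] entries, which gives
    the converse direction. *)
Lemma median_ge (a : R) :
  (a <= median f) = ((r./2).+1 <= \sum_(i < r) (a <= f i)%R)%N.
Proof.
rewrite (count_srt (fun v => a <= v)); apply/idP/idP => [|h].
  by apply: (all_upper (a := fun v => a <= v)) => u v uv /le_trans; apply.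
rewrite leNgt; apply: contraTN h => ma; rewrite -ltnNge; apply: count_compl.
apply: all_lower => [u v vu /=|/=]; rewrite -?ltNge // => /le_lt_trans.
by apply.
Qed.

Lemma median_le (a : R) :
  (median f <= a) = ((r./2).+1 <= \sum_(i < r) (f i <= a)%R)%N.
Proof.
rewrite (count_srt (fun v => v <= a)); apply/idP/idP => [|h].
  by apply: (all_lower (a := fun v => v <= a)) => u v vu; apply: le_trans.
rewrite leNgt; apply: contraTN h => ma; rewrite -ltnNge; apply: count_compl.
apply: all_upper => [u v uv /=|/=]; rewrite -?ltNge // => /lt_le_trans.
by apply.
Qed.

End Median.

Section Tests.
Context (R : realType) (disp : measure_display) (Omega : measurableType disp).
Variable P : probability Omega R.
Variables (w r d m : nat) (nu : 'I_r -> 'I_(2 ^ m) -> {RV P >-> R}).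
Variables (p : 'I_w) (q : 'I_m -> 'I_w) (l : 'I_d).
Variables (R0 : nat) (a eps : R).

Local Notation x0 := [tuple of nseq w false].
Local Notation sg := (fun B : block w => tnth B p).

Let noise (om : Omega) (i : nat) (j : 'I_(2 ^ m)) : R :=
  if insub i is Some i' then nu i' j om else 0.

Let row_event_hits (J : finType) (label : block w -> J)
    (F : J -> 'I_d -> block w -> R) z om :
  (forall y (i : 'I_r), eps * sgr R sg (row_blocks d y i l) *
      rsum l sg (block_bucket q) z (row_blocks d y i) =
    \sum_(rho | rho != l) F (label (row_blocks d y i l)) rho (row_blocks d y i rho)) ->
  (fun y => \1_(row_event nu p q l R0 a eps z y) om : R) =
  (fun y => (R0 <= \sum_(i < r) labelled_hit x0 l label (fun i blk =>
    (eps * sgr R sg blk * noise om i (block_bucket q blk) - a)%R) F y i)%N%:R).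
Proof.
move=> FE; apply/funext => y; rewrite indicE; congr (nat_of_bool _)%:R.
rewrite /row_event /count_event mem_setE; congr (_ <= _)%N.
apply: eq_bigr => i _; congr nat_of_bool; apply/asboolP/idP.
  rewrite /half_line /= /labelled_hit mulrDr FE => h.
  rewrite /noise valK -subr_ge0 in h *; move: h; rewrite !ffunE.
  under eq_bigr => rho _ do rewrite ffunE.
  move: (\sum_(rho | _) _) => S; lra.
rewrite /half_line /= /labelled_hit mulrDr FE /noise valK !ffunE.
under [X in _ -> _ <= X + _]eq_bigr => rho _ do rewrite ffunE.
move: (\sum_(rho | _) _) => S; lra.
Qed.

(** The label is the bucket and the sign of the queried block: the first selects the colliding
    terms, the second multiplies them. *)
Lemma tame_row_event (z : 'I_d -> R) om :
  tame ('I_r.+1 * option ('I_(2 ^ m) * bool) * option ('I_(2 ^ m) * bool))%type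
    (fun y => \1_(row_event nu p q l R0 a eps z y) om : R).
Proof.
rewrite (row_event_hits (label := fun B => (block_bucket q B, sg B))
  (F := fun je rho blk => eps * (if je.2 then 1 else -1) *
    (sgr R sg blk * z rho * (block_bucket q blk == je.1)%:R))).
  exact: tame_labelled_hits.
by move=> y i; rewrite /rsum mulr_sumr.
Qed.

(** For the zero vector the other blocks contribute nothing, and one label suffices whatever the
    number of buckets. *)
Lemma tame_row_event0 om :
  tame ('I_r.+1 * option unit * option unit)%type
    (fun y => \1_(row_event nu p q l R0 a eps (fun=> 0) y) om : R).
Proof.
rewrite (row_event_hits (label := fun B => tt) (F := fun _ _ _ => 0)).
  exact: tame_labelled_hits.
move=> y i; rewrite big1_eq /rsum big1 ?mulr0 // => rho _.
by rewrite mulr0 mul0r.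
Qed.

End Tests.

Section Collisions.
Variables (R : realType) (w r d m : nat) (p : 'I_w) (q : 'I_m -> 'I_w) (l : 'I_d).

Local Notation x0 := [tuple of nseq w false].

(** The score is the number of colliding coordinates minus 1, a form to which [tame_labelled_hits]
    applies. *)
Definition collision_hit (y : seq (block w)) (i : nat) : bool :=
  labelled_hit x0 l (block_bucket q) (fun _ _ => -1 : R)
    (fun j _ blk => (block_bucket q blk == j)%:R) y i.

Lemma collision_hitP y i : reflect
  (exists2 rho, rho != l & block_bucket q (nth x0 y (i * d + rho)) =
                           block_bucket q (nth x0 y (i * d + l)))
  (collision_hit y i).
Proof.
apply: (iffP idP) => [h|[rho rl e]].
  case: (pickP (fun rho : 'I_d => (rho != l) &&
    (block_bucket q (nth x0 y (i * d + rho)) ==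
     block_bucket q (nth x0 y (i * d + l))))) => [rho /andP[rl /eqP e]|no].
    by exists rho.
  move: h; rewrite /collision_hit /labelled_hit big1 ?addr0 ?lerN10 ?oppr_ge0 ?ler10 //.
  by move=> rho rl; have := no rho; rewrite rl /= => ->.
rewrite /collision_hit /labelled_hit (bigD1 rho) //= e eqxx addrA addNr add0r.
by apply: sumr_ge0.
Qed.

(** Union bound over the pairs formed in each row by the queried coordinate and another one. *)
Lemma avg_collision_le (n : nat) : injective q -> (forall e, q e != p) ->
  (r * d <= n)%N ->
  iavg n (fun y => (1 <= \sum_(i < r) collision_hit y i)%N%:R) <=
    (r * d)%:R / (2 ^ m)%:R :> R.
Proof.
move=> q_inj qp rd; have pos (i : 'I_r) (rho : 'I_d) : (i * d + rho < n)%N.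
  apply: leq_trans rd; apply: (@leq_trans (i.+1 * d)).
    by rewrite mulSn addnC ltn_add2r.
  by rewrite leq_mul2r ltn_ord orbT.
apply: (@le_trans _ _ (iavg n (fun y => \sum_(i < r) \sum_(rho < d)
    (if rho != l then (block_bucket q (nth x0 y (i * d + rho)) ==
     block_bucket q (nth x0 y (i * d + l)))%:R else 0)))).
  apply: ler_iavg => y _; case: posnP => [_|]; first by apply: sumr_ge0 => i _;
    apply: sumr_ge0 => rho _; case: ifP.
  move=> h; have [i hi] : exists i : 'I_r, collision_hit y i.
    apply/existsP; apply: contraTT h; rewrite negb_exists => /forallP h.
    by rewrite big1 // => i _; rewrite (negPf (h i)).
  have [rho rl e] := collision_hitP _ _ hi.
  rewrite (bigD1 i) //= (bigD1 rho) //= rl e eqxx -addrA lerDl addr_ge0 //.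
    by apply: sumr_ge0 => rho' _; case: ifP.
  by apply: sumr_ge0 => i' _; apply: sumr_ge0 => rho' _; case: ifP.
rewrite iavg_sum; apply: (@le_trans _ _ (\sum_(i < r) \sum_(rho < d) (2 ^ m)%:R^-1)).
  apply: ler_sum => i _; rewrite iavg_sum; apply: ler_sum => rho _.
  case: eqVneq => /= [_|rl].
    by rewrite iavg_cst ?card_tuple ?card_bool ?expn_gt0 // invr_ge0.
  rewrite (pair_collision R _ q_inj qp) // eqn_add2l.
  by apply: contra_neq rl; exact: val_inj.
by rewrite !sumr_const !card_ord -mulrnA -[leLHS]mulr_natl mulnC.
Qed.

End Collisions.

Section Numerics.
Variables (R : realType) (w : nat).

(** This is [2 ^ (c * w)] for [c = 1 / 64]. The square root of the number of block values is
    [scale ^ 32]; up to a factor 2, the number of quantiles is [scale ^ 8] and that of truncated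
    buckets [scale ^ 2]. *)
Definition scale : R := 2 `^ (w%:R / 64).

Lemma scale_ge1 : 1 <= scale.
Proof.
rewrite -[leLHS](powRr0 2); apply: ler_powR; first by rewrite ler1n.
by rewrite divr_ge0.
Qed.

Lemma scaleX (n : nat) : scale ^+ n = 2 `^ (w%:R / 64 * n%:R).
Proof. by rewrite powRrM powR_mulrn // powR_ge0. Qed.

Lemma exp_half_scale : (scale ^+ 32) ^+ 2 = (2 ^ w)%:R.
Proof.
rewrite -exprM scaleX natrX -powR_mulrn //; congr powR.
by rewrite -[(32 * 2)%N]/64%N; field.
Qed.

Lemma exp_floor_scale (e : nat) : (0 < e)%N -> (e %| 64)%N ->
  let n := (2 ^ (w %/ (64 %/ e)))%N in
  n%:R <= scale ^+ e /\ scale ^+ e <= 2 * n%:R.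
Proof.
move=> e0 e64 n; set f := (64 %/ e)%N; have fe : (f * e = 64)%N by rewrite divnK.
have f0 : (0 < f)%N by rewrite divn_gt0 // dvdn_leq.
have E : w%:R / 64 * e%:R = w%:R / f%:R :> R.
  have -> : 64 = f%:R * e%:R :> R by rewrite -natrM fe.
  by field; rewrite !pnatr_eq0 -!lt0n e0 f0.
have two (j : nat) : (2 ^ j)%:R = 2 `^ j%:R :> R by rewrite natrX powR_mulrn.
have l1 : ((w %/ f)%N%:R <= w%:R / f%:R :> R).
  by rewrite ler_pdivlMr ?ltr0n // -natrM ler_nat leq_divM.
have l2 : (w%:R / f%:R <= (w %/ f).+1%:R :> R).
  by rewrite ler_pdivrMr ?ltr0n // -natrM ler_nat ltnW // ltn_ceil.
rewrite scaleX E /n -[2 * _]natrM -expnS !two.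
by split; apply: ler_powR; rewrite ?ler1n.
Qed.

(** There are at most [18 * scale ^ 5] cells, each costing at most [24 / scale ^ 8]; the factor
    [scale] in front stands for the number of output blocks. *)
Lemma fooling_error_le (r : nat) (J : finType) : (0 < r)%N -> r%:R <= scale ->
  #|J|%:R <= 2 * scale ^+ 2 ->
  scale * fooling_error (2 ^ (w %/ 8)) (scale ^+ 32)
    ('I_r.+1 * option J * option J)%type <= 432 / scale.
Proof.
move=> r0 rs Js; have s1 := scale_ge1.
have [n1 n2] := @exp_floor_scale 8 isT isT.
move: n1 n2; rewrite -[(64 %/ 8)%N]/8%N; set n := (2 ^ _)%N => n1 n2.
have n0 : 1 <= n%:R :> R by rewrite ler1n expn_gt0.
have s0 : 0 < scale by apply: lt_le_trans s1.
rewrite /fooling_error !card_prod card_ord card_option.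
move: (scale) rs Js s1 n1 n2 s0 => s rs Js s1 n1 n2 s0.
have s2 : 1 <= s ^+ 2 by rewrite exprn_ege1.
have h1 : (r.+1)%:R <= 2 * s by rewrite -natr1; lra.
have h2 : (#|J|.+1)%:R <= 3 * s ^+ 2 by rewrite -natr1; lra.
have h3 : (r.+1 * #|J|.+1 * #|J|.+1)%:R <= 18 * s ^+ 5.
  rewrite !natrM (_ : 18 * s ^+ 5 = 2 * s * (3 * s ^+ 2) * (3 * s ^+ 2)); last by ring.
  by apply: ler_pM => //; rewrite ?mulr_ge0 //; apply: ler_pM.
have h4 : (n.+1)%:R <= 2 * s ^+ 8 by rewrite -natr1; lra.
have h5 : n.+1%:R ^+ 2 / s ^+ 32 <= 4 / s ^+ 8.
  rewrite ler_pdivrMr ?exprn_gt0 //.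
  apply: (@le_trans _ _ ((2 * s ^+ 8) ^+ 2)).
    by rewrite ler_sqr ?nnegrE // mulr_ge0 // exprn_ge0 // ltW.
  have -> : 4 / s ^+ 8 * s ^+ 32 = 4 * s ^+ 24 by field; rewrite gt_eqF.
  have -> : (2 * s ^+ 8) ^+ 2 = 4 * s ^+ 16 by ring.
  by rewrite ler_pM2l // ler_weXn2l.
have h6 : 2 / n%:R <= 4 / s ^+ 8.
  rewrite ler_pdivrMr ?(lt_le_trans _ n0) // mulrAC ler_pdivlMr ?exprn_gt0 //.
  by move: n2; lra.
have h7 : 2 * (2 * n.+1%:R ^+ 2 / s ^+ 32 + 2 / n%:R) <= 24 / s ^+ 8.
  by rewrite -[2 * _ / _]mulrA; move: h5 h6; rewrite ![_ / s ^+ 8]mulrC; lra.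
apply: (@le_trans _ _ (s * (18 * s ^+ 5 * (24 / s ^+ 8)))).
  rewrite ler_pM2l //; apply: ler_pM => //.
  by rewrite !(mulr_ge0, addr_ge0, invr_ge0) ?exprn_ge0 // ltW.
have -> : s * (18 * s ^+ 5 * (24 / s ^+ 8)) = 432 / s ^+ 2 by field; rewrite gt_eqF.
by rewrite ler_pM2l // lef_pV2 ?posrE ?exprn_gt0 // expr2 ler_peMl // ltW.
Qed.

End Numerics.

Section FineProbability.
Context (R : realType) (disp : measure_display) (Omega : measurableType disp).
Variable P : probability Omega R.

Lemma fine_prob_le (A B : set Omega) : measurable A -> measurable B ->
  A `<=` B -> fine (P A) <= fine (P B).
Proof.
move=> mA mB AB; apply: fine_le; rewrite ?fin_num_measure //.
by apply: le_measure; rewrite ?inE.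
Qed.

Lemma fine_probU_le (A B : set Omega) : measurable A -> measurable B ->
  fine (P (A `|` B)) <= fine (P A) + fine (P B).
Proof.
move=> mA mB; rewrite -lee_fin EFinD !fineK ?fin_num_measure //.
  exact: measureU2.
exact: measurableU.
Qed.

End FineProbability.

(** * The sketch with the blocks of the generator *)

Section Sketch.
Context (R : realType) (disp : measure_display) (Omega : measurableType disp).
Variable P : probability Omega R.
Variables (w b k r d m : nat) (hb : (2 <= b)%N) (K : finType).
Variables (H : K -> block w -> block w).
Variables (X : Omega -> block w) (key : 'I_k -> 'I_b -> Omega -> K).
Variables (sigma : R) (nu : 'I_r -> 'I_(2 ^ m) -> {RV P >-> R}).
Hypotheses (rnd : pcs_randomness X key sigma nu) (H2 : two_wise_independent H).
Variables (p : 'I_w) (q : 'I_m -> 'I_w) (l : 'I_d).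
Hypotheses (q_inj : injective q) (qp : forall e, q e != p).
Hypotheses (rd : (r * d <= b ^ k)%N) (odd_r : odd r).
Hypothesis bk : (b ^ k)%:R <= scale R w.

Local Notation x0 := [tuple of nseq w false].
Local Notation sg := (fun B : block w => tnth B p).
Local Notation out := (output X key H).
Local Notation R0 := (r./2).+1.

Lemma hash_output om (i : 'I_r) (rho : 'I_d) :
  hash_block (fastprg_block (ltnW hb) (fun i j => H (key i j om)) (X om)) i rho =
  row_blocks d (out om) i rho.
Proof.
have pos : (i * d + rho < b ^ k)%N.
  apply: leq_trans rd; apply: (@leq_trans (i.+1 * d)).
    by rewrite mulSn addnC ltn_add2r.
  by rewrite leq_mul2r ltn_ord orbT.
rewrite ffunE /hash_block -(fastprg_block_gen (ltnW hb) H _ _ _ pos) /seed /=.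
congr (fastprg_block _ _ _ _); apply/funext => i'; apply/funext => j.
by rewrite !ffunE.
Qed.

(** Multiplied by its own sign, row [i] reads [x 0 l] plus its error [v i], so an error of the
    median is a majority of row errors in one direction. *)
Lemma estimate_error om (x : 'rV[R]_d) (a : R) :
  let gamma := fastprg_block (ltnW hb) (fun i j => H (key i j om)) (X om) in
  let s i rho : R := block_sign R p (hash_block gamma i rho) in
  let g i rho := block_bucket q (hash_block gamma i rho) in
  let Y := CS g s x + \matrix_(i, j) nu i j om in
  (a <= `|estimate g s Y l - x 0 l|) <->
  row_event nu p q l R0 a 1 (x 0) (out om) om \/
  row_event nu p q l R0 a (-1) (x 0) (out om) om.
Proof.
move=> gamma s g Y.
pose f (i : 'I_r) : R := s i l * Y i (g i l).
have sE i rho : s i rho = sgr R sg (row_blocks d (out om) i rho).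
  rewrite /s /block_sign hash_output /sgr.
  by case: (tnth _ p); rewrite /= ?mulr2n ?mulr0n; ring.
have gE i rho : g i rho = block_bucket q (row_blocks d (out om) i rho).
  by rewrite /g hash_output.
pose v (i : 'I_r) : R := sgr R sg (row_blocks d (out om) i l) *
  (rsum l sg (block_bucket q) (x 0) (row_blocks d (out om) i) +
   nu i (block_bucket q (row_blocks d (out om) i l)) om).
have fE i : f i = x 0 l + v i.
  rewrite /f /Y !mxE (bigD1 l) //= eqxx mulr1 /v !sE gE.
  have ss : sgr R sg (row_blocks d (out om) i l) * sgr R sg (row_blocks d (out om) i l) = 1.
    by rewrite /sgr; case: (tnth _ p); rewrite ?mulr1 // mulrNN mulr1.
  rewrite -addrA mulrDr mulrA ss mul1r; congr (_ + (_ * (_ + _))).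
  by apply: eq_bigr => rho _; rewrite sE !gE.
have -> : (a <= `|estimate g s Y l - x 0 l|) =
    (a + x 0 l <= estimate g s Y l) || (estimate g s Y l <= x 0 l - a).
  by rewrite ler_normr opprB lerBrDr lerBrDl lerBrDr.
rewrite /estimate (median_ge _ odd_r) (median_le _ odd_r).
have e1 : (\sum_(i < r) (a + x 0 l <= f i)%R)%N = (\sum_(i < r) `[<
    half_line a (1 * sgr R sg (row_blocks d (out om) i l))%R
      (rsum l sg (block_bucket q) (x 0%R) (row_blocks d (out om) i))
      (nu i (block_bucket q (row_blocks d (out om) i l)) om)>])%N.
  apply: eq_bigr => i _; congr nat_of_bool; rewrite fE.
  by apply/idP/asboolP; rewrite /half_line /= mul1r -/(v i); lra.
have e2 : (\sum_(i < r) (f i <= x 0 l - a)%R)%N = (\sum_(i < r) `[<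
    half_line a (-1 * sgr R sg (row_blocks d (out om) i l))%R
      (rsum l sg (block_bucket q) (x 0%R) (row_blocks d (out om) i))
      (nu i (block_bucket q (row_blocks d (out om) i l)) om)>])%N.
  apply: eq_bigr => i _; congr nat_of_bool; rewrite fE.
  by apply/idP/asboolP; rewrite /half_line /= mulN1r mulNr -/(v i); lra.
rewrite /row_event /count_event /= -e1 -e2; split=> [/orP|/orP]; exact.
Qed.

Lemma measurable_row_event_output a eps z : eps = 1 \/ eps = -1 ->
  measurable [set om | row_event nu p q l R0 a eps z (out om) om].
Proof.
move=> e1; have [] := seed_partition rnd
  (G := fun v => row_event nu p q l R0 a eps z (gen H (codom v.2) v.1)) => // v.
have [j [A [mA ->]]] := row_event_count nu p q l R0 a z (gen H (codom v.2) v.1) e1.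
exact: measurable_count_event.
Qed.

Let d0 : (0 < d)%N. Proof. exact: leq_ltn_trans (ltn_ord l). Qed.
Let r0 : (0 < r)%N. Proof. by move: odd_r; case: r. Qed.

Let r_scale : r%:R <= scale R w.
Proof.
apply: le_trans bk; rewrite ler_nat; apply: leq_trans rd.
by rewrite -[leqLHS]muln1 leq_mul2l d0 orbT.
Qed.

Let s1 : 1 <= scale R w. Proof. exact: scale_ge1. Qed.

Let output_error (J : finType) : #|J|%:R <= 2 * scale R w ^+ 2 ->
  (b ^ k)%:R * fooling_error (2 ^ (w %/ 8)) (scale R w ^+ 32)
    ('I_r.+1 * option J * option J)%type <= 432 / scale R w.
Proof.
move=> Js; apply: le_trans (fooling_error_le r0 r_scale Js).
rewrite ler_wpM2r //; have sp : 0 <= scale R w by apply: le_trans s1.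
by rewrite !(mulr_ge0, addr_ge0, invr_ge0) ?exprn_ge0.
Qed.

Let prob_output_scale (J : finType) (G : seq (block w) -> set Omega) N :
  #|J|%:R <= 2 * scale R w ^+ 2 ->
  (forall y, exists j A, (forall i, measurable (A i)) /\ G y = count_event nu N j A) ->
  (forall om, tame ('I_r.+1 * option J * option J)%type (fun y => \1_(G y) om : R)) ->
  fine (P [set om | G (out om) om]) <=
    iavg (b ^ k) (fun y => fine (P (G y))) + 432 / scale R w.
Proof.
move=> Js hG tG; have s32 : 0 < scale R w ^+ 32.
  by rewrite exprn_gt0 // (lt_le_trans ltr01).
have n0 : (0 < 2 ^ (w %/ 8))%N by rewrite expn_gt0.
apply: le_trans (prob_output_le rnd H2 hb n0 s32 (exp_half_scale R w) hG tG) _.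
by rewrite lerD2l output_error.
Qed.

Hypothesis m0 : (0 < m)%N.

Let mh : (2 ^ m = (2 ^ m.-1).*2)%N.
Proof. by rewrite -muln2 -expnSr prednK. Qed.

Lemma row_event_prob_le (J : finType) (z : 'I_d -> R) (heavy : {set 'I_d})
    (Delta alpha eps : R) :
  #|J|%:R <= 2 * scale R w ^+ 2 ->
  (forall om, tame ('I_r.+1 * option J * option J)%type
    (fun y => \1_(row_event nu p q l R0 (alpha * maxr Delta sigma) eps z y) om : R)) ->
  (#|heavy| <= 2 ^ m)%N ->
  \sum_(rho | rho \notin heavy) z rho ^+ 2 <= (2 ^ m)%:R * Delta ^+ 2 ->
  eps = 1 \/ eps = -1 -> 0 <= Delta -> 0 <= sigma -> 0 < alpha <= 1 ->
  0 < maxr Delta sigma ->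
  fine (P [set om | row_event nu p q l R0 (alpha * maxr Delta sigma) eps z (out om) om])
    <= expR (- (2 * (spread R / 192) ^+ 2 * alpha ^+ 2 * r%:R)) + 432 / scale R w.
Proof.
move=> Js tG few light e1 D0 s0 al M0.
apply: le_trans (prob_output_scale Js (N := R0) _ tG) _.
  by move=> y; exact: row_event_count.
rewrite lerD2r; apply: (row_event_ideal rnd l q_inj qp rd mh few light e1 D0 s0 al M0).
by rewrite -[leqLHS](odd_double_half r) odd_r doubleS; lia.
Qed.

(** With at least [scale ^ 2 / 2] buckets, the union bound over at most [scale] pairs gives
    [2 / scale]; passing to the generator adds [432 / scale]. *)
Lemma collision_prob_le (m' : nat) (q' : 'I_m' -> 'I_w) :
  injective q' -> (forall e, q' e != p) -> (2 ^ m')%:R <= 2 * scale R w ^+ 2 ->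
  scale R w ^+ 2 <= 2 * (2 ^ m')%:R ->
  let C := [set om : Omega | (1 <= \sum_(i < r) collision_hit R q' l (out om) i)%N] in
  measurable C /\ fine (P C) <= 434 / scale R w.
Proof.
move=> q'_inj q'p m'1 m'2 C.
have sp : 0 < scale R w by apply: lt_le_trans s1.
pose G y := [set om : Omega | (1 <= \sum_(i < r) collision_hit R q' l y i)%N].
have GE y : exists j A, (forall i, measurable (A i)) /\ G y = count_event nu 1 j A.
  (* The noise does not enter the event: as a count event, it takes each [A i] full or empty, at an
     arbitrary bucket. *)
  exists (fun=> Ordinal (bits_value_subproof q x0)).
  exists (fun i => if collision_hit R q' l y i then setT else set0).
  split=> [i|]; first by case: ifP => _; [exact: measurableT|exact: measurable0].
  apply/seteqP; split => om; rewrite /G /count_event /= => h;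
  apply: (leq_trans h); apply: leq_sum => i _.
    by case: ifP => // _; rewrite asboolT.
  by case: (collision_hit R q' l y i) => //=; case: asboolP.
have mG y : measurable (G y).
  by have [j [A [mA ->]]] := GE y; exact: measurable_count_event.
have fG y om : \1_(G y) om = (1 <= \sum_(i < r) collision_hit R q' l y i)%N%:R :> R.
  by rewrite indicE; congr (nat_of_bool _)%:R; apply/idP/idP; rewrite inE.
split.
  have [] := seed_partition rnd (G := fun v => G (gen H (codom v.2) v.1)) => //.
apply: le_trans (prob_output_scale (J := 'I_(2 ^ m')) _ GE _) _.
- by rewrite card_ord.
- move=> om; rewrite (_ : (fun y => _) =
    (fun y => (1 <= \sum_(i < r) collision_hit R q' l y i)%N%:R)).
    exact: tame_labelled_hits.
  by apply/funext => y; rewrite fG.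
have -> : 434 / scale R w = 2 / scale R w + 432 / scale R w by ring.
rewrite lerD2r.
apply: (@le_trans _ _ (iavg (b ^ k) (fun y =>
    (1 <= \sum_(i < r) collision_hit R q' l y i)%N%:R))).
  apply: ler_iavg => y _; have := fG y.
  case: (1 <= _)%N => /= fGy.
    by rewrite -lee_fin fineK ?fin_num_measure // probability_le1.
  rewrite (_ : G y = set0) ?measure0 //; apply/seteqP; split=> // om Gom.
  by have /eqP := fGy om; rewrite indicE mem_set // oner_eq0.
apply: le_trans (avg_collision_le R l q'_inj q'p rd) _.
apply: (@le_trans _ _ (scale R w / (scale R w ^+ 2 / 2))).
  apply: ler_pM; rewrite ?invr_ge0 ?ler0n //.
    by apply: le_trans bk; rewrite ler_nat.
  rewrite lef_pV2 ?posrE ?divr_gt0 ?exprn_gt0 ?ltr0n ?expn_gt0 //.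
  by rewrite ler_pdivrMr // mulrC.
by rewrite le_eqVlt; apply/orP; left; apply/eqP; field; rewrite gt_eqF.
Qed.

(* Truncating buckets only creates collisions; without any, the error of a row is
   the noise alone, as for the zero vector. *)
Lemma row_event_no_collision (m' : nat) (m'm : (m' <= m)%N) y om R1 a eps z :
  ~~ (1 <= \sum_(i < r) collision_hit R (q \o widen_ord m'm) l y i)%N ->
  row_event nu p q l R1 a eps z y om ->
  row_event nu p q l R1 a eps (fun=> 0) y om.
Proof.
rewrite -leqNgt leqn0 sum_nat_eq0 => /forallP no.
rewrite /row_event /count_event /= => /leq_trans; apply; apply: leq_sum => i _.
have -> : rsum l sg (block_bucket q) z (row_blocks d y i) =
    rsum l sg (block_bucket q) (fun=> 0) (row_blocks d y i); last by [].
rewrite /rsum; apply: eq_bigr => rho rl; rewrite mulr0 mul0r.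
case: eqVneq => [e|_]; last by rewrite mulr0.
have /implyP := no i; rewrite eqb0 => /(_ isT) /negP []; apply/collision_hitP.
exists rho => //; move: e; rewrite !ffunE => /(congr1 (@nat_of_ord _)) /= e.
have te := bits_value_inj (a := fun e => tnth _ (q e)) (b := fun e => tnth _ (q e)) e.
by apply: val_inj; apply: eq_bigr => j _ /=; rewrite te.
Qed.

Lemma sketch_tail_bound (x : 'rV[R]_d) (alpha : R) :
  let Delta := l2norm (tail (2 ^ m) x) / Num.sqrt (2 ^ m)%:R in
  0 <= sigma -> 0 < maxr Delta sigma -> 0 < alpha <= 1 ->
  let E := [set om |
    row_event nu p q l R0 (alpha * maxr Delta sigma) 1 (x 0) (out om) om \/
    row_event nu p q l R0 (alpha * maxr Delta sigma) (-1) (x 0) (out om) om] in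
  measurable E /\ fine (P E) <=
    2 * expR (- (2 * (spread R / 192) ^+ 2 * alpha ^+ 2 * r%:R)) + 2000 / scale R w.
Proof.
move=> Delta s0 M0 al; set a := alpha * _; set ex := expR _.
have sp : 0 < scale R w by apply: lt_le_trans s1.
have isp : 0 < (scale R w)^-1 by rewrite invr_gt0.
pose G z eps := [set om | row_event nu p q l R0 a eps z (out om) om].
have pos1 : (1 : R) = 1 \/ (1 : R) = -1 by left.
have neg1 : (-1 : R) = 1 \/ (-1 : R) = -1 by right.
have mG z eps : eps = 1 \/ eps = -1 -> measurable (G z eps).
  exact: measurable_row_event_output.
have mU z : measurable (G z 1 `|` G z (-1)) by apply: measurableU; apply: mG.
have D0 : 0 <= Delta by rewrite divr_ge0 ?sqrtr_ge0.
have [f1 f2] := @exp_floor_scale R w 2 isT isT.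
have s2 : 1 <= scale R w ^+ 2 by rewrite exprn_ege1.
move=> E; split; first exact: mU.
(* With at most [2 ^ (w %/ 32)] buckets there are few enough labels for a direct comparison. *)
case: (leqP m (w %/ 32)) => mw.
  have Js : #|{: 'I_(2 ^ m) * bool}|%:R <= 2 * scale R w ^+ 2.
    rewrite card_prod card_ord card_bool mulnC natrM ler_pM2l //.
    by apply: le_trans f1; rewrite ler_nat leq_exp2l.
  have bnd eps : eps = 1 \/ eps = -1 -> fine (P (G (x 0) eps)) <= ex + 432 / scale R w.
    move=> e1; apply: (row_event_prob_le Js) => //.
    - by move=> om; exact: tame_row_event.
    - exact: (card_heavy x (2 ^ m)).
    - by rewrite sum_light ?expn_gt0.
  apply: le_trans (fine_probU_le P (mG _ _ pos1) (mG _ _ neg1)) _.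
  by have := bnd _ pos1; have := bnd _ neg1; lra.
(* With more buckets, the first [w %/ 32] bits already exclude collisions up to [434 / scale], and
   two tests of the zero vector remain; [434 + 2 * 432 <= 2000]. *)
have m'm := ltnW mw.
have c_inj : injective (q \o widen_ord m'm).
  by move=> e e' /q_inj /(congr1 val) /= ?; exact: val_inj.
have cp e : (q \o widen_ord m'm) e != p by exact: qp.
have f1' : (2 ^ (w %/ 32))%:R <= 2 * scale R w ^+ 2.
  by apply: le_trans f1 _; lra.
have [mC Cle] := collision_prob_le c_inj cp f1' f2.
set C := [set om | _] in mC Cle.
have bnd eps : eps = 1 \/ eps = -1 -> fine (P (G (fun=> 0) eps)) <= ex + 432 / scale R w.
  move=> e1; apply: (@row_event_prob_le unit _ finset.set0) => //.
  - by rewrite card_unit; lra.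
  - by move=> om; exact: tame_row_event0.
  - by rewrite cards0.
  - rewrite big1 => [|rho _]; last by rewrite expr0n.
    by apply: mulr_ge0 => //; exact: sqr_ge0.
apply: (@le_trans _ _ (fine (P (C `|` (G (fun=> 0) 1 `|` G (fun=> 0) (-1)))))).
  apply: fine_prob_le; [exact: mU|exact: measurableU|].
  move=> om Eom; case: (boolP (1 <= \sum_(i < r)
      collision_hit R (q \o widen_ord m'm) l (out om) i)%N) => [c|c].
    by left.
  by right; case: Eom => h; [left|right]; exact: (row_event_no_collision c h).
apply: le_trans (fine_probU_le P mC (mU _)) _.
have := fine_probU_le P (mG (fun=> 0) _ pos1) (mG (fun=> 0) _ neg1).
by have := bnd _ pos1; have := bnd _ neg1; move: Cle; lra.
Qed.

End Sketch.

(** With a single bucket a heavy coordinate would always collide with the queried one, hence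
    [2 <= t]. If [Delta] and [sigma] both vanished, the event would have probability one, hence
    [0 < maxr Delta sigma]. *)
Theorem theorem7p2 (R : realType) :
  exists c c1 C : R, [/\ 0 < c, 0 < c1, 0 < C &
  forall (d m r w b k : nat) (hb : (2 <= b)%N) (sigma omega0 : R)
    (x : 'rV[R]_d)
    (p : 'I_w) (q : 'I_m -> 'I_w)
    (K : finType) (H : K -> block w -> block w)
    (disp : measure_display) (Omega : measurableType disp)
    (P : probability Omega R)
    (X : Omega -> block w) (key : 'I_k -> 'I_b -> Omega -> K)
    (nu : 'I_r -> 'I_(2 ^ m) -> {RV P >-> R}),
  let t := (2 ^ m)%N in
  let gamma (om : Omega) :=
    fastprg_block (ltnW hb) (fun i j => H (key i j om)) (X om) in
  let s (om : Omega) (i : 'I_r) (rho : 'I_d) : R :=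
    block_sign R p (hash_block (gamma om) i rho) in
  let g (om : Omega) (i : 'I_r) (rho : 'I_d) : 'I_t :=
    block_bucket q (hash_block (gamma om) i rho) in
  let PCS (om : Omega) : 'M[R]_(r, t) :=
    CS (g om) (s om) x + \matrix_(i, j) nu i j om in
  let xhat (om : Omega) (l : 'I_d) : R :=
    estimate (g om) (s om) (PCS om) l in
  let Delta : R := l2norm (tail t x) / Num.sqrt t%:R in
  (2 <= t)%N ->
  odd r ->
  0 <= sigma ->
  0 < maxr Delta sigma ->
  0 < omega0 ->
  omega0 * ln d%:R <= w%:R ->
  (r * d <= b ^ k)%N ->
  (b ^ k)%:R <= 2 `^ (c * w%:R) ->
  injective q ->
  (forall e, q e != p) ->
  two_wise_independent H ->
  pcs_randomness X key sigma nu ->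
  forall (alpha : R) (l : 'I_d),
    0 <= alpha <= 1 ->
    (P [set om | (alpha * maxr Delta sigma <= `|xhat om l - x 0 l|)%R]
     <= (2 * expR (- (c1 * alpha ^+ 2 * r%:R))
         + C * 2 `^ (- (c * w%:R)))%:E)%E].
Proof.
exists 64^-1, (2 * (spread R / 192) ^+ 2), 2000; split.
- by rewrite invr_gt0 ltr0n.
- by rewrite mulr_gt0 ?exprn_gt0 ?divr_gt0 ?spread_gt0 ?ltr0n.
- by rewrite ltr0n.
move=> d m r w b k hb sigma omega0 x p q K H disp Omega P X key nu t gamma s g
  PCS xhat Delta t2 odd_r s0 M0 _ _ rd bk q_inj qp H2 rnd alpha l /andP[al0 al1].
rewrite powRN [64^-1 * _]mulrC -/(scale R w) in bk *.
have m0 : (0 < m)%N by move: t2; rewrite /t; case: (m).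
have -> : [set om | (alpha * maxr Delta sigma <= `|xhat om l - x 0 l|)%R] =
    [set om |
    row_event nu p q l (r./2).+1 (alpha * maxr Delta sigma) 1 (x 0) (output X key H om) om \/
    row_event nu p q l (r./2).+1 (alpha * maxr Delta sigma) (-1) (x 0) (output X key H om) om].
  by apply/seteqP; split => om /=; rewrite (estimate_error hb H X key nu p q l rd odd_r om x).
have s1 := scale_ge1 R w.
case: (ltrgtP alpha 0) al0 => // [al0|->] _.
  have al : 0 < alpha <= 1 by rewrite al0.
  have [mE] := sketch_tail_bound hb rnd H2 l q_inj qp rd odd_r bk m0 s0 M0 al.
  by rewrite -lee_fin fineK ?fin_num_measure.
(* For [alpha = 0] the right-hand side is at least 2, so a probability at most 1 suffices. *)
have mE : measurable [set om |
    row_event nu p q l (r./2).+1 (0 * maxr Delta sigma) 1 (x 0) (output X key H om) om \/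
    row_event nu p q l (r./2).+1 (0 * maxr Delta sigma) (-1) (x 0) (output X key H om) om].
  by apply: measurableU; apply: (measurable_row_event_output H rnd); [left|right].
apply: le_trans (probability_le1 P mE) _.
rewrite expr0n /= mulr0 mul0r oppr0 expR0 lee_fin.
have : 0 <= 2000 / scale R w by rewrite divr_ge0 ?ler0n ?(le_trans ler01 s1).
by move: (2000 / _) => v; lra.
Qed.
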